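(* Let $p\in\mathbb{Z}[x]$ be a $k$-nomial of magnitude $(n,\tau)$, and let $I_j=(a_j,b_j)\subset\mathcal{I}:=(0,2^{\tau+1})$, with $j=1,\ldots,k_0$ and $a_j,b_j\in\mathbb{Q}$, be isolating intervals for all simple real roots of $p$ in $\mathcal{I}$. Let $L$ be an arbitrary positive integer. Then all intervals $I_j$ can be refined to a width less than $2^{-L}$ with a number of arithmetic operations over $\mathbb{Q}$ bounded by $$O\big(k^2\cdot\log n\cdot(\log n+\log(\tau+L))\big).$$
   Context: A $k$-nomial of magnitude $(n,\tau)$, with $n,k,\tau$ positive integers, is a polynomial in $\mathbb{Z}[x]$ of degree at most $n$ with at most $k$ non-vanishing coefficients, each of absolute value less than $2^\tau$; it is given by its sparse representation, i.e. the list of pairs (exponent, coefficient) of its non-zero terms. Isolating intervals for a set of roots of $p$ are pairwise disjoint open intervals, one for each root in the set, such that the interval belonging to a root contains that root and no other root of $p$. To refine an isolating interval $I_j$ for a root $\xi$ to a width less than $2^{-L}$ means to compute an interval $I_j'\subset I_j$ with rational endpoints, of width less than $2^{-L}$, that contains $\xi$ (a degenerate interval $[m,m]$ with $m=\xi\in\mathbb{Q}$ is allowed). An arithmetic operation over $\mathbb{Q}$ is an addition, subtraction, multiplication, division or comparison of two rational numbers, counted at unit cost. Logarithms are to base $2$, and in asymptotic bounds logarithmic factors are read as being at least $1$. The refinement is carried out by a deterministic algorithm. *)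

(* Defs.v *)
From HB Require Import structures.
From mathcomp Require Import all_boot all_order all_algebra.
From mathcomp Require Import all_classical all_reals all_analysis.
Set Implicit Arguments. Unset Strict Implicit. Unset Printing Implicit Defensive.
Import Order.TTheory GRing.Theory Num.Theory.
Local Open Scope classical_set_scope.
Local Open Scope ring_scope.

(** * Sparse polynomials *)

Definition knomial (k n tau : nat) (p : {poly int}) : Prop :=
  [/\ (size p <= n.+1)%N, (count (predC1 0%R) p <= k)%N
    & forall i : nat, `|p`_i| < 2 ^+ tau].

(* The order in which the terms are listed is left unspecified. *)
Definition sparse_repr (p : {poly int}) (s : seq (nat * int)) : Prop :=
  perm_eq s [seq (i, p`_i) | i <- iota 0 (size p) & p`_i != 0].

(** * Real roots and isolating intervals *)

Section Roots.
Variable R : realType.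

Definition real_poly (p : {poly int}) : {poly R} := map_poly intr p.

(* [mup x q] is the multiplicity of [x] as a root of [q]; it is [0] for [q = 0]. *)
Definition simple_roots (p : {poly int}) (D : set R) : set R :=
  [set x | D x /\ mup x (real_poly p) = 1%N].

Definition oint (a b : rat) : set R := `]ratr a, ratr b[%classic.

(* [xi] enumerates the set [S] of roots, and [xi j] is the root belonging to
   the interval [(a j, b j)]. *)
Definition isolating (p : {poly int}) (S : set R) (m : nat)
    (a b : 'I_m -> rat) (xi : 'I_m -> R) : Prop :=
  [/\ injective xi, range xi = S,
      forall j, oint (a j) (b j) (xi j),
      forall j x, oint (a j) (b j) x -> root (real_poly p) x -> x = xi j
    & trivIset [set: 'I_m] (fun j => oint (a j) (b j))].

(* A pair [(a, a)] stands for the degenerate interval [[a, a]], a pair [(a, b)]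
   with [a != b] for the open interval [(a, b)]. *)
Definition rint (a b : rat) : set R :=
  if a == b then [set ratr a] else oint a b.

Definition refines (L : nat) (a b a' b' : rat) (x : R) : Prop :=
  [/\ rint a' b' `<=` oint a b, rint a' b' x & b' - a' < 2 ^- L].

(* Binary logarithm, read as being at least 1. *)
Definition lg (m : nat) : R := Num.max 1 (ln m%:R / ln 2).

End Roots.

(** * Random access machines over the rationals

  All numerical data lie in a memory of rational cells.  The natural number
  registers only serve for addressing and control flow; the only way in which
  they can depend on the contents of the rational memory is through
  comparisons.  Each operation [+, -, *, /] and each comparison on rational
  cells costs 1; nothing else is charged. *)

Inductive nexp : Type :=
| NLit of nat
| NReg of nat
| NAdd of nexp & nexp
| NSub of nexp & nexp. (* truncated *)

Inductive qop : Type := QAdd | QSub | QMul | QDiv.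

(* In [QLit], [QCopy], [QOp] the first expression is the address of the target
   cell, the following ones are addresses of source cells. [QCmp r x y] sets
   register [r] to the outcome of a comparison of two cells. *)
Inductive cmd : Type :=
| Skip
| NSet of nat & nexp
| QLit of nexp & rat
| QCopy of nexp & nexp
| QOp of qop & nexp & nexp & nexp
| QCmp of nat & nexp & nexp
| Seq of cmd & cmd
| If of nexp & cmd & cmd
| While of nexp & cmd.

Record state : Type := State { nreg : nat -> nat; qmem : nat -> rat }.

Fixpoint neval (st : state) (e : nexp) : nat :=
  match e with
  | NLit c => c
  | NReg r => nreg st r
  | NAdd e1 e2 => (neval st e1 + neval st e2)%N
  | NSub e1 e2 => (neval st e1 - neval st e2)%N
  end.

Definition qeval (st : state) (e : nexp) : rat := qmem st (neval st e).

Definition set_nreg (st : state) (r v : nat) : state :=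
  State [eta nreg st with r |-> v] (qmem st).

Definition set_qmem (st : state) (d : nexp) (v : rat) : state :=
  State (nreg st) [eta qmem st with neval st d |-> v].

Definition apply_qop (o : qop) (x y : rat) : rat :=
  match o with
  | QAdd => x + y
  | QSub => x - y
  | QMul => x * y
  | QDiv => x / y
  end.

Definition qdefined (o : qop) (y : rat) : bool :=
  if o is QDiv then y != 0 else true.

Definition cmp_code (x y : rat) : nat :=
  if x < y then 0%N else if x == y then 1%N else 2%N.

(* [exec c st t st']: started in [st], the program [c] halts in [st'] after [t]
   arithmetic operations.  Division by zero blocks the execution. *)
Inductive exec : cmd -> state -> nat -> state -> Prop :=
| ESkip st : exec Skip st 0 st
| ENSet r e st : exec (NSet r e) st 0 (set_nreg st r (neval st e))
| EQLit d q st : exec (QLit d q) st 0 (set_qmem st d q)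
| EQCopy d x st : exec (QCopy d x) st 0 (set_qmem st d (qeval st x))
| EQOp o d x y st : qdefined o (qeval st y) ->
    exec (QOp o d x y) st 1
      (set_qmem st d (apply_qop o (qeval st x) (qeval st y)))
| EQCmp r x y st :
    exec (QCmp r x y) st 1 (set_nreg st r (cmp_code (qeval st x) (qeval st y)))
| ESeq c1 c2 st t1 st1 t2 st2 :
    exec c1 st t1 st1 -> exec c2 st1 t2 st2 ->
    exec (Seq c1 c2) st (t1 + t2) st2
| EIfTrue e c1 c2 st t st' : neval st e != 0%N -> exec c1 st t st' ->
    exec (If e c1 c2) st t st'
| EIfFalse e c1 c2 st t st' : neval st e == 0%N -> exec c2 st t st' ->
    exec (If e c1 c2) st t st'
| EWhileStop e c st : neval st e == 0%N -> exec (While e c) st 0 st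
| EWhileStep e c st t1 st1 t2 st2 : neval st e != 0%N ->
    exec c st t1 st1 -> exec (While e c) st1 t2 st2 ->
    exec (While e c) st (t1 + t2) st2.

(* The machine is deterministic, so that the existence of a halting execution
   with some result and cost determines both. *)
Lemma exec_det c st t1 st1 t2 st2 :
  exec c st t1 st1 -> exec c st t2 st2 -> t1 = t2 /\ st1 = st2.
Proof.
move=> H; elim: H t2 st2 => {c st t1 st1}.
- by move=> st t2 st2 H; inversion H.
- by move=> r e st t2 st2 H; inversion H.
- by move=> d q st t2 st2 H; inversion H.
- by move=> d x st t2 st2 H; inversion H.
- by move=> o d x y st _ t2 st2 H; inversion H.
- by move=> r x y st t2 st2 H; inversion H.
- move=> c1 c2 st t1 st1 t2 st2 _ IH1 _ IH2 t st' H.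
  inversion H as [| | | | | |? ? ? u1 s1 u2 s2 E1 E2| | | |]; subst.
  by case: (IH1 _ _ E1) => ? ?; subst; case: (IH2 _ _ E2) => ? ?; subst.
- move=> e c1 c2 st t st' ne0 _ IH t2 st2 H.
  inversion H as [| | | | | | |? ? ? ? ? ? Z E|? ? ? ? ? ? Z E| |]; subst.
    exact: IH.
  by rewrite Z in ne0.
- move=> e c1 c2 st t st' e0 _ IH t2 st2 H.
  inversion H as [| | | | | | |? ? ? ? ? ? Z E|? ? ? ? ? ? Z E| |]; subst.
    by rewrite e0 in Z.
  exact: IH.
- move=> e c st e0 t2 st2 H.
  inversion H as [| | | | | | | | | |? ? ? ? ? ? ? Z]; subst => //.
  by rewrite e0 in Z.
- move=> e c st t1 st1 t2 st2 ne0 _ IH1 _ IH2 t st' H.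
  inversion H as [| | | | | | | | |? ? ? Z|? ? ? u1 s1 u2 s2 Z E1 E2]; subst.
    by rewrite Z in ne0.
  by case: (IH1 _ _ E1) => ? ?; subst; case: (IH2 _ _ E2) => ? ?; subst.
Qed.

(** * Input and output conventions

  Initially, register 0 holds the number of terms, register 1 the number of
  intervals and all other registers 0.  The rational memory starts with [L],
  followed by the terms (exponent, then coefficient) and by the intervals (left
  endpoint, then right endpoint), and is 0 elsewhere.  The refined intervals
  replace the given ones in place. *)

Definition input_cells (s : seq (nat * int)) (m : nat) (a b : 'I_m -> rat)
    (L : nat) : seq rat :=
  L%:R :: flatten [seq [:: t.1%:R; t.2%:~R] | t <- s]
       ++ flatten [seq [:: a j; b j] | j <- enum 'I_m].

Definition init_state (s : seq (nat * int)) (m : nat) (a b : 'I_m -> rat)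
    (L : nat) : state :=
  State (nth 0%N [:: size s; m]) (nth 0 (input_cells s a b L)).

Definition left_end (s : seq (nat * int)) (st : state) (j : nat) : rat :=
  qmem st (1 + 2 * size s + 2 * j)%N.

Definition right_end (s : seq (nat * int)) (st : state) (j : nat) : rat :=
  qmem st (2 + 2 * size s + 2 * j)%N.

Lemma left_end_init s m (a b : 'I_m -> rat) L (j : 'I_m) :
  left_end s (init_state s a b L) j = a j.
Proof.
rewrite /left_end [(1 + _)%N]add1n addSn /= nth_cat.
have szf (T : Type) (f g : T -> rat) (l : seq T) :
    size (flatten [seq [:: f t; g t] | t <- l]) = (2 * size l)%N.
  by elim: l => //= x l ->; rewrite mulnS.
have nthf (l : seq 'I_m) x0 i : (i < size l)%N ->
    nth 0 (flatten [seq [:: a t; b t] | t <- l]) (2 * i) = a (nth x0 l i).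
  by elim: l i => [|x l IH] [|i] // lt_il; rewrite mulnS add2n /= IH.
rewrite szf ltnNge leq_addr /= addKn (nthf _ j) ?size_enum_ord //.
by rewrite nth_ord_enum.
Qed.

Lemma right_end_init s m (a b : 'I_m -> rat) L (j : 'I_m) :
  right_end s (init_state s a b L) j = b j.
Proof.
rewrite /right_end [(2 + _)%N]add2n !addSn /= -addnS nth_cat.
have szf (T : Type) (f g : T -> rat) (l : seq T) :
    size (flatten [seq [:: f t; g t] | t <- l]) = (2 * size l)%N.
  by elim: l => //= x l ->; rewrite mulnS.
have nthf (l : seq 'I_m) x0 i : (i < size l)%N ->
    nth 0 (flatten [seq [:: a t; b t] | t <- l]) (2 * i).+1 = b (nth x0 l i).
  by elim: l i => [|x l IH] [|i] // lt_il; rewrite mulnS add2n /= IH.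
rewrite szf ltnNge leq_addr /= addKn (nthf _ j) ?size_enum_ord //.
by rewrite nth_ord_enum.
Qed.

(* Main.v *)
Require Import Defs.
From HB Require Import structures.
From mathcomp Require Import all_boot all_order all_algebra.
From mathcomp Require Import all_classical all_reals all_analysis.
From mathcomp Require Import perm complex.
From mathcomp Require Import ring lra zify.
Set Implicit Arguments. Unset Strict Implicit. Unset Printing Implicit Defensive.
Import Order.TTheory GRing.Theory Num.Theory.
Local Open Scope classical_set_scope.
Local Open Scope ring_scope.

(* An interval is refined by cuts at rational points, each decided by the sign
   of [p], that is by one evaluation with O(k log n) operations.  If no complex
   root other than those in a small disc about [xi] is closer to [xi] than
   128 deg(p) w T, where [w] is the width of the interval, then a Schroeder step
   started at distance about [w] from [xi] gains a factor [T].  A round tries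
   T = 2^(2^i) for increasing and then for decreasing i, in
   O(log n + log (tau + L)) steps, followed by O(log n) bisections.  If it does
   not finish the refinement, then there is a root [z <> xi] whose distance to
   [xi] is, up to a factor O(deg p), between the widths after and before the
   steps of the round; the bisections separate these scales for different
   rounds.

   A geometric search at the start makes the interval so narrow compared with
   [xi] that all these roots [z] lie in a thin cone about the positive real
   axis.  Such a cone contains fewer than k distinct roots: a determinant with
   entries z_j^(e_i) is the Vandermonde product times a sum of monomials in the
   z_j with positive coefficients, and all these monomials point nearly in the
   direction of the positive axis.

   Finally, the rounds of all intervals together are at most O(k): move the
   roots [z] to the real line, and charge a round to the largest gap between
   consecutive points that lies between [xi] and [z].  The scales of a fixed
   [xi] decrease so fast, and the intervals are disjoint, so that no gap is
   charged more than twice. *)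
(** * Complex roots of sparse polynomials near the positive real axis *)

(** The number of complex roots close to [xi] is unknown, and towards such a cluster Newton's step
    for [p] would converge only linearly. Schroeder's step is Newton's step for [p / p'], which
    treats a cluster of any size like one simple root. No step is tested for success: cuts keep [xi]
    enclosed wherever their points fall, so a failed step costs operations but does no harm, and
    success matters only for the number of rounds. The sign of [p] left of [xi] is needed as a
    reference, but the given left endpoint may itself be a root of [p]. In that case the sign is
    taken slightly to its right, at a distance justified by a root separation bound. Charging rounds
    to arbitrary complex roots would bring in the degree; the cone is what replaces it by the number
    of terms. The analysis concerns functions on pairs of rationals in which [xi] serves as an
    oracle; programs are then shown to compute these functions at a stated cost. Neither [n] nor
    [tau] is part of the input: the exponents take the place of [n], and the number of powers T is
    found by comparison with the right endpoint. *)

Section ThinCone.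
Import ComplexField.Normc.
Local Open Scope complex_scope.

(** * The complex modulus, and products of numbers close to the positive axis *)

Section ComplexModulus.
Variable R : rcfType.
Implicit Types (x y z s : R[i]) (r : R).

Lemma normc_ge0 x : 0 <= normc x.
Proof. by case: x => a b; rewrite /normc sqrtr_ge0. Qed.

Lemma normc_eq0 x : (normc x == 0) = (x == 0).
Proof. by apply/eqP/eqP => [/eq0_normc|->] //; rewrite normc0. Qed.

Lemma normc_gt0 x : (0 < normc x) = (x != 0).
Proof. by rewrite lt_def normc_ge0 normc_eq0 andbT. Qed.

Lemma normc_sub x y : normc (x - y) = normc (y - x).
Proof. by rewrite -normcN opprB. Qed.

Lemma normc_real r : normc r%:C = `|r|.
Proof. by rewrite /normc /= expr0n /= addr0 sqrtr_sqr. Qed.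

Lemma normc_Re z : `|complex.Re z| <= normc z.
Proof.
case: z => a b /=; rewrite -sqrtr_sqr ler_wsqrtr // lerDl sqr_ge0 //.
Qed.

Lemma normc_Im z : `|complex.Im z| <= normc z.
Proof.
case: z => a b /=; rewrite -sqrtr_sqr ler_wsqrtr // lerDr sqr_ge0 //.
Qed.

Lemma normc_ReIm z : normc z <= `|complex.Re z| + `|complex.Im z|.
Proof.
case: z => a b /=; rewrite -[leRHS]ger0_norm ?addr_ge0 // -[leRHS]sqrtr_sqr.
rewrite ler_wsqrtr // sqrrD !real_normK ?num_real //.
have : 0 <= `|a| * `|b| *+ 2 by rewrite mulrn_wge0 ?mulr_ge0.
lra.
Qed.

Section Aperture.
Variable t : R.
Hypothesis t_ge0 : 0 <= t.

(* [near_ray M r s]: [s] lies where a product of [M] factors [a (1 + e)] with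
   [a > 0] and [|e| <= t] may lie, [r] being the product of the [a]. *)
Definition near_ray (M : nat) (r : R) (s : R[i]) : Prop :=
  0 <= r /\ normc (s - r%:C) <= ((1 + t) ^+ M - 1) * r.

Lemma near_ray0 M : near_ray M 0 0.
Proof. by rewrite /near_ray subrr normc0 mulr0. Qed.

Lemma near_ray1 : near_ray 0 1 1.
Proof. by rewrite /near_ray rmorph1 subrr normc0 expr0 subrr mul0r. Qed.

(** The pairs [(r, s)] form a convex cone. Together with [near_ray_neq0] this rules out cancellation
    in sums of monomials with positive coefficients. *)
Lemma near_rayD M r1 s1 r2 s2 : near_ray M r1 s1 -> near_ray M r2 s2 ->
  near_ray M (r1 + r2) (s1 + s2).
Proof.
move=> [h1 h2] [h3 h4]; split; first exact: addr_ge0.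
rewrite rmorphD /= opprD addrACA mulrDr.
exact: le_trans (le_normcD _ _) (lerD _ _).
Qed.

(** With [u = (1 + t) ^+ M1] and [v = (1 + t) ^+ M2], the modulus of [s1] is at most [u r1], so the
    error of the product is at most [u r1 (v - 1) r2 + (u - 1) r1 r2 = (u v - 1) r1 r2]. *)
Lemma near_rayM M1 M2 r1 s1 r2 s2 : near_ray M1 r1 s1 -> near_ray M2 r2 s2 ->
  near_ray (M1 + M2) (r1 * r2) (s1 * s2).
Proof.
move=> [h1 h2] [h3 h4]; split; first exact: mulr_ge0.
have -> : s1 * s2 - (r1 * r2)%:C = s1 * (s2 - r2%:C) + (s1 - r1%:C) * r2%:C.
  by rewrite rmorphM; ring.
apply: le_trans (le_normcD _ _) _; rewrite !normcM normc_real.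
rewrite (ger0_norm h3) exprD.
set u := (1 + t) ^+ M1 in h2 *; set v := (1 + t) ^+ M2 in h4 *.
have hs : normc s1 <= u * r1.
  have -> : s1 = (s1 - r1%:C) + r1%:C by ring.
  apply: le_trans (le_normcD _ _) _; rewrite normc_real (ger0_norm h1).
  by apply: le_trans (lerD h2 (lexx _)) _; lra.
have := ler_pM (normc_ge0 _) (normc_ge0 _) hs h4.
have := ler_wpM2r h3 h2.
lra.
Qed.

Lemma near_rayX M n r s : near_ray M r s -> near_ray (n * M) (r ^+ n) (s ^+ n).
Proof.
move=> h; elim: n => [|n IH]; first exact: near_ray1.
by rewrite !exprS mulSn; apply: near_rayM.
Qed.

Lemma near_ray_mono M1 M2 r s : (M1 <= M2)%N -> near_ray M1 r s ->
  near_ray M2 r s.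
Proof.
move=> leM [h1 h2]; split => //; apply: le_trans h2 _.
by rewrite ler_wpM2r // lerB // ler_weXn2l // lerDl.
Qed.

Lemma near_ray_neq0 M r s : (1 + t) ^+ M < 2 -> 0 < r -> near_ray M r s ->
  s != 0.
Proof.
move=> hM r0 [_ h]; apply/eqP => s0; move: h.
rewrite s0 sub0r normcN normc_real gtr0_norm //; nra.
Qed.

End Aperture.
End ComplexModulus.

(** * Generalized Vandermonde determinants *)

Section PowerMatrix.
Variable F : fieldType.

(** Multilinearity in the rows: [f] picks one summand of the sum in each row. *)
Lemma det_row_sums m (J : finType) (Q : 'I_m -> pred J) (G : 'I_m -> J -> 'rV[F]_m) :
  \det (\matrix_i \sum_(a | Q i a) G i a)
    = \sum_(f in family Q) \det (\matrix_i G i (f i)).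
Proof.
rewrite /determinant exchange_big /=; apply: eq_bigr => s _.
rewrite -big_distrr /=; congr (_ * _).
transitivity (\prod_i \sum_(a | Q i a) G i a 0 (s i)).
  by apply: eq_bigr => i _; rewrite mxE summxE.
rewrite bigA_distr_big_dep; apply: eq_bigr => f _.
by apply: eq_bigr => i _; rewrite mxE.
Qed.

Definition pow_mx m (z : 'I_m -> F) (e : 'I_m -> nat) : 'M[F]_m :=
  \matrix_(i, j) z j ^+ e i.

Lemma subrXX_interval (x y : F) (a b N : nat) : (a <= b)%N -> (b <= N)%N ->
  x ^+ b - y ^+ (b - a) * x ^+ a
    = (x - y) * \sum_(c < N | (a <= c < b)%N) y ^+ (b.-1 - c) * x ^+ c.
Proof.
move=> ab bN.
pose G c := y ^+ (b.-1 - c) * x ^+ c.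
have -> : \sum_(c < N | (a <= c < b)%N) y ^+ (b.-1 - c) * x ^+ c =
    \sum_(a <= c < b) G c.
  rewrite -(big_mkord (fun c => (a <= c < b)%N) G).
  by rewrite [RHS](big_nat_widenl _ 0) // [RHS](big_nat_widen _ _ N).
rewrite -[in X in (_ - _) * X](add0n a) big_addn big_mkord /G.
rewrite -{1}(subnK ab) exprD -mulrBl subrXX -mulrA mulr_suml; congr (_ * _).
rewrite (reindex_inj rev_ord_inj) /=; apply: eq_bigr => i _.
have hi := ltn_ord i.
rewrite mulrAC -exprD mulrC; congr (_ ^+ _ * _ ^+ _); lia.
Qed.

(** Row operations clear the first column below its top entry. What remains in a later column is
    [z_j ^ b - z0 ^ (b - a) z_j ^ a] for consecutive exponents [a < b], and this is [z_j - z0] times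
    a sum of monomials with exponents [a <= c < b] of [z_j]. Multilinearity then gives determinants
    of the same kind with exponents interlacing the old ones: the branching rule of Schur
    polynomials. *)
Lemma det_pow_mx_rec m (z : 'I_m.+1 -> F) (e : 'I_m.+1 -> nat) (N : nat) :
  (forall i j : 'I_m.+1, (i < j)%N -> (e i < e j)%N) ->
  (forall i, e i <= N)%N ->
  let w (j : 'I_m) : 'I_m.+1 := widen_ord (leqnSn m) j in
  \det (pow_mx z e) =
    z ord0 ^+ e ord0 * (\prod_(j < m) (z (lift ord0 j) - z ord0)) *
    \sum_(f in family (fun (i : 'I_m) (c : 'I_N) =>
                 (e (w i) <= c < e (lift ord0 i))%N))
      (\prod_(i < m) z ord0 ^+ ((e (lift ord0 i)).-1 - f i)) *
      \det (pow_mx (z \o lift ord0) (fun i => nat_of_ord (f i))).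
Proof.
move=> einc eN w; set z0 := z ord0.
(* Left multiplication by [L] subtracts from each row but the top one the row above it, times [z0]
   to the difference of their exponents. *)
pose L : 'M[F]_m.+1 := \matrix_(i, j)
  ((i == j)%:R - (i == j.+1 :> nat)%:R * z0 ^+ (e i - e j)).
have detL : \det L = 1.
  rewrite det_trig.
    by apply: big1 => i _; rewrite mxE eqxx ltn_eqF // mul0r subr0.
  apply/is_trig_mxP => i j ij; rewrite mxE.
  have -> : (i == j) = false by apply/negP => /eqP h; rewrite h ltnn in ij.
  by rewrite ltn_eqF ?mul0r ?subrr // ltnW.
have LA0 k : (L *m pow_mx z e) ord0 k = z k ^+ e ord0.
  rewrite mxE (bigD1 ord0) //= big1 ?addr0; last first.
    by move=> j j0; rewrite !mxE eq_sym (negPf j0) /= mul0r subr0 mul0r.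
  by rewrite !mxE /= mul0r subr0 mul1r.
have LAS (i : 'I_m) k : (L *m pow_mx z e) (lift ord0 i) k =
    z k ^+ e (lift ord0 i) - z0 ^+ (e (lift ord0 i) - e (w i)) * z k ^+ e (w i).
  have ne : w i != lift ord0 i.
    by rewrite -(inj_eq val_inj) /= ltn_eqF // /bump leq0n.
  rewrite mxE (bigD1 (lift ord0 i)) //= (bigD1 (w i)) //= big1 ?addr0; last first.
    move=> j /andP[j1 j2]; rewrite !mxE eq_sym (negPf j1) /= /bump leq0n add1n eqSS.
    have -> : (i == j :> nat) = false.
      by apply: contraNF j2 => /eqP h; apply/eqP/val_inj.
    by rewrite mul0r subr0 mul0r.
  rewrite !mxE eqxx /= /bump leq0n add1n eqxx.
  rewrite (ltn_eqF (n := i.+2)) // mul0r subr0 mul1r mul1r.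
  by rewrite eq_sym (negPf ne) sub0r mulNr.
have -> : \det (pow_mx z e) = \det (L *m pow_mx z e).
  by rewrite det_mulmx detL mul1r.
rewrite (expand_det_col _ ord0) (bigD1 ord0) //=.
rewrite big1 ?addr0 => [|i]; last first.
  rewrite eq_sym => /unlift_some[j -> _]; rewrite LAS -exprD subnK ?subrr ?mul0r //.
  by rewrite ltnW // einc.
rewrite LA0 -mulrA; congr (_ * _).
rewrite /cofactor /= expr0 mul1r.
(* [B] is the remaining minor after division of each column by its factor [z_j - z0], with rows
   written as sums over the interlacing exponents. *)
pose B : 'M[F]_m := \matrix_i \sum_(c < N | (e (w i) <= c < e (lift ord0 i))%N)
  \row_j (z0 ^+ ((e (lift ord0 i)).-1 - c) * z (lift ord0 j) ^+ c).
have -> : row' ord0 (col' ord0 (L *m pow_mx z e)) =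
    B *m diag_mx (\row_j (z (lift ord0 j) - z0)).
  apply/matrixP => i j; rewrite mul_mx_diag [in LHS]mxE [in LHS]mxE LAS.
  rewrite !mxE (subrXX_interval _ _ (N := N)) //; last by rewrite ltnW // einc.
  rewrite mulrC; congr (_ * _); rewrite summxE; apply: eq_bigr => c _.
  by rewrite mxE.
rewrite det_mulmx det_diag mulrC; congr (_ * _).
  by apply: eq_bigr => j _; rewrite mxE.
rewrite det_row_sums; apply: eq_bigr => f _.
pose D := diag_mx (\row_(i < m) z0 ^+ ((e (lift ord0 i)).-1 - f i)).
have -> : (\matrix_i \row_j (z0 ^+ ((e (lift ord0 i)).-1 - f i) *
     z (lift ord0 j) ^+ f i)) = D *m pow_mx (z \o lift ord0) (fun i => nat_of_ord (f i)).
  by apply/matrixP => i j; rewrite mul_diag_mx !mxE.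
rewrite det_mulmx det_diag; congr (_ * _).
by apply: eq_bigr => j _; rewrite mxE.
Qed.

End PowerMatrix.

(** * Distinct roots in a thin cone *)

Section ThinRoots.
Variables (R : rcfType) (t : R).
Hypothesis t_ge0 : 0 <= t.

Lemma near_ray_sum_gt0 M (I : finType) (P : pred I) (s : I -> R[i]) (i0 : I) :
  P i0 -> (forall i, P i -> exists2 r, 0 < r & near_ray t M r (s i)) ->
  exists2 r, 0 < r & near_ray t M r (\sum_(i | P i) s i).
Proof.
move=> Pi0 h; rewrite (bigD1 i0) //=.
have [r r0 hr] := h _ Pi0.
have [r' hr'] : exists r', near_ray t M r' (\sum_(i | P i && (i != i0)) s i).
  elim/big_ind: _.
  - by exists 0; apply: near_ray0.
  - by move=> s1 s2 [r1 h1] [r2 h2]; exists (r1 + r2); apply: near_rayD.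
  - by move=> i /andP[/h [ri _ hi] _]; exists ri.
exists (r + r'); last exact: near_rayD.
by case: hr' => r'0 _; apply: ltr_wpDr.
Qed.

(** Bounds the total degree in [z ord0] of the factors picked up in one step of the recursion, since
    the ranges of the new exponents are consecutive. *)
Lemma ord_telescope_le n (u : 'I_n.+1 -> nat) :
  (forall i : 'I_n, u (widen_ord (leqnSn n) i) <= u (lift ord0 i))%N ->
  (\sum_(i < n) (u (lift ord0 i) - u (widen_ord (leqnSn n) i)) <= u ord_max)%N.
Proof.
move=> hu; pose v k := u (inord k).
have vE (i : 'I_n) : v i = u (widen_ord (leqnSn n) i) /\ v i.+1 = u (lift ord0 i).
  by split; congr u; apply: val_inj; rewrite /= inordK ?ltnS ?(ltnW (ltn_ord i)) ?ltn_ord.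
have -> : (\sum_(i < n) (u (lift ord0 i) - u (widen_ord (leqnSn n) i)) =
    \sum_(0 <= k < n) (v k.+1 - v k))%N.
  by rewrite big_mkord; apply: eq_bigr => i _; have [-> ->] := vE i.
have -> : u ord_max = v n by congr u; apply: val_inj; rewrite /= inordK.
rewrite telescope_sumn_in ?leq_subr // => i /andP[_ lt_in].
by have [-> ->] := vE (Ordinal lt_in).
Qed.

(** [V] is the Vandermonde product, chosen before [e] so that it factors out of the whole sum in the
    recursion; [S] is the value of a Schur polynomial. One step contributes at most [N] factors
    [z ord0] in front of the sum and at most [N] inside it, hence the aperture exponent
    [m * (N + N)]. *)
Lemma det_pow_mx_pos N m (z : 'I_m -> R[i]) (x : 'I_m -> R) :
  (forall i, 0 < x i) -> (forall i, near_ray t 1 (x i) (z i)) ->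
  injective z ->
  exists2 V : R[i], V != 0 & forall e : 'I_m -> nat,
    (forall i j : 'I_m, (i < j)%N -> (e i < e j)%N) ->
    (forall i, e i <= N)%N ->
    exists r S, [/\ 0 < r, near_ray t (m * (N + N)) r S
                  & \det (pow_mx z e) = V * S].
Proof.
elim: m z x => [|m IH] z x x0 xz zinj.
  exists 1; first exact: oner_neq0.
  move=> e _ _; exists 1, 1; split => //; last by rewrite det_mx00 mul1r.
  exact: near_ray1.
have [||i j /zinj/lift_inj //|V V0 hV] := IH (z \o lift ord0) (x \o lift ord0).
- by move=> i; apply: x0.
- by move=> i; apply: xz.
exists ((\prod_(j < m) (z (lift ord0 j) - z ord0)) * V).
  rewrite mulf_neq0 //; apply/prodf_neq0 => j _; rewrite subr_eq0.
  by apply/eqP => /zinj.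
move=> e einc eN; rewrite (det_pow_mx_rec _ einc eN).
set w := widen_ord (leqnSn m).
pose Q (i : 'I_m) (c : 'I_N) := (e (w i) <= c < e (lift ord0 i))%N.
pose d (f : {ffun 'I_m -> 'I_N}) := \det (pow_mx (z \o lift ord0) (fun i => nat_of_ord (f i))).
pose c (f : {ffun 'I_m -> 'I_N}) := \prod_(i < m) z ord0 ^+ ((e (lift ord0 i)).-1 - f i).
have ew i : (e (w i) < e (lift ord0 i))%N by apply: einc.
have [f0 f0Q] : exists f0, f0 \in family Q.
  have lt i : (e (w i) < N)%N by apply: leq_trans (ew i) (eN _).
  exists [ffun i => Ordinal (lt i)].
  by apply/familyP => i; rewrite ffunE unfold_in /= leqnn ew.
have [r r0 hr] : exists2 r, 0 < r &
    near_ray t (N + m * (N + N)) r (\sum_(f in family Q) c f * (d f / V)).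
  apply: (near_ray_sum_gt0 f0Q) => f /familyP fQ.
  have hf i : (e (w i) <= f i < e (lift ord0 i))%N by apply: (fQ i).
  have [i j ij|i|r [S [r0 hS dE]]] := hV (fun i => nat_of_ord (f i)).
  (* The half-open ranges of the [f i] are consecutive, so these exponents increase strictly, as the
     induction hypothesis requires. *)
  - have /andP[_ h1] := hf i; have /andP[h2 _] := hf j.
    apply: leq_trans h1 (leq_trans _ h2).
    have [->|ne] := eqVneq (lift ord0 i) (w j); first exact: leqnn.
    apply/ltnW/einc; move: ne; rewrite -(inj_eq val_inj) /= /bump leq0n add1n.
    by move=> ne; rewrite ltn_neqAle ne ij.
  - exact: ltnW.
  rewrite /d dE mulrAC mulfV // mul1r.
  pose g := (\sum_(i < m) ((e (lift ord0 i)).-1 - f i))%N.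
  exists (x ord0 ^+ g * r); first by rewrite mulr_gt0 ?exprn_gt0.
  apply: near_rayM => //.
  have -> : c f = z ord0 ^+ g by rewrite /c /g -prodrXr.
  apply: (@near_ray_mono _ _ _ (g * 1)) => //; last exact: near_rayX.
  rewrite muln1 /g.
  apply: leq_trans (eN ord_max).
  apply: leq_trans (ord_telescope_le (u := e) (fun i => ltnW (ew i))).
  apply: leq_sum => i _.
  by have /andP[h1 h2] := hf i; rewrite /w in h1 *; lia.
exists (x ord0 ^+ e ord0 * r), (z ord0 ^+ e ord0 * \sum_(f in family Q) c f * (d f / V)).
split; first by rewrite mulr_gt0 ?exprn_gt0.
  rewrite mulSn -addnA; apply: near_rayM => //.
  apply: (@near_ray_mono _ _ _ (e ord0 * 1)) => //; last exact: near_rayX.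
  by rewrite muln1.
have -> : \sum_(f in family Q) c f * d f = V * \sum_(f in family Q) c f * (d f / V).
  rewrite mulr_sumr; apply: eq_bigr => f _.
  by rewrite mulrCA; congr (_ * _); rewrite mulrC divfK.
by rewrite -!mulrA mulrCA; congr (_ * _); rewrite mulrCA.
Qed.

(** If there were at least as many roots as terms, the row of nonzero coefficients would be
    annihilated by an invertible power matrix. *)
Lemma thin_roots_lt N (P : {poly R[i]}) (Z : seq R[i]) :
  let es := [seq i <- iota 0 (size P) | P`_i != 0] in
  P != 0 -> (size P <= N.+1)%N -> uniq Z -> all (root P) Z ->
  (forall z, z \in Z -> exists2 x, 0 < x & near_ray t 1 x z) ->
  (1 + t) ^+ (size es * (N + N)) < 2 ->
  (size Z < size es)%N.
Proof.
move=> es P0 sP Zu Zr Zthin ht; rewrite ltnNge; apply/negP => le_es.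
have es_size i : (i < size es)%N -> P`_(nth 0%N es i) != 0 /\ (nth 0%N es i < size P)%N.
  by move=> /(mem_nth 0%N); rewrite mem_filter mem_iota add0n => /andP[-> /andP[_ ->]].
have es_inc : sorted ltn es by apply: sorted_filter (iota_ltn_sorted _ _); apply: ltn_trans.
pose z (i : 'I_(size es)) := nth 0 Z i.
pose e (i : 'I_(size es)) := nth 0%N es i.
have zZ i : z i \in Z by apply: mem_nth; apply: leq_trans le_es.
have zinj : injective z.
  move=> i j /eqP; rewrite nth_uniq // ?(leq_trans (ltn_ord _) le_es) //.
  by move/eqP/val_inj.
have /fin_all_exists2[x x0 xz] : forall i, exists2 x, 0 < x & near_ray t 1 x (z i).
  by move=> i; apply: Zthin.
have [V V0 hV] := det_pow_mx_pos N x0 xz zinj.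
have [||r [S [r0 hS detE]]] := hV e.
- move=> i j ij; rewrite /e.
  by apply: (sorted_ltn_nth ltn_trans) => //; rewrite inE.
- by move=> i; have [_ h] := es_size _ (ltn_ord i); rewrite -ltnS; apply: leq_trans h sP.
have det0 : \det (pow_mx z e) != 0.
  by rewrite detE mulf_neq0 // (near_ray_neq0 ht r0 hS).
pose c : 'rV_(size es) := \row_i P`_(e i).
have c0 : c *m pow_mx z e = 0.
  apply/rowP => j; rewrite !mxE.
  have /rootP : root P (z j) by apply: (allP Zr).
  move=> Pz; transitivity (P.[z j]); last by rewrite Pz.
  rewrite horner_coef.
  rewrite -(big_mkord xpredT (fun i => P`_i * z j ^+ i)) /index_iota subn0.
  rewrite (bigID (fun i => P`_i != 0)) /= [X in _ + X]big1 ?addr0; last first.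
    by move=> i /negPn/eqP ->; rewrite mul0r.
  rewrite -[RHS]big_filter -/es (big_nth 0%N) big_mkord.
  by apply: eq_bigr => i _; rewrite !mxE.
have {}c0 : c = 0.
  have U : pow_mx z e \in unitmx by rewrite unitmxE unitfE.
  by rewrite -[c](mulmxK U) c0 mul0mx.
have es0 : (0 < size es)%N.
  rewrite size_filter -has_count; apply/hasP; exists (size P).-1.
    by rewrite mem_iota /= add0n prednK ?size_poly_gt0.
  by rewrite -lead_coefE lead_coef_eq0.
have := congr1 (fun M : 'rV_(size es) => M 0 (Ordinal es0)) c0.
rewrite !mxE; apply/eqP; exact: (es_size _ es0).1.
Qed.

End ThinRoots.

End ThinCone.

(** * Schroeder steps from rational points *)

Section SchroderSteps.
Import ComplexField.Normc.
Local Open Scope complex_scope.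

(** The passage from [q] to [(X - z) q] for the first two derivatives, with [y = x - z], [q' = q s1]
    and [q'' = q (s1 ^+ 2 - s2)]. *)
Lemma log_deriv_step (F : fieldType) (q s1 s2 y : F) : y != 0 ->
  q + y * (q * s1) = y * q * (y^-1 + s1) /\
  q * s1 + (q * s1 + y * (q * (s1 ^+ 2 - s2)))
    = y * q * ((y^-1 + s1) ^+ 2 - (y ^- 2 + s2)).
Proof. by move=> y0; split; field. Qed.

Lemma inv_sub_inv (F : fieldType) (x z c : F) : x - z != 0 -> x - c != 0 ->
  (x - z)^-1 - (x - c)^-1 = (z - c) * ((x - z)^-1 * (x - c)^-1).
Proof. by move=> h1 h2; field; rewrite h1 h2. Qed.

Lemma schroder_error_eq (F : fieldType) (x c s1 s2 : F) : x - c != 0 -> s2 != 0 ->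
  x - s1 / s2 - c = - (((x - c)^-1 * s1 - s2) * (x - c)) / s2.
Proof. by move=> h1 h2; field; rewrite h1 h2. Qed.

(** * The error of a Schroeder step near a cluster of roots *)

Section Schroder.
Variable R : rcfType.
Implicit Types (zs : seq R[i]) (x z c : R[i]).

(** For the product [q] of the [X - z], this is [q' / q] if [e = 1] and minus the derivative of
    [q' / q] if [e = 2]. So [x - inv_sum 1 zs x / inv_sum 2 zs x] is Newton's step for [q / q']. *)
Definition inv_sum (e : nat) zs x := \sum_(z <- zs) (x - z) ^- e.

Lemma prod_XsubC_derivs zs x : x \notin zs ->
  let q := \prod_(z <- zs) ('X - z%:P) in
  [/\ q.[x] != 0, q^`().[x] = q.[x] * inv_sum 1 zs x
    & q^`()^`().[x] = q.[x] * (inv_sum 1 zs x ^+ 2 - inv_sum 2 zs x)].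
Proof.
rewrite /inv_sum; elim: zs => [|z zs IH] /=.
  by rewrite !big_nil !derivC !hornerC mulr0 expr0n subrr mulr0 oner_neq0.
rewrite inE negb_or !big_cons => /andP[xz /IH[]].
set q := \prod_(z <- zs) _; set S1 := \sum_(j <- zs) _; set S2 := \sum_(j <- zs) _.
have {}xz : x - z != 0 by rewrite subr_eq0.
move=> q0 h1 h2; rewrite derivM derivXsubC mul1r derivD derivM derivXsubC mul1r.
rewrite !hornerE h1 h2 expr1; split; first exact: mulf_neq0.
- exact: (log_deriv_step q.[x] S1 S2 xz).1.
- rewrite -[LHS]addrA; exact: (log_deriv_step q.[x] S1 S2 xz).2.
Qed.

Lemma normc_sum_le zs (p : pred R[i]) (f : R[i] -> R[i]) (A B : R) :
  0 <= A -> 0 <= B ->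
  (forall z, z \in zs -> normc (f z) <= if p z then A else B) ->
  normc (\sum_(z <- zs) f z) <= (count p zs)%:R * A + (size zs)%:R * B.
Proof.
move=> A0 B0; elim: zs => [|z zs IH] hf /=.
  by rewrite big_nil normc0 !mul0r addr0.
rewrite big_cons natrD -natr1 !mulrDl mul1r.
have h1 := le_normcD (f z) (\sum_(j <- zs) f j).
have h2 : normc (\sum_(j <- zs) f j) <= (count p zs)%:R * A + (size zs)%:R * B.
  by apply: IH => y yz; apply: hf; rewrite inE yz orbT.
have := hf z (mem_head _ _).
by case: (p z) => h3; rewrite ?mul1r ?mul0r; lra.
Qed.

(** With [u = 1 / (x - c)] the new error is [(u S1 - S2) (x - c) / S2] up to sign. A term of
    [u S1 - S2] is [(x - z)^-1 (u - (x - z)^-1)]: the second factor is small for a root within [d]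
    of [c], the first one for a root beyond [D]. The denominator is close to [m u ^+ 2], where [m]
    counts the cluster; [m] cancels in the contribution of the cluster and need not be known. *)
Lemma schroder_error zs x c (d D : R) :
  let rho := normc (x - c) in let N := (size zs)%:R in
  c \in zs -> 0 <= d -> 0 < rho -> 32 * d <= rho -> 16 * N * rho <= D ->
  (forall z, z \in zs -> normc (z - c) <= d \/ D <= normc (z - c)) ->
  [/\ x \notin zs, inv_sum 2 zs x != 0
    & normc (x - inv_sum 1 zs x / inv_sum 2 zs x - c)
        <= 8 * d + 8 * N * rho ^+ 2 / D].
Proof.
move=> rho N czs d0 rho0 drho Drho hz.
have N1 : 1 <= N by rewrite /N ler1n; case: (zs) czs.
have Nrho : rho <= N * rho by rewrite ler_peMl // ltW.
have D0 : 0 < D by lra.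
have rhoD : 16 * rho <= D by lra.
pose p z := normc (z - c) <= d.
have inner z : p z -> rho / 2 <= normc (x - z).
  rewrite /p => pz; have := le_normcD (x - z) (z - c).
  by rewrite addrA subrK -/rho; lra.
have outer z : z \in zs -> ~~ p z -> D / 2 <= normc (x - z).
  move=> /hz[pz|pz]; first by rewrite /p pz.
  move=> _; have := le_normcD (z - x) (x - c).
  by rewrite addrA subrK -/rho (normc_sub z); lra.
have xz z : z \in zs -> 0 < normc (x - z).
  by move=> zzs; have [/inner|/(outer _ zzs)] := boolP (p z); lra.
have xzs : x \notin zs.
  by apply/negP => /xz; rewrite subrr normc0 ltxx.
pose u := (x - c)^-1.
have xc0 : x - c != 0 by rewrite -normc_gt0.
have nu : normc u = rho^-1 by rewrite normcV.
have ninv z : normc ((x - z)^-1) = (normc (x - z))^-1 by rewrite normcV.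
pose m : R := (count p zs)%:R.
have m1 : 1 <= m.
  rewrite /m ler1n -has_count; apply/hasP; exists c => //.
  by rewrite /p subrr normc0.
have mN : m <= N by rewrite ler_nat count_size.
pose S1 := inv_sum 1 zs x; pose S2 := inv_sum 2 zs x.
have hin z : p z -> normc (x - z)^-1 <= 2 / rho.
  move=> pz; have h := inner z pz.
  by rewrite ninv -[leRHS]invf_div lef_pV2 // posrE; lra.
have hout z : z \in zs -> ~~ p z -> normc (x - z)^-1 <= 2 / D.
  move=> zzs pz; have h := outer z zzs pz.
  by rewrite ninv -[leRHS]invf_div lef_pV2 // posrE; lra.
have hdiff z : z \in zs -> p z -> normc ((x - z)^-1 - u) <= 2 * d / rho ^+ 2.
  move=> zzs pz; have xz0 : x - z != 0 by rewrite -normc_gt0 xz.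
  have -> : (x - z)^-1 - u = (z - c) * ((x - z)^-1 * u).
    exact: inv_sub_inv.
  rewrite !normcM nu.
  have -> : 2 * d / rho ^+ 2 = d * (2 / rho / rho) by field; rewrite gt_eqF.
  apply: ler_pM => //; rewrite ?mulr_ge0 ?normc_ge0 ?invr_ge0 ?(ltW rho0) //.
  by rewrite ler_wpM2r ?hin // invr_ge0 ltW.
have num_bound : normc (u * S1 - S2) <= m * (4 * d / rho ^+ 3) + N * (4 / (D * rho)).
  rewrite /S1 /S2 /inv_sum mulr_sumr -sumrB.
  apply: normc_sum_le => [||z zzs].
  - by rewrite !mulr_ge0 ?invr_ge0 ?exprn_ge0 // ltW.
  - by rewrite !mulr_ge0 ?invr_ge0 ?mulr_ge0 // ltW.
  rewrite expr1 -exprVn expr2 -mulrBl normcM mulrC.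
  case: ifP => pz.
    have -> : 4 * d / rho ^+ 3 = 2 / rho * (2 * d / rho ^+ 2) by field; rewrite gt_eqF.
    by rewrite ler_pM ?normc_ge0 ?hin // normc_sub hdiff.
  have -> : 4 / (D * rho) = 2 / D * (2 / rho) by field; rewrite !gt_eqF.
  rewrite ler_pM ?normc_ge0 ?hout ?pz //.
  apply: le_trans (le_normcD _ _) _; rewrite normcN nu.
  have : normc (x - z)^-1 <= 2 / D by rewrite hout ?pz.
  have : 2 / D <= 1 / rho by rewrite ler_pdivrMr // mulrAC ler_pdivlMr //; lra.
  by rewrite !mul1r; lra.
have den_bound : normc (S2 - m%:C * u ^+ 2) <= m * (6 * d / rho ^+ 3) + N * (4 / D ^+ 2).
  have -> : m%:C * u ^+ 2 = \sum_(z <- zs) (p z)%:R * u ^+ 2.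
    rewrite -mulr_suml; congr (_ * _); rewrite /m.
    elim: (zs) => [|z s IH] /=; first by rewrite big_nil rmorph0.
    by rewrite big_cons natrD rmorphD /= IH rmorph_nat.
  rewrite /S2 /inv_sum -sumrB.
  apply: normc_sum_le => [||z zzs].
  - by rewrite !mulr_ge0 ?invr_ge0 ?exprn_ge0 // ltW.
  - by rewrite !mulr_ge0 ?invr_ge0 ?exprn_ge0 // ltW.
  rewrite -exprVn; case: ifP => pz.
    rewrite mul1r subr_sqr normcM.
    have -> : 6 * d / rho ^+ 3 = (2 * d / rho ^+ 2) * (3 / rho) by field; rewrite gt_eqF.
    rewrite ler_pM ?normc_ge0 ?hdiff //.
    apply: le_trans (le_normcD _ _) _; rewrite nu.
    by have := hin z pz; lra.
  rewrite mul0r subr0 expr2 normcM.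
  have -> : 4 / D ^+ 2 = 2 / D * (2 / D) by field; rewrite gt_eqF.
  by rewrite ler_pM ?normc_ge0 ?hout ?pz.
(* By [32 d <= rho] and [16 N rho <= D], the deviation of [S2] from [m u ^+ 2] is at most
   [(6 / 32 + 1 / 64) m / rho ^+ 2]. *)
have S2_bound : m / (2 * rho ^+ 2) <= normc S2.
  have h := le_normcD (m%:C * u ^+ 2 - S2) S2.
  have nm : normc m%:C = m by rewrite normc_real ger0_norm; lra.
  rewrite subrK normcM nm expr2 normcM nu -expr2 in h.
  rewrite normc_sub expr2 in den_bound; rewrite expr2 in h.
  have e1 : m * (6 * d / rho ^+ 3) <= m * (6 / 32 / rho ^+ 2).
    apply: ler_wpM2l; first by lra.
    have -> : 6 * d / rho ^+ 3 = (d / rho) * (6 / rho ^+ 2) by field; rewrite gt_eqF.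
    have -> : 6 / 32 / rho ^+ 2 = (1 / 32) * (6 / rho ^+ 2) by field; rewrite gt_eqF.
    apply: ler_wpM2r; first by rewrite mulr_ge0 ?invr_ge0 ?exprn_ge0 // ltW.
    by rewrite ler_pdivrMr //; lra.
  have e2 : N * (4 / D ^+ 2) <= m * (1 / 64 / rho ^+ 2).
    have -> : m * (1 / 64 / rho ^+ 2) = m / (64 * rho ^+ 2) by field; rewrite gt_eqF.
    have -> : N * (4 / D ^+ 2) = 4 * N / D ^+ 2 by field; rewrite gt_eqF.
    rewrite ler_pdivrMr ?exprn_gt0 // mulrAC ler_pdivlMr ?mulr_gt0 ?exprn_gt0 //.
    have h1 : (16 * N * rho) ^+ 2 <= D ^+ 2.
      by rewrite ler_pXn2r // nnegrE; lra.
    have h2 : 0 <= N * (N - 1) * rho ^+ 2.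
      by apply: mulr_ge0 (sqr_ge0 _); apply: mulr_ge0; lra.
    have h3 : 0 <= (m - 1) * D ^+ 2 by apply: mulr_ge0 (sqr_ge0 _); lra.
    by rewrite !expr2 in h1 h2 h3 *; lra.
  have -> : m / (2 * rho ^+ 2) = m * (rho^-1 * rho^-1) / 2 by field; rewrite gt_eqF.
  have e3 : 6 / 32 / rho ^+ 2 = 6 / 32 * (rho^-1 * rho^-1) by field; rewrite gt_eqF.
  have e4 : 1 / 64 / rho ^+ 2 = 1 / 64 * (rho^-1 * rho^-1) by field; rewrite gt_eqF.
  rewrite e3 in e1; rewrite e4 in e2.
  have : 0 <= m * (rho^-1 * rho^-1) by rewrite mulr_ge0 ?mulr_ge0 ?invr_ge0 ?(ltW rho0) //; lra.
  by lra.
have S20 : S2 != 0.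
  by rewrite -normc_gt0; apply: lt_le_trans S2_bound; rewrite divr_gt0 ?mulr_gt0 ?exprn_gt0 //; lra.
split=> //.
have -> : x - inv_sum 1 zs x / inv_sum 2 zs x - c = - ((u * S1 - S2) * (x - c)) / S2.
  by rewrite /u -/S1 -/S2; apply: schroder_error_eq.
rewrite normcM normcN normcM normcV -/rho ler_pdivrMr ?normc_gt0 //.
apply: le_trans (ler_wpM2l _ S2_bound); last first.
  apply: addr_ge0; first by lra.
  by apply: divr_ge0 (ltW D0); apply: mulr_ge0 (sqr_ge0 _); lra.
apply: le_trans (ler_wpM2r (ltW rho0) num_bound) _.
have -> : (m * (4 * d / rho ^+ 3) + N * (4 / (D * rho))) * rho =
   4 * m * d / rho ^+ 2 + 4 * N / D by field; rewrite !gt_eqF.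
have -> : (8 * d + 8 * N * rho ^+ 2 / D) * (m / (2 * rho ^+ 2)) =
   4 * m * d / rho ^+ 2 + m * (4 * N / D) by field; rewrite !gt_eqF.
by rewrite lerD2l ler_peMl // divr_ge0 ?(ltW D0) //; lra.
Qed.

End Schroder.

(** * The values needed by a Schroeder step *)

Section WeightedSums.
Variable p : {poly int}.

(** The operator [x d/dx] applied [e] times to [p]. In contrast to the derivatives, all these sums
    involve the same powers of [x]. *)
Definition wsum (e : nat) (x : rat) : rat :=
  \sum_(i < size p) (p`_i)%:~R * i%:R ^+ e * x ^+ i.

Let q : {poly rat} := map_poly intr p.

Let qE : q = \sum_(i < size p) (p`_i)%:~R *: 'X^i.
Proof.
by rewrite -[q]coefK poly_def size_map_inj_poly // ?rmorph0 //; [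
   apply: eq_bigr => i _; rewrite coef_map | exact: intr_inj].
Qed.

Lemma wsum0 x : wsum 0 x = q.[x].
Proof.
rewrite qE horner_sum; apply: eq_bigr => i _.
by rewrite hornerZ hornerXn expr0 mulr1.
Qed.

Lemma wsum1 x : wsum 1 x = x * q^`().[x].
Proof.
rewrite qE raddf_sum horner_sum mulr_sumr; apply: eq_bigr => i _ /=.
rewrite derivZ derivXn hornerZ hornerMn hornerXn -mulr_natl expr1.
by case: (nat_of_ord i) => [|j] /=; rewrite ?mul0r ?mulr0 ?mul0r // exprS; ring.
Qed.

Lemma wsum2 x : wsum 2 x = x ^+ 2 * q^`()^`().[x] + x * q^`().[x].
Proof.
rewrite qE !raddf_sum !horner_sum !mulr_sumr -big_split; apply: eq_bigr => i _ /=.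
rewrite !(derivZ, derivXn, derivMn, hornerZ, hornerMn, hornerXn).
case: (nat_of_ord i) => [|[|j]] /=; rewrite ?mulr0n ?mulr0 ?expr0n /= ?mulr0 ?mul0r ?addr0 //.
  by rewrite expr1n !mulr1n expr0; ring.
by rewrite -(mulr_natl _ j.+2) -(mulr_natl _ j.+1) -(mulr_natl _ j.+2) !exprS -natr1; ring.
Qed.

End WeightedSums.

(** * Enclosing pairs, cuts and steps *)

Section Cuts.
Variables (R : rcfType) (p : {poly int}) (xi : R).
Implicit Types (I J : rat * rat) (y T : rat).

Definition width I : rat := I.2 - I.1.

(* As in [rint], an equal pair stands for a single point. *)
Definition encloses I : Prop :=
  (ratr I.1 < xi /\ xi < ratr I.2) \/ (I.1 = I.2 /\ xi = ratr I.1).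

Definition subint J I : bool := (I.1 <= J.1) && (J.2 <= I.2).

(** [xi] is an oracle here; [cut_prog] answers the comparison by a sign of [p]. A point [y] that is
    not strictly inside changes nothing, so any rational may be proposed. *)
Definition cut y I : rat * rat :=
  if (I.1 < y) && (y < I.2) then
    if ratr y < xi then (y, I.2) else if ratr y == xi then (y, y) else (I.1, y)
  else I.

Lemma subint_refl I : subint I I.
Proof. by rewrite /subint !lexx. Qed.

Lemma subint_trans I J L : subint J I -> subint L J -> subint L I.
Proof.
move=> /andP[h1 h2] /andP[h3 h4].
by rewrite /subint (le_trans h1 h3) (le_trans h4 h2).
Qed.

Lemma subint_width I J : subint J I -> width J <= width I.
Proof. by rewrite /width => /andP[h1 h2]; lra. Qed.

Lemma encloses_width I : encloses I -> 0 <= width I.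
Proof.
rewrite /width => -[[h1 h2]|[-> _]]; last by rewrite subrr.
by have := lt_trans h1 h2; rewrite ltr_rat; lra.
Qed.

Lemma encloses_le I : encloses I -> ratr I.1 <= xi <= ratr I.2.
Proof. by move=> [[h1 h2]|[<- ->]]; rewrite ?lexx // !ltW. Qed.

Lemma cut_encloses y I : encloses I -> encloses (cut y I).
Proof.
rewrite /cut; case: ifP => // /andP[h1 h2] [[h3 h4]|[h3 _]]; last by lra.
case: ltgtP => // h; [by left | by left | by right].
Qed.

Lemma cut_subint y I : subint (cut y I) I.
Proof.
rewrite /cut; case: ifP => [/andP[h1 h2]|_]; last exact: subint_refl.
by rewrite /subint; case: ifP => _ /=; [|case: ifP => _ /=]; rewrite ?lexx ?(ltW h1) ?(ltW h2).
Qed.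

(** Also for [y] outside the pair: as [y <= xi], a point that is not strictly inside lies at or
    below [I.1]. *)
Lemma cut_lb y I : encloses I -> ratr y <= xi -> y <= (cut y I).1.
Proof.
move=> hI hy; rewrite /cut; case: ifPn => [/andP[h1 h2]|].
  by case: ifPn => //; rewrite -leNgt => h3; rewrite (le_anti (introT andP (conj hy h3))) eqxx.
rewrite negb_and -!leNgt => /orP[//|h].
move: hy; case: hI => [[h1 h2]|[h1 ->]]; last by rewrite ler_rat.
by have := ler_rat R I.2 y; rewrite h => h3 h4; have := lt_le_trans h2 (le_trans h3 h4); rewrite ltxx.
Qed.

Lemma cut_ub y I : encloses I -> xi <= ratr y -> (cut y I).2 <= y.
Proof.
move=> hI hy; rewrite /cut; case: ifPn => [/andP[h1 h2]|].
  case: ifPn => [h3|]; first by have := le_lt_trans hy h3; rewrite ltxx.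
  by move=> _; case: ifP.
rewrite negb_and -!leNgt => /orP[h|//].
move: hy; case: hI => [[h1 h2]|[<- ->]]; last by rewrite ler_rat.
by have := ler_rat R y I.1; rewrite h => h3 h4; have := lt_le_trans h1 (le_trans h4 h3); rewrite ltxx.
Qed.

(* The Schroeder step [x - p p' / (p'^2 - p p'')], with [p'] and [p''] expressed
   through [x p'] and [(x d/dx)^2 p]. *)
Definition schroder_den (x : rat) : rat :=
  wsum p 1 x * wsum p 1 x - wsum p 0 x * wsum p 2 x + wsum p 0 x * wsum p 1 x.

Definition schroder (x : rat) : rat :=
  x - wsum p 0 x * wsum p 1 x * x / schroder_den x.

(** The start lies to the left of the pair, at a distance between [w] and [2 w] from [xi]; a start
    inside might be too close to [xi] or to its cluster. The two cuts are [w / T] apart, and the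
    approximation lies midway between them. *)
Definition newton T I : rat * rat :=
  let w := width I in
  let x := I.1 - w in
  if schroder_den x == 0 then I
  else cut (schroder x + w * 2^-1 / T) (cut (schroder x - w * 2^-1 / T) I).

Lemma newton_encloses T I : encloses I -> encloses (newton T I).
Proof. by rewrite /newton; case: ifP => // _ h; do 2!apply: cut_encloses. Qed.

Lemma newton_subint T I : subint (newton T I) I.
Proof.
rewrite /newton; case: ifP => _; first exact: subint_refl.
exact: subint_trans (cut_subint _ _) (cut_subint _ _).
Qed.

Definition cpoly : {poly R[i]} := map_poly intr p.

Definition root_list (zs : seq R[i]) : Prop :=
  lead_coef cpoly != 0 /\ cpoly = lead_coef cpoly *: \prod_(z <- zs) ('X - z%:P).

Lemma schroderE (zs : seq R[i]) (x : rat) :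
  root_list zs -> let y := ratr x : R in
  x != 0 -> y%:C \notin zs -> inv_sum 2 zs y%:C != 0 ->
  schroder_den x != 0 /\
  (ratr (schroder x))%:C = y%:C - inv_sum 1 zs y%:C / inv_sum 2 zs y%:C.
Proof.
move=> [l0 pE] y x0 yzs S20; have [q0 h1 h2] := prod_XsubC_derivs yzs.
pose q : {poly rat} := map_poly intr p.
pose j := fun r : rat => (ratr r : R)%:C.
have jM a b : j (a * b) = j a * j b by exact: (rmorphM (real_complex R \o ratr)).
have jD a b : j (a + b) = j a + j b by exact: (rmorphD (real_complex R \o ratr)).
have jN a : j (- a) = - j a by exact: (rmorphN (real_complex R \o ratr)).
have jV a : j (a^-1) = (j a)^-1 by exact: (fmorphV (real_complex R \o ratr)).
have qC : cpoly = map_poly (real_complex R \o ratr) q.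
  by rewrite /cpoly /q -map_poly_comp; apply: eq_map_poly => i /=; rewrite !rmorph_int.
have hm r : (map_poly (real_complex R \o ratr) r).[y%:C] = j r.[x].
  exact: (horner_map (real_complex R \o ratr)).
have dm r : (map_poly (real_complex R \o ratr) r)^`() =
    map_poly (real_complex R \o ratr) r^`().
  exact: (deriv_map (real_complex R \o ratr)).
have hq0 : j q.[x] = cpoly.[y%:C] by rewrite qC hm.
have hq1 : j q^`().[x] = cpoly^`().[y%:C] by rewrite qC dm hm.
have hq2 : j q^`()^`().[x] = cpoly^`()^`().[y%:C] by rewrite qC !dm hm.
move: hq0 hq1 hq2; rewrite pE !derivZ !hornerZ h1 h2.
set l := lead_coef cpoly in l0 *; set Q := _.[_] in q0 *.
set S1 := inv_sum 1 _ _; set S2 := inv_sum 2 _ _ in S20 *.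
move=> hq0 hq1 hq2.
have jx0 : j x != 0 by rewrite /j fmorph_eq0 fmorph_eq0.
have denE : j (schroder_den x) = j x ^+ 2 * l ^+ 2 * Q ^+ 2 * S2.
  rewrite /schroder_den wsum0 wsum1 wsum2 !(jD, jM, jN, expr2) -/q hq0 hq1 hq2.
  ring.
have den0 : schroder_den x != 0.
  apply: contra_neq (_ : j (schroder_den x) != 0).
    by move=> ->; exact: (rmorph0 (real_complex R \o ratr)).
  by rewrite denE !mulf_neq0 // expf_neq0.
split=> //.
rewrite -/(j (schroder x)) /schroder wsum0 wsum1 jD jN jM jV denE !jM -/q hq0 hq1 -/(j x).
by field; rewrite S20 q0 l0 jx0.
Qed.

(** This is [schroder_error] with [d = w / (64 T)] and [D = 128 N w T], for a start at distance
    [w <= rho <= 2 w]. The condition [width I < I.1] keeps the start away from 0, where the formula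
    in terms of [x p'] would fail. *)
Lemma newton_width zs T I :
  root_list zs -> xi%:C \in zs ->
  encloses I -> width I < I.1 -> 1 <= T ->
  (forall z, z \in zs -> normc (z - xi%:C) <= ratr (width I / (64 * T)) \/
     ratr (128 * (size zs)%:R * width I * T) <= normc (z - xi%:C)) ->
  width (newton T I) <= width I / T.
Proof.
move=> zsE xizs hI hw T1 hz.
have [w0|w0] := eqVneq (width I) 0.
  rewrite [X in _ <= X / _]w0 mul0r -[leRHS]w0; apply: subint_width; exact: newton_subint.
have {}w0 : 0 < width I by rewrite lt_def w0 encloses_width.
set w := width I in w0 hw hz *; set x := I.1 - w.
have x0 : x != 0 by rewrite /x; lra.
pose y : R := ratr x; pose wR : R := ratr w; pose TR : R := ratr T.
have wR0 : 0 < wR by rewrite ltr0q.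
have TR1 : 1 <= TR by rewrite /TR -(rmorph1 (@ratr R)) ler_rat.
have /andP[ha hb] := encloses_le hI.
have ryE : y = ratr I.1 - wR by rewrite /y /x rmorphB.
have rbE : ratr I.2 = ratr I.1 + wR :> R by rewrite -rmorphD; congr ratr; rewrite /w /width; lra.
pose rho := normc (y%:C - xi%:C).
have rhoE : rho = xi - y.
  by rewrite /rho normc_sub -rmorphB normc_real ger0_norm //; lra.
pose N : R := (size zs)%:R.
have N1 : 1 <= N by rewrite /N ler1n; case: (zs) xizs.
have dE : ratr (w / (64 * T)) = wR / (64 * TR) :> R.
  by rewrite fmorph_div rmorphM rmorph_nat.
have DE : ratr (128 * (size zs)%:R * w * T) = 128 * N * wR * TR :> R.
  by rewrite 3!rmorphM 2!rmorph_nat.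
rewrite dE DE in hz.
have wTN : 0 <= (N - 1) * wR by apply: mulr_ge0; lra.
have wTN2 : 0 <= (TR - 1) * (N * wR) by apply: mulr_ge0; [lra | apply: mulr_ge0; lra].
have T0 : 0 < TR by lra.
have d0 : 0 <= wR / (64 * TR) by apply: divr_ge0; lra.
have dw : wR / (64 * TR) <= wR / 64 by rewrite ler_pM2l // lef_pV2 ?posrE; lra.
have [|||yzs S20 herr] := schroder_error (x := y%:C) xizs d0 _ _ _ hz.
- by rewrite -/rho rhoE; lra.
- by rewrite -/rho rhoE; lra.
- rewrite -/rho -/N rhoE.
  have : N * (xi - y) <= N * (2 * wR) by rewrite ler_pM2l; lra.
  by lra.
have [den0 cE] := schroderE zsE x0 yzs S20.
rewrite -/rho -/N rhoE in herr; rewrite -cE -rmorphB normc_real in herr.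
(* The first term is [w / (8 T)]; by [rho <= 2 w] the second one is at most [w / (4 T)]. *)
have bound : 8 * (wR / (64 * TR)) + 8 * N * (xi - y) ^+ 2 / (128 * N * wR * TR)
     <= wR * 2^-1 / TR.
  have -> : 8 * (wR / (64 * TR)) = 1 / 8 * (wR / TR) by field; rewrite gt_eqF.
  have -> : 8 * N * (xi - y) ^+ 2 / (128 * N * wR * TR) = (xi - y) ^+ 2 / (16 * wR) / TR.
    by field; rewrite !gt_eqF //; lra.
  have : (xi - y) ^+ 2 / (16 * wR) <= wR / 4.
    rewrite ler_pdivrMr; last by lra.
    have -> : wR / 4 * (16 * wR) = (2 * wR) ^+ 2 by field.
    by rewrite ler_pXn2r ?nnegrE //; lra.
  have iT : 0 < TR^-1 by rewrite invr_gt0.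
  by move/(ler_wpM2r (ltW iT)); lra.
rewrite /newton -/w -/x (negPf den0).
set c := schroder x in herr *; set h := w * 2^-1 / T.
have hE : ratr h = wR * 2^-1 / TR :> R by rewrite /h fmorph_div rmorphM fmorphV rmorph_nat.
have {herr bound} herr := le_trans herr bound; rewrite -hE in herr.
move: herr; rewrite ler_distlC => /andP[h1 h2].
have e1 := cut_encloses (c - h) hI.
have lb : c - h <= (cut (c - h) I).1 by apply: cut_lb => //; rewrite rmorphB; lra.
have ub : (cut (c + h) (cut (c - h) I)).2 <= c + h by apply: cut_ub => //; rewrite rmorphD; lra.
have /andP[s1 _] := cut_subint (c + h) (cut (c - h) I).
have -> : w / T = h + h by rewrite /h; lra.
by rewrite /width; lra.
Qed.

End Cuts.

(** * What a round achieves, or else reveals about the roots *)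

Section Rounds.
Variables (R : rcfType) (p : {poly int}) (xi : R).
Implicit Types (I J : rat * rat).

(** The product of [tower 0], ..., [tower (n - 1)] is [tower n / 2]; so a successful ascent gains as
    much as one step with [tower n], up to the factor 2 in the bounds below. *)
Definition tower (i : nat) : rat := 2 ^+ (2 ^ i).

Fixpoint ascent n I :=
  if n is m.+1 then newton p xi (tower m) (ascent m I) else I.

Fixpoint descent n I :=
  if n is m.+1 then descent m (newton p xi (tower m) I) else I.

Definition bisect I := cut xi ((I.1 + I.2) * 2^-1) I.

Definition round n beta I := iter beta bisect (descent n (ascent n I)).

Lemma towerS i : tower i.+1 = tower i * tower i.
Proof. by rewrite /tower expnS mul2n -addnn exprD. Qed.

Lemma tower_ge2 i : 2 <= tower i.
Proof.
by rewrite -[leLHS]expr1 /tower ler_weXn2l // expn_gt0.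
Qed.

Lemma tower_leS i : tower i <= tower i.+1.
Proof. by rewrite towerS; have := tower_ge2 i; nra. Qed.

Lemma ascent_encloses n I : encloses xi I -> encloses xi (ascent n I).
Proof. by elim: n => //= n IH h; apply/newton_encloses/IH. Qed.

Lemma ascent_subint n I : subint (ascent n I) I.
Proof.
elim: n => [|n IH] /=; first exact: subint_refl.
exact: subint_trans IH (newton_subint _ _ _ _).
Qed.

Lemma descent_encloses n I : encloses xi I -> encloses xi (descent n I).
Proof. by elim: n I => //= n IH I h; apply/IH/newton_encloses. Qed.

Lemma descent_subint n I : subint (descent n I) I.
Proof.
elim: n I => [|n IH] I /=; first exact: subint_refl.
exact: subint_trans (newton_subint _ _ _ _) (IH _).
Qed.

Lemma bisect_width I : encloses xi I -> width (bisect I) <= width I / 2.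
Proof.
move=> hI; set m := (I.1 + I.2) * 2^-1.
have /andP[s1 s2] := cut_subint xi m I.
rewrite /width /bisect -/m; have [h|h] := leP xi (ratr m).
  by have := cut_ub hI h; rewrite /m in s1 s2 *; lra.
by have := cut_lb hI (ltW h); rewrite /m in s1 s2 *; lra.
Qed.

Lemma bisects n I : encloses xi I ->
  [/\ encloses xi (iter n bisect I), subint (iter n bisect I) I
    & width (iter n bisect I) <= width I / 2 ^+ n].
Proof.
move=> hI; elim: n => [|n [h1 h2 h3]] /=.
  by rewrite subint_refl expr0 divr1.
split; first exact: cut_encloses.
  exact: subint_trans h2 (cut_subint _ _ _).
apply: le_trans (bisect_width h1) _.
have -> : width I / 2 ^+ n.+1 = width I / 2 ^+ n / 2.
  by rewrite exprS invfM mulrA mulrAC.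
by rewrite ler_pM2r.
Qed.

Section Gap.
Variables (zs : seq R[i]) (G : R) (I0 : rat * rat).
Hypothesis zsE : root_list p zs.
Hypothesis xizs : xi%:C \in zs.
Hypothesis GE : 256 * (size zs)%:R <= G.
Hypothesis hI0 : encloses xi I0.
Hypothesis hw0 : width I0 < I0.1.

Let dist (z : R[i]) : R := normc (z - xi%:C).
Let wR I : R := ratr (width I).
Let TR i : R := ratr (tower i).

Hypothesis gap : forall z, z \in zs -> dist z < wR I0 / G \/ G * wR I0 <= dist z.

(** By [gap], the roots closer than [G * wR I0] form a cluster of radius less than [wR I0 / G];
    [inner b] says that this cluster is not contained in the closed disc of radius [b]. *)
Let inner (b : R) : Prop := exists2 z, z \in zs & b < dist z < wR I0 / G.

Let TRS i : TR i.+1 = TR i * TR i.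
Proof. by rewrite /TR towerS rmorphM. Qed.

Let TR2 i : 2 <= TR i.
Proof. by rewrite /TR -(rmorph_nat (@ratr R)) ler_rat tower_ge2. Qed.

(** Only a root of the cluster can make the step fail: [wR J * TR i <= 2 * wR I0] and [256 N <= G]
    put the roots outside of it beyond the distance [128 N w T] required by [newton_width]. *)
Lemma newton_gap i J : encloses xi J -> subint J I0 -> wR J * TR i <= 2 * wR I0 ->
  wR (newton p xi (tower i) J) * TR i <= wR J \/ inner (wR J / (64 * TR i)).
Proof.
move=> hJ sJ hT; have T2 := TR2 i; have T0 : 0 < TR i by lra.
have [/hasP[z zzs hz]|/hasPn none] := boolP (has (fun z => wR J / (64 * TR i) < dist z < wR I0 / G) zs).
  by right; exists z.
left; rewrite -ler_pdivlMr //.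
have -> : wR J / TR i = ratr (width J / tower i) by rewrite fmorph_div.
rewrite ler_rat; apply: (newton_width zsE) => //.
- have /andP[h1 h2] := sJ; apply: le_lt_trans (subint_width sJ) _.
  exact: lt_le_trans hw0 h1.
- by have := tower_ge2 i; lra.
move=> z zzs; have [hz|hz] := gap zzs.
  left; have := none z zzs; rewrite hz andbT -leNgt => h; apply: le_trans h _.
  by rewrite fmorph_div rmorphM rmorph_nat.
right; apply: le_trans hz.
rewrite 3!rmorphM 2!rmorph_nat -/(wR J) -/(TR i).
have w0 : 0 <= wR I0 by rewrite /wR ler0q (encloses_width hI0).
have N0 : 0 <= (size zs)%:R :> R by [].
have : (size zs)%:R * (wR J * TR i) <= (size zs)%:R * (2 * wR I0) by rewrite ler_wpM2l.
have : 256 * (size zs)%:R * wR I0 <= G * wR I0 by rewrite ler_wpM2r.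
lra.
Qed.

(** Once a step has failed at an index [i], both facts recorded about [i] persist, because later
    steps can only narrow the interval. *)
Lemma ascent_gap n : wR (ascent n I0) * TR n <= 2 * wR I0 \/
  exists i, [/\ (i < n)%N, wR (ascent n I0) * TR i <= 2 * wR I0
              & inner (wR (ascent n I0) / (64 * TR i))].
Proof.
have mono J T : wR (newton p xi T J) <= wR J.
  by rewrite /wR ler_rat; apply/subint_width/newton_subint.
have w0 : 0 <= wR I0 by rewrite /wR ler0q (encloses_width hI0).
elim: n => [|n IH] /=.
  by left; rewrite /TR /tower expn0 expr1 rmorph_nat mulrC.
set J := ascent n I0 in IH *; set J' := newton _ _ _ _.
have hJ : encloses xi J by apply: ascent_encloses.
have lJ : wR J' <= wR J by apply: mono.
have inner_mono i : inner (wR J / (64 * TR i)) -> inner (wR J' / (64 * TR i)).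
  move=> [z zzs /andP[h1 h2]]; exists z => //; rewrite h2 andbT.
  apply: le_lt_trans h1; rewrite ler_wpM2r // invr_ge0.
  by have := TR2 i; lra.
case: IH => [h|[i [lt_in h1 h2]]].
  have [h'|h'] := newton_gap hJ (ascent_subint n I0) h.
    left; rewrite TRS mulrA; apply: le_trans h.
    by apply: ler_wpM2r h'; have := TR2 n; lra.
  right; exists n; split => //; last exact: inner_mono.
  by apply: le_trans h; apply: ler_wpM2r lJ; have := TR2 n; lra.
right; exists i; split; [exact: ltnW | | exact: inner_mono].
by apply: le_trans h1; apply: ler_wpM2r lJ; have := TR2 i; lra.
Qed.

(** The witness of a failure is carried down to [tower 0]. A successful step with [tower m] divides
    the width by [tower m], which makes up for replacing [tower m.+1] by its square root [tower m]
    in the bound; a failed step supplies a witness for [tower m] by itself. In the end some root of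
    the cluster is farther from [xi] than the width over 128. *)
Lemma descent_gap_from n J : encloses xi J -> subint J I0 ->
  wR J * TR n <= 2 * wR I0 -> inner (wR J / (64 * TR n)) ->
  inner (wR (descent n J) / (64 * TR 0)).
Proof.
elim: n J => [//|n IH] J hJ sJ hT hin /=.
set J' := newton _ _ _ _.
have hJ' : encloses xi J' by apply: newton_encloses.
have sJ' : subint J' J by apply: newton_subint.
have lJ : wR J' <= wR J by rewrite /wR ler_rat; apply: subint_width.
have T2 := TR2 n; have wJ : 0 <= wR J by rewrite /wR ler0q (encloses_width hJ).
have hTn : wR J * TR n <= 2 * wR I0.
  apply: le_trans hT; apply: ler_wpM2l => //.
  by rewrite /TR ler_rat tower_leS.
have bound (b : R) : inner b -> wR J' / (64 * TR n) <= b ->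
    inner (wR J' / (64 * TR n)).
  by move=> [z zzs /andP[h1 h2]] h; exists z => //; rewrite h2 andbT (le_lt_trans h h1).
apply: IH => //; first exact: subint_trans sJ sJ'.
  by apply: le_trans hTn; apply: ler_wpM2r lJ; lra.
have iT : 0 < (64 * TR n)^-1 by rewrite invr_gt0; lra.
have [h|h] := newton_gap hJ sJ hTn.
  apply: bound hin _.
  have -> : wR J / (64 * TR n.+1) = wR J / TR n / (64 * TR n).
    by rewrite TRS; field; rewrite gt_eqF //; lra.
  by apply: ler_wpM2r (ltW iT) _ _ _; rewrite ler_pdivlMr //; lra.
by apply: bound h _; apply: ler_wpM2r (ltW iT) _ _ lJ.
Qed.

(** The steps of the descent with [tower i] and larger powers leave a witness for [i] valid, whether
    they succeed or not. *)
Lemma descent_gap i n J : (i <= n)%N -> encloses xi J -> subint J I0 ->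
  wR J * TR i <= 2 * wR I0 -> inner (wR J / (64 * TR i)) ->
  inner (wR (descent n J) / (64 * TR 0)).
Proof.
elim: n J => [|n IH] J.
  by rewrite leqn0 => /eqP ->; apply: descent_gap_from.
rewrite leq_eqVlt => /orP[/eqP ->|]; first exact: descent_gap_from.
rewrite ltnS => le_in hJ sJ hT [z zzs /andP[h1 h2]] /=.
set J' := newton _ _ _ _.
have sJ' : subint J' J by apply: newton_subint.
have lJ : wR J' <= wR J by rewrite /wR ler_rat; apply: subint_width.
have T2 := TR2 i.
apply: IH => //; [exact: newton_encloses | exact: subint_trans sJ sJ' | |].
  by apply: le_trans hT; apply: ler_wpM2r lJ; lra.
exists z => //; rewrite h2 andbT; apply: le_lt_trans h1.
by apply: ler_wpM2r lJ; rewrite invr_ge0; lra.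
Qed.

End Gap.

(** The second alternative covers two kinds of roots: one whose distance is within a factor [G] of
    the initial width, so that no cluster is separated at the start, or the one left over by the
    descent. *)
Lemma ascent_descent zs G n I :
  root_list p zs -> xi%:C \in zs -> 256 * (size zs)%:R <= G ->
  encloses xi I -> width I < I.1 -> 0 < width I ->
  let J := descent n (ascent n I) in
  width J * tower n <= 2 * width I \/
  exists z, [/\ z \in zs, z != xi%:C, ratr (width J) <= G * normc (z - xi%:C)
              & normc (z - xi%:C) <= G * ratr (width I)].
Proof.
move=> zsE xizs GE hI hw w0 J.
have N1 : 1 <= (size zs)%:R :> R by rewrite ler1n; case: (zs) xizs.
have G0 : 0 < G by lra.
pose dist (z : R[i]) : R := normc (z - xi%:C).
have dist_gt0 z : 0 < dist z -> z != xi%:C by rewrite normc_gt0 subr_eq0.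
have wR0 : 0 < ratr (width I) :> R by rewrite ltr0q.
have sA : subint (ascent n I) I by apply: ascent_subint.
have hA : encloses xi (ascent n I) by apply: ascent_encloses.
have sJ : subint J (ascent n I) by apply: descent_subint.
have hJ : encloses xi J by apply: descent_encloses.
have wJ : ratr (width J) <= ratr (width I) :> R.
  by rewrite ler_rat; apply/subint_width/(subint_trans sA sJ).
have wJ0 : 0 <= ratr (width J) :> R by rewrite ler0q (encloses_width hJ).
have [/hasP[z zzs /andP[h1 h2]]|/hasPn none] := boolP
    (has (fun z => ratr (width I) / G <= dist z < G * ratr (width I)) zs).
  right; exists z; split=> //; last exact: ltW.
    by apply: dist_gt0; apply: lt_le_trans h1; rewrite divr_gt0.
  by apply: le_trans wJ _; move: h1; rewrite ler_pdivrMr // mulrC.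
have gap z : z \in zs -> dist z < ratr (width I) / G \/ G * ratr (width I) <= dist z.
  move=> zzs; have := none z zzs; rewrite negb_and -ltNge -leNgt.
  by move/orP; rewrite /dist.
have [h|[i [lt_in h1 h2]]] := ascent_gap zsE xizs GE hI hw gap n.
  left; rewrite -(ler_rat R) !rmorphM rmorph_nat; apply: le_trans h.
  apply: ler_wpM2r; first by rewrite ler0q; have := tower_ge2 n; lra.
  by rewrite ler_rat; apply: subint_width.
have [z zzs /andP[h3 h4]] :=
  descent_gap zsE xizs GE hI hw gap (ltnW lt_in) hA sA h1 h2.
have e : ratr (tower 0) = 2 :> R by rewrite /tower expn0 expr1 rmorph_nat.
rewrite e -/J ltr_pdivrMr in h3; last by lra.
have GI : ratr (width I) / G <= ratr (width I) * G.
  rewrite ler_wpM2l ?(ltW wR0) //; apply: (@le_trans _ _ 1); last by lra.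
  by rewrite invf_le1; lra.
right; exists z; split=> //.
- apply: dist_gt0; rewrite -/(dist z) in h3; lra.
- have : 256 * dist z <= G * dist z by rewrite ler_wpM2r ?normc_ge0 //; lra.
  by have := normc_ge0 (z - xi%:C); rewrite -/(dist z) in h3 *; lra.
- rewrite -/(dist z) in h4 *; lra.
Qed.

Lemma round_spec n beta I : encloses xi I ->
  [/\ encloses xi (round n beta I), subint (round n beta I) I
    & width (round n beta I) <= width (descent n (ascent n I)) / 2 ^+ beta].
Proof.
move=> hI; have hJ := descent_encloses n (ascent_encloses n hI).
have [h1 h2 h3] := bisects beta hJ; split=> //.
apply: subint_trans h2; apply: subint_trans (descent_subint _ _).
exact: ascent_subint.
Qed.

End Rounds.

End SchroderSteps.

(** * Counting the rounds *)

Section RoundCount.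
Import ComplexField.Normc.
Local Open Scope complex_scope.

(** * Charging points of a line to gaps *)

Section GapCharging.
Variables (R : realFieldType) (X : seq R).
Let M := size X.
Let s := sort <=%R (undup X).

Let s_lt i j : (i < j < size s)%N -> s`_i < s`_j.
Proof.
move=> /andP[ij js]; have sl : sorted <%R s by rewrite sort_lt_sorted undup_uniq.
by apply: (sorted_ltn_nth lt_trans) => //; rewrite inE (ltn_trans ij).
Qed.

Let s_size : (size s <= M)%N.
Proof. by rewrite size_sort size_undup. Qed.

(** Fewer than [M] gaps lie between [u] and [v], so one of them is at least [(v - u) / M]. *)
Lemma large_gap u v : u \in X -> v \in X -> u < v ->
  exists2 k, (k.+1 < size s)%N &
    [/\ u <= s`_k, s`_k.+1 <= v & v - u <= M%:R * (s`_k.+1 - s`_k)].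
Proof.
rewrite -(mem_undup X) -(mem_sort <=%R) -/s => /(nthP 0)[i i_s <-].
rewrite -(mem_undup X) -(mem_sort <=%R) -/s => /(nthP 0)[j js <-] uv.
have le_s i1 i2 : (i1 <= i2 < size s)%N -> s`_i1 <= s`_i2.
  case/andP; rewrite leq_eqVlt => /orP[/eqP -> //|i12 i2s].
  by apply/ltW/s_lt; rewrite i12 i2s.
have ij : (i < j)%N.
  by rewrite ltnNge; apply/negP => h; have := le_s j i; rewrite h i_s leNgt uv => /(_ isT).
have M0 : 0 < M%:R :> R by rewrite ltr0n (leq_trans _ s_size) // (leq_ltn_trans _ js).
pose g := (s`_j - s`_i) / M%:R.
have g0 : 0 < g by rewrite divr_gt0 // subr_gt0 s_lt // ij js.
have [/hasP[k]|/hasPn none] := boolP (has (fun k => g <= s`_k.+1 - s`_k) (iota i (j - i))).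
  rewrite mem_iota subnKC ?(ltnW ij) // => /andP[ik kj] hk.
  exists k; first exact: leq_ltn_trans kj js.
  split; [by apply: le_s; rewrite ik (ltn_trans kj js) | by apply: le_s; rewrite kj js |].
  by rewrite mulrC -ler_pdivrMr.
have bound d : (i + d <= j)%N -> s`_(i + d) - s`_i <= d%:R * g.
  elim: d => [|d IH]; first by rewrite addn0 subrr mul0r.
  rewrite addnS => lt_dj; have {IH} := IH (ltnW lt_dj).
  have : i + d \in iota i (j - i) by rewrite mem_iota leq_addr; lia.
  by move/none; rewrite -ltNge -natr1; lra.
have := bound (j - i)%N; rewrite subnKC ?(ltnW ij) // leqnn => /(_ isT).
have : (j - i)%:R * g < M%:R * g.
  by rewrite ltr_pM2r // ltr_nat; apply: leq_trans s_size; apply: leq_ltn_trans (leq_subr _ _) js.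
have -> : M%:R * g = s`_j - s`_i by rewrite /g mulrC divfK ?gt_eqF.
lra.
Qed.

(** A pair [(j, t)] is charged to a gap [g] between [xi j] and [x j t] with [g <= r <= M g], where
    [r] is their distance. The map to the gap and one additional bit is injective, which gives the
    factor 2. *)
Lemma sum_shrinking_chains m (xi a b : 'I_m -> R) (n : 'I_m -> nat)
    (x : 'I_m -> nat -> R) (Q : R) :
  2 * M%:R <= Q -> 1 <= Q ->
  (forall j, a j < xi j /\ xi j < b j) ->
  (forall i j, i != j -> b i <= a j \/ b j <= a i) ->
  (forall j, xi j \in X) ->
  (forall j t, (t < n j)%N -> x j t \in X /\ 0 < `|x j t - xi j|) ->
  (forall j, (0 < n j)%N -> `|x j 0%N - xi j| * Q < b j - a j) ->
  (forall j t, (t.+1 < n j)%N -> `|x j t.+1 - xi j| * Q < `|x j t - xi j|) ->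
  (\sum_j n j <= 2 * M)%N.
Proof.
move=> QM Q1 xiI disj xiX xX x0 xS.
pose r j t := `|x j t - xi j|.
have r_ge0 j t : 0 <= r j t by apply: normr_ge0.
have r_Q j t : r j t <= r j t * Q by rewrite ler_peMr.
have Q0 : 0 < Q by lra.
have r_lt j t d : (t + d < n j)%N -> r j (t + d)%N <= r j t.
  elim: d => [|d IH] h; first by rewrite addn0.
  rewrite addnS in h *; apply: le_trans (IH (ltnW h)).
  exact: le_trans (r_Q _ _) (ltW (xS _ _ h)).
have r_0 j t : (t < n j)%N -> r j t * Q < b j - a j.
  move=> h; apply: le_lt_trans (x0 j _); last by apply: leq_ltn_trans h.
  by rewrite ler_pM2r //; have := r_lt j 0%N t; rewrite add0n => /(_ h).
pose D := {j : 'I_m & 'I_(n j)}.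
have charge (u : D) : exists k : 'I_M,
    let r := r (tag u) (tagged u) in let g := s`_k.+1 - s`_k in
    [/\ 0 < g, `|s`_k - xi (tag u)| <= r, g <= r & r <= M%:R * g].
  case: u => j t /=; have [xtX rt0] := xX j t (ltn_ord t).
  have [h|h] : xi j < x j t \/ x j t < xi j.
    by apply/orP; rewrite -neq_lt eq_sym -subr_eq0 -normr_gt0.
  - have [k ks [h1 h2 h3]] := large_gap (xiX j) xtX h.
    have kM : (k < M)%N by apply: leq_trans s_size; apply: ltnW.
    exists (Ordinal kM) => /=; have -> : r j t = x j t - xi j by rewrite /r ger0_norm; lra.
    have : s`_k < s`_k.+1 by apply: s_lt; rewrite ltnSn ks.
    by split; rewrite ?ger0_norm; lra.
  - have [k ks [h1 h2 h3]] := large_gap xtX (xiX j) h.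
    have kM : (k < M)%N by apply: leq_trans s_size; apply: ltnW.
    exists (Ordinal kM) => /=; have -> : r j t = xi j - x j t by rewrite /r ltr0_norm; lra.
    have : s`_k < s`_k.+1 by apply: s_lt; rewrite ltnSn ks.
    by split; rewrite ?ler0_norm; lra.
have [k hk] := fin_all_exists charge.
pose reach (u : D) : R := s`_(k u) - M%:R * (s`_(k u).+1 - s`_(k u)).
(* [c u] tells whether the interval of [u] extends to the left of every point
   that may charge the gap [k u]. *)
pose c (u : D) : bool := a (tag u) < reach u.
have inj : injective (fun u => (k u, c u)).
  (* Both roots are within [M g] of the left end of the gap. If both intervals begin left of
     [reach], the left one also ends before it and cannot contain its root. If neither does, the
     left one, being longer than [2 M g], ends so far to the right that the root of the other is too
     far away. *)
  have aux (u v : D) : k u = k v -> c u = c v -> tag u != tag v ->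
      b (tag u) <= a (tag v) -> False.
    move=> kuv; rewrite /c /reach; have := hk u; have := hk v; rewrite kuv.
    set y := s`_(k v); set g := s`_(k v).+1 - y => /= -[g0 v1 v2 v3] [_ u1 u2 u3] cuv ne ba.
    have := r_0 _ _ (ltn_ord (tagged u)); have [xu1 xu2] := xiI (tag u).
    have [xv1 xv2] := xiI (tag v).
    move: u1 v1; rewrite !ler_norml => /andP[u1 u1'] /andP[v1 v1'] len.
    have M0 : 0 <= M%:R :> R by exact: ler0n.
    have gQ : g * (2 * M%:R) <= r (tag u) (tagged u) * Q by apply: ler_pM => //; lra.
    case: (ltP (a (tag u)) (y - M%:R * g)) cuv => h1; case: ltP => // h2 _; lra.
  (* Distances charged to the same gap [g] lie between [g] and [M g], but within a chain they drop
     by more than the factor [2 M]. *)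
  have same j (t t' : 'I_(n j)) : k (Tagged _ t) = k (Tagged _ t') -> (t < t')%N -> False.
    move=> kk lt_t; have := hk (Tagged (fun j => 'I_(n j)) t).
    have := hk (Tagged (fun j => 'I_(n j)) t'); rewrite kk /=.
    set g := _ - _ => -[g0 _ h1 _] [_ _ _ h2].
    have t1n : (t.+1 < n j)%N by apply: leq_ltn_trans lt_t (ltn_ord t').
    have := r_lt j t.+1 (t' - t.+1)%N; rewrite subnKC // => /(_ (ltn_ord _)) h3.
    have h4 : r j t.+1 * Q < r j t := xS _ _ t1n.
    have h5 : r j t' * Q <= r j t.+1 * Q by rewrite ler_pM2r.
    have : g * Q <= r j t' * Q by rewrite ler_wpM2r //; lra.
    have : 2 * M%:R * g <= Q * g by rewrite ler_wpM2r // ltW.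
    have M1 : 1 <= M%:R :> R by rewrite ler1n (leq_trans _ (ltn_ord (k (Tagged (fun j => 'I_(n j)) t)))).
    have : g <= M%:R * g by rewrite ler_peMl // ltW.
    lra.
  move=> [j t] [j' t'] [kk cc].
  have [jj|ne] := eqVneq j j'; last first.
    have [h|h] := disj _ _ ne.
      by case: (aux _ _ kk cc ne h).
    by rewrite eq_sym in ne; case: (aux _ _ (esym kk) (esym cc) ne h).
  case: j' / jj t' kk cc => t' kk cc.
  have [lt_t|lt_t|/val_inj -> //] := ltngtP t t'.
    by case: (same j t t' kk lt_t).
  by case: (same j t' t (esym kk) lt_t).
have := leq_card _ inj; rewrite card_prod card_ord card_bool mulnC.
rewrite card_tagged sumnE big_map big_enum /=.
by under eq_bigr do rewrite card_ord.
Qed.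

End GapCharging.

(** * Integer polynomials at rational points *)

Section RationalEvaluation.
Implicit Types (g p : {poly int}) (a : rat).

Definition hom_eval g N a : int :=
  \sum_(i < N.+1) g`_i * numq a ^+ i * denq a ^+ (N - i).

Lemma hom_evalE g N a : (size g <= N.+1)%N ->
  (hom_eval g N a)%:~R = (map_poly intr g).[a] * (denq a)%:~R ^+ N.
Proof.
move=> sg; rewrite (@horner_coef_wide _ N.+1); last first.
  exact: leq_trans (size_poly _ _) sg.
rewrite mulr_suml rmorph_sum; apply: eq_bigr => i _ /=.
have d0 : (denq a)%:~R != 0 :> rat by rewrite intr_eq0 denq_neq0.
rewrite coef_map !rmorphM !rmorphXn /= -!mulrA; congr (_ * _).
have -> : (numq a)%:~R = a * (denq a)%:~R :> rat.
  by rewrite -{2}[a]divq_num_den divfK.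
by rewrite exprMn -?mulrA -exprD subnKC // -ltnS.
Qed.

(** The value times [denq a ^ N] is a nonzero integer. *)
Lemma horner_denq_lb g N a : (size g <= N.+1)%N ->
  (map_poly intr g).[a] != 0 ->
  (denq a)%:~R ^- N <= `|(map_poly intr g).[a]| :> rat.
Proof.
move=> sg g0; have d0 : 0 < (denq a)%:~R ^+ N :> rat by rewrite exprn_gt0 ?ltr0z ?denq_gt0.
rewrite -(ler_pM2r d0) mulVf ?gt_eqF // -[X in _ * X]gtr0_norm // -normrM.
rewrite -hom_evalE // -intr_norm -[1]/(1%:~R) ler_int.
rewrite -gtz0_ge1 normr_gt0 -(intr_eq0 rat) hom_evalE // mulf_neq0 // gt_eqF //.
Qed.

(** After clearing denominators, every term but the leading one is divisible by the denominator,
    which is coprime to the numerator. *)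
Lemma denq_root_dvd p a : p != 0 -> root (map_poly intr p) a ->
  (denq a %| lead_coef p)%Z.
Proof.
move=> p0 /rootP pa; set N := (size p).-1.
have sp : size p = N.+1 by rewrite prednK // size_poly_gt0.
have := hom_evalE (g := p) (N := N) a; rewrite sp leqnn pa mul0r => /(_ isT)/eqP.
rewrite intr_eq0 /hom_eval big_ord_recr /= subnn expr0 mulr1 addr_eq0 => /eqP h.
have cop : coprimez (denq a) (numq a ^+ N).
  by apply: coprimezXr; rewrite coprimez_sym; apply: coprime_num_den.
rewrite -(Gauss_dvdzl _ cop) lead_coefE -/N -[_ * _]opprK -h rpredN.
apply: rpred_sum => i _.
apply: dvdz_mull; rewrite -(subnSK (ltn_ord i)) exprS; exact: dvdz_mulr.
Qed.

Definition abs_sum p : rat := \sum_(i < size p) `|(p`_i)%:~R|.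

Lemma denq_root_le p a : p != 0 -> root (map_poly intr p) a ->
  (denq a)%:~R <= abs_sum p.
Proof.
move=> p0 /(denq_root_dvd p0) h.
have l0 : lead_coef p != 0 by rewrite lead_coef_eq0.
apply: (@le_trans _ _ (`|lead_coef p|)%:~R).
  have : (`|denq a| <= `|lead_coef p|)%N by apply: dvdn_leq; rewrite ?absz_gt0.
  by rewrite ler_int -lez_nat !abszE gtr0_norm ?denq_gt0.
have sp : ((size p).-1 < size p)%N by rewrite prednK // size_poly_gt0.
rewrite /abs_sum (bigD1 (Ordinal sp)) //= intr_norm -lead_coefE lerDl.
by apply: sumr_ge0.
Qed.

End RationalEvaluation.

(** * Separation of roots by Taylor expansion *)

Section TaylorSeparation.
Variable R : realFieldType.
Implicit Types (P : {poly R}).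

(** The first nonzero Taylor coefficient, of index [m], contributes at least [d t ^+ m], all later
    ones together at most [t ^+ m * (t S)]. As [m] is arbitrary, [x] may be a root of any
    multiplicity. *)
Lemma taylor_neq0 P (x t S d : R) : P != 0 -> 0 < t -> t <= 1 ->
  (forall i, P^`N(i).[x] != 0 -> d <= `|P^`N(i).[x]|) ->
  \sum_(i < size P) `|P^`N(i).[x]| <= S -> t * S < d -> P.[x + t] != 0.
Proof.
move=> P0 t0 t1 hd hS htS.
have sP : ((size P).-1 < size P)%N by rewrite prednK // size_poly_gt0.
have [m hm hmin] : exists2 m, P^`N(m).[x] != 0 & forall i, (i < m)%N -> P^`N(i).[x] = 0.
  have ex : exists m, P^`N(m).[x] != 0.
    exists (size P).-1; rewrite (_ : P^`N(_) = (lead_coef P)%:P) ?hornerC ?lead_coef_eq0 //.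
    apply/polyP => i; rewrite coef_nderivn coefC; case: i => [|i] /=.
      by rewrite addn0 binn.
    by rewrite nth_default ?mul0rn // addnS; lia.
  case: (ex_minnP ex) => m hm hmin; exists m => // i im.
  by apply/eqP; apply: contraTT im => /hmin; rewrite -leqNgt.
have mP : (m < size P)%N.
  rewrite ltnNge; apply: contra hm => h; rewrite (_ : P^`N(m) = 0) ?horner0 //.
  apply/polyP => i; rewrite coef_nderivn coef0 nth_default ?mul0rn //.
  exact: leq_trans h (leq_addr _ _).
rewrite nderiv_taylor; last exact: mulrC.
apply/negP => /eqP; rewrite (bigD1 (Ordinal mP)) //= => /eqP.
rewrite addr_eq0 => /eqP/(congr1 Num.norm); rewrite normrN normrM.
have tm0 : 0 < t ^+ m by rewrite exprn_gt0.
rewrite (gtr0_norm tm0) => h.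
have h1 := hd _ hm.
have : `|\sum_(i < size P | i != Ordinal mP) P^`N(i).[x] * t ^+ i| <= t ^+ m * (t * S).
  apply: le_trans (ler_norm_sum _ _ _) _.
  apply: le_trans (ler_wpM2l (ltW tm0) (ler_wpM2l (ltW t0) hS)).
  rewrite mulrA -exprSr mulr_sumr big_mkcond /=; apply: ler_sum => i _.
  have tm1 : 0 <= t ^+ m.+1 by rewrite exprn_ge0 // ltW.
  case: ifP => [im|_]; last by rewrite mulr_ge0.
  have [lt_im|le_mi] := ltnP i m; first by rewrite (hmin _ lt_im) mul0r normr0 mulr0.
  rewrite normrM mulrC ler_wpM2r // ger0_norm ?exprn_ge0 // ?(ltW t0) //.
  rewrite ler_wiXn2l ?(ltW t0) // ltn_neqAle le_mi andbT.
  by apply: contraNneq (negbT (negbTE im)) => e; apply/eqP/val_inj.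
rewrite -h => h2.
have : `|P^`N(m).[x]| * t ^+ m < d * t ^+ m.
  by apply: le_lt_trans h2 _; rewrite mulrC ltr_pM2r.
by rewrite ltr_pM2r // ltNge h1.
Qed.

Lemma sum_nderivn_norm P (x : R) : 0 <= x ->
  \sum_(i < size P) `|P^`N(i).[x]| <= \sum_(i < size P) `|P`_i| * (x + 1) ^+ i.
Proof.
move=> x0; pose A := \poly_(i < size P) `|P`_i|.
have sA : (size A <= size P)%N by apply: size_poly.
have -> : \sum_(i < size P) `|P`_i| * (x + 1) ^+ i = A.[x + 1].
  by rewrite horner_poly.
rewrite (nderiv_taylor_wide (n := size P)) //; last exact: mulrC.
apply: ler_sum => i _; rewrite expr1n mulr1.
rewrite (@horner_coef_wide _ (size P)); last by apply: leq_trans (size_poly _ _) (leq_subr _ _).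
rewrite (@horner_coef_wide _ (size P) A^`N(i)); last first.
  apply: leq_trans (size_poly _ _) _; exact: leq_trans (leq_subr _ _) sA.
apply: le_trans (ler_norm_sum _ _ _) _; apply: ler_sum => j _.
rewrite normrM (ger0_norm (exprn_ge0 _ x0)) ler_wpM2r ?exprn_ge0 //.
rewrite !coef_nderivn normrMn lerMn2r coef_poly.
by case: ltnP => h; rewrite ?lexx ?orbT // (nth_default _ h) normr0 lexx orbT.
Qed.

End TaylorSeparation.

(** The denominator of the root [a] is at most [M], so with [N] the degree, nonzero Taylor
    coefficients at [a] are at least [M ^- N], while their absolute values sum up to at most
    [M (a + 1) ^+ N]. The bound on [t] makes [t] times this sum smaller than [M ^- N]. *)
Lemma no_root_right_of_root (R : realFieldType) (p : {poly int}) (a M : rat) (n : nat) :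
  p != 0 -> root (map_poly intr p) a -> 0 <= a -> 1 + abs_sum p <= M -> (size p <= n)%N ->
  forall t : R, 0 < t -> t <= ratr ((M * (a + 2)) ^- n) ->
    ~~ root (map_poly intr p : {poly R}) (ratr a + t).
Proof.
move=> p0 pa a0 hM sn t t0 tle; set P : {poly R} := map_poly intr p.
have abs0 : 0 <= abs_sum p by apply: sumr_ge0.
pose N := (size p).-1; have sp : size p = N.+1 by rewrite prednK // size_poly_gt0.
have P0 : P != 0 by rewrite map_poly_eq0_id0 // intr_eq0 lead_coef_eq0.
have sP : size P = size p by rewrite size_map_poly_id0 // intr_eq0 lead_coef_eq0.
have Y1 : 1 <= M * (a + 2) by nra.
have vM := le_trans (denq_root_le p0 pa) (_ : abs_sum p <= M).
have {}vM : (denq a)%:~R <= M by apply: vM; lra.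
have v0 : 0 < (denq a)%:~R :> rat by rewrite ltr0z denq_gt0.
have cE i : P^`N(i).[ratr a] = ratr (map_poly intr p^`N(i)).[a].
  have -> : P^`N(i) = map_poly ratr (map_poly intr p^`N(i) : {poly rat}).
    rewrite -map_poly_comp nderivn_map; apply: eq_map_poly => z /=.
    by rewrite ratr_int.
  by rewrite horner_map.
pose q : rat := M ^- N.
apply: (@taylor_neq0 R P (ratr a) t (ratr (M * (a + 1) ^+ N)) (ratr q)) => //.
- apply: le_trans tle _; rewrite -(rmorph1 (@ratr R)) ler_rat.
  by rewrite invf_le1 ?exprn_ege1 // exprn_gt0 //; lra.
- move=> i; rewrite cE fmorph_eq0 => c0; rewrite -ratr_norm ler_rat.
  have sN : (size p^`N(i) <= N.+1)%N.
    by rewrite -sp; apply: leq_trans (size_poly _ _) (leq_subr _ _).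
  apply: le_trans (horner_denq_lb sN c0).
  rewrite /q lef_pV2 ?posrE ?exprn_gt0 //; last by lra.
  by rewrite lerXn2r ?nnegrE //; lra.
- apply: le_trans (sum_nderivn_norm _ _) _; first by rewrite ler0q.
  rewrite rmorphM rmorphXn rmorphD rmorph1 sP.
  have a1 : 1 <= ratr a + 1 :> R by rewrite lerDr ler0q.
  apply: (@le_trans _ _ (\sum_(i < size p) `|P`_i| * (ratr a + 1) ^+ N)).
    apply: ler_sum => i _; rewrite ler_wpM2l // ler_weXn2l //.
    by rewrite -ltnS -sp.
  rewrite -mulr_suml ler_wpM2r ?exprn_ge0 //; first by lra.
  apply: (@le_trans _ _ (ratr (abs_sum p))); last by rewrite ler_rat; lra.
  rewrite /abs_sum rmorph_sum; apply: ler_sum => i _ /=.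
  by rewrite ratr_norm ratr_int coef_map.
have T0 : 0 < ratr ((M * (a + 2)) ^- n) :> R by rewrite ltr0q invr_gt0 exprn_gt0 //; lra.
have S0 : 0 < ratr (M * (a + 1) ^+ N) :> R.
  by rewrite ltr0q mulr_gt0 ?exprn_gt0 //; lra.
have := ler_wpM2r (ltW S0) tle; move/le_lt_trans; apply.
rewrite -rmorphM ltr_rat /q.
have MN : 0 < M ^+ N by rewrite exprn_gt0 //; lra.
have Yn : 0 < (M * (a + 2)) ^+ n by rewrite exprn_gt0 //; lra.
rewrite -(ltr_pM2l Yn) mulVKf ?gt_eqF //.
rewrite -(ltr_pM2r MN) divfK ?gt_eqF //.
apply: (@lt_le_trans _ _ ((M * (a + 2)) ^+ N.+1)); last by rewrite ler_weXn2l // -sp.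
rewrite exprMn exprS.
have h : (a + 1) ^+ N <= (a + 2) ^+ N by rewrite lerXn2r ?nnegrE //; lra.
have h0 : 0 < (a + 1) ^+ N by rewrite exprn_gt0 //; lra.
have : (a + 1) ^+ N < (a + 2) ^+ N.+1 by rewrite exprS; nra.
have MM : 0 < M * M ^+ N by rewrite mulr_gt0 //; lra.
by rewrite -(ltr_pM2l MM) exprS; lra.
Qed.

(** * The sign of a polynomial around a simple root *)

Section SimpleRootSign.
Variable R : rcfType.
Implicit Types (q : {poly R}) (x y : R).

Lemma no_root_same_sign q x y : x <= y ->
  (forall z, x <= z <= y -> ~~ root q z) -> 0 < q.[x] * q.[y].
Proof.
move=> xy nz.
have q0 z : x <= z <= y -> q.[z] != 0 by move=> /nz; rewrite rootE.
have qx : q.[x] != 0 by apply: q0; rewrite lexx.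
have qy : q.[y] != 0 by apply: q0; rewrite lexx andbT.
have ivt q' : q'.[x] < 0 -> 0 < q'.[y] -> (forall z, x <= z <= y -> ~~ root q' z) -> False.
  move=> h1 h2 h; have [|z zI] := @poly_ivt R q' x y xy; first by rewrite !ltW.
  by apply/negP/h.
case: (ltgtP q.[x] 0) qx => // hx _; case: (ltgtP q.[y] 0) qy => // hy _.
- by rewrite nmulr_lgt0.
- by case: (ivt q hx hy nz).
- case: (ivt (- q)); rewrite ?hornerN ?oppr_lt0 ?oppr_gt0 //.
  by move=> z /nz; rewrite !rootE hornerN oppr_eq0.
- by rewrite pmulr_lgt0.
Qed.

(** In [P = q (X - xi)] the cofactor [q] has no root between [e] and [y], so only the signs of
    [xi - e] and [xi - y] count. The reference point [e] may be the endpoint [a], outside the open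
    interval; there [P.[e] != 0] is what excludes a root of [q]. *)
Lemma simple_root_sgr (P : {poly R}) (a b xi e y : R) :
  mup xi P = 1%N -> (forall x, a < x < b -> root P x -> x = xi) ->
  a <= e < xi -> xi < b -> P.[e] != 0 -> a < y < b ->
  Num.sg (P.[y] * P.[e]) = Num.sg (xi - y).
Proof.
move=> m1 only /andP[ae exi] xib Pe0 /andP[ay yb].
have rP : root P xi.
  by apply: contraTT isT => h; have := mupNroot h; rewrite m1.
have P0 : P != 0 by apply: contraNneq Pe0 => ->; rewrite horner0.
have [q PE] := factor_theorem P xi rP.
have q0 : q != 0 by apply: contraNneq P0; rewrite PE => ->; rewrite mul0r.
have qxi : ~~ root q xi.
  apply/negP => /factor_theorem [q' q'E].
  have : (2 <= mup xi P)%N by rewrite mup_geq // PE q'E -mulrA -expr2 dvdp_mulIr.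
  by rewrite m1.
have nq z : (z == e) || (a < z) -> z < b -> ~~ root q z.
  have [-> _ _|_ /= az zb] := eqVneq z e.
    by apply: contra Pe0; rewrite rootE PE hornerM => /eqP ->; rewrite mul0r.
  have [-> //|zxi] := eqVneq z xi.
  apply: contraNN zxi => qz; apply/eqP/only; last by rewrite PE rootM qz.
  by rewrite az.
have pos : 0 < q.[y] * q.[e].
  have [ye|ey] := leP y e.
    apply: no_root_same_sign ye _ => z /andP[yz ze]; apply: nq.
      by rewrite (lt_le_trans ay yz) orbT.
    exact: le_lt_trans ze (lt_trans exi xib).
  rewrite mulrC; apply: no_root_same_sign (ltW ey) _ => z /andP[ez zy]; apply: nq.
    by have [//|ne /=] := eqVneq z e; rewrite (le_lt_trans ae) // lt_def ne.
  exact: le_lt_trans zy yb.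
have -> : P.[y] * P.[e] = (q.[y] * q.[e]) * (xi - e) * (xi - y).
  by rewrite PE !hornerM !hornerXsubC; ring.
by rewrite sgrM [Num.sg (_ * (xi - e))]gtr0_sg ?mul1r // mulr_gt0 // subr_gt0.
Qed.

End SimpleRootSign.

(** * The complex roots of [p] and their images on the real line *)

Section ChargedRoots.
Variables (R : rcfType) (p : {poly int}).
Let P : {poly R} := map_poly intr p.
Let C := @cpoly R p.

Lemma cpolyE : C = map_poly (real_complex R) P.
Proof. by rewrite /C /cpoly /P -map_poly_comp; apply: eq_map_poly => z /=; rewrite rmorph_int. Qed.

Lemma cpoly_neq0 : p != 0 -> C != 0.
Proof. by move=> p0; rewrite map_poly_eq0_id0 // intr_eq0 lead_coef_eq0. Qed.

Lemma size_cpoly : p != 0 -> size C = size p.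
Proof.
by move=> p0; rewrite size_map_poly_id0 // intr_eq0 lead_coef_eq0.
Qed.

Lemma root_list_exists : p != 0 ->
  {zs : seq R[i] | root_list p zs /\ (size zs).+1 = size p}.
Proof.
move=> p0; have [zs zsE] := closed_field_poly_normal C.
have l0 : lead_coef C != 0 by rewrite lead_coef_eq0 cpoly_neq0.
exists zs; split; first by split.
by rewrite -size_cpoly // zsE size_scale // size_prod_XsubC.
Qed.

Lemma mem_root_list zs z : root_list p zs -> (z \in zs) = root C z.
Proof. by move=> [l0 E]; rewrite /C E rootZ // root_prod_XsubC. Qed.

Lemma root_cpoly_real x : root C x%:C = root P x.
Proof. by rewrite cpolyE fmorph_root. Qed.

Lemma root_cpoly_conj z : root C z -> root C (conjc z).
Proof.
have CE : C = map_poly conjc C.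
  by rewrite /C /cpoly -map_poly_comp; apply: eq_map_poly => x /=; rewrite rmorph_int.
by rewrite {2}CE fmorph_root.
Qed.

Definition thin (t : R) (z : R[i]) : bool :=
  (0 < complex.Re z) && (`|complex.Im z| <= t * complex.Re z).

Lemma thin_near_ray t z : thin t z -> near_ray t 1 (complex.Re z) z.
Proof.
move=> /andP[h1 h2]; split; first exact: ltW.
rewrite expr1 addrAC subrr add0r; apply: le_trans (normc_ReIm _) _.
by case: z h1 h2 => a b /= h1 h2; rewrite subrr normr0 add0r oppr0 addr0.
Qed.

Lemma thin_conj t z : thin t (conjc z) = thin t z.
Proof. by case: z => a b; rewrite /thin /= normrN. Qed.

Lemma exprD1_lt2 (t : R) (n : nat) : 0 <= t -> n%:R * t < 1 / 2 -> (1 + t) ^+ n < 2.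
Proof.
move=> t0 h; suff : forall i, (i <= n)%N -> (1 + t) ^+ i <= 1 + 2 * (i%:R * t).
  by move=> /(_ _ (leqnn n)); lra.
elim=> [|i IH] le_in; first by rewrite expr0 mul0r mulr0 addr0.
have {}IH := IH (ltnW le_in); rewrite exprS -natr1.
have : i%:R * t <= n%:R * t by rewrite ler_wpM2r // ler_nat ltnW.
have : 0 <= i%:R * t by rewrite mulr_ge0.
have := ler_wpM2l (_ : 0 <= 1 + t) IH => /(_ ltac:(lra)).
nra.
Qed.

(* One of the two real points [Re z + Im z], [Re z - Im z], chosen such that its
   distance to [xi] is [|Re z - xi| + |Im z|]. *)
Definition flatten_root (xi : R) (z : R[i]) : R :=
  if 0 <= (complex.Re z - xi) * complex.Im z then complex.Re z + complex.Im z
  else complex.Re z - complex.Im z.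

Lemma flatten_root_dist xi z :
  normc (z - xi%:C) <= `|flatten_root xi z - xi| <= 2 * normc (z - xi%:C).
Proof.
have -> : `|flatten_root xi z - xi| = `|complex.Re z - xi| + `|complex.Im z|.
  case: z => a b; rewrite /flatten_root /=.
  case: (leP 0 (a - xi)) => h1; case: (leP 0 b) => h2; rewrite ?(ger0_norm h2) ?(ltr0_norm h2) ?(ger0_norm h1) ?(ltr0_norm h1).
  - by rewrite mulr_ge0 // ger0_norm; lra.
  - case: ifP => h; last by rewrite ger0_norm; lra.
    have : (a - xi) * b = 0 by apply: le_anti; rewrite h andbT mulr_ge0_le0 // ltW.
    by move/eqP; rewrite mulf_eq0 (lt_eqF h2) orbF => /eqP e; rewrite ltr0_norm; lra.
  - case: ifP => h; last by rewrite ltr0_norm; lra.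
    have : (a - xi) * b = 0 by apply: le_anti; rewrite h andbT mulr_le0_ge0 // ltW.
    by move/eqP; rewrite mulf_eq0 (lt_eqF h1) /= => /eqP e; rewrite ltr0_norm; lra.
  - by rewrite mulr_le0 ?(ltW h1) ?(ltW h2) // ltr0_norm; lra.
have h1 := normc_Re (z - xi%:C); have h2 := normc_Im (z - xi%:C).
have h3 := normc_ReIm (z - xi%:C).
have e1 : complex.Re (z - xi%:C) = complex.Re z - xi by case: z {h1 h2 h3}.
have e2 : complex.Im (z - xi%:C) = complex.Im z by case: z {h1 h2 h3 e1} => a b /=; rewrite oppr0 addr0.
by rewrite e1 e2 in h1 h2 h3; rewrite h3 /=; lra.
Qed.

End ChargedRoots.

(** * The total number of rounds *)

Section SumRounds.
Variables (R : rcfType) (p : {poly int}).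
Let P : {poly R} := map_poly intr p.
Let C := @cpoly R p.

Definition nterms : nat := size [seq i <- iota 0 (size p) | p`_i != 0].

Lemma thin_root_count (t : R) N (Z : seq R[i]) : p != 0 -> 0 <= t ->
  (size p <= N.+1)%N -> (nterms * (N + N))%:R * t < 1 / 2 ->
  uniq Z -> all (fun z => root C z && thin t z) Z -> (size Z < nterms)%N.
Proof.
move=> p0 t0 sN ht uZ /allP hZ.
have esE : [seq i <- iota 0 (size C) | C`_i != 0] = [seq i <- iota 0 (size p) | p`_i != 0].
  by rewrite size_cpoly //; apply: eq_filter => i; rewrite coef_map intr_eq0.
have := @thin_roots_lt R t t0 N C Z; rewrite esE; apply => //.
- exact: cpoly_neq0.
- by rewrite size_cpoly.
- by apply/allP => z /hZ /andP[].
- move=> z /hZ /andP[_ h]; exists (complex.Re z); last exact: thin_near_ray.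
  by case/andP: h.
- exact: exprD1_lt2.
Qed.

Lemma nterms_le : (nterms <= size p)%N.
Proof. by rewrite /nterms size_filter -[leqRHS](size_iota 0) count_size. Qed.

Lemma thin_close (t x : R) y : 0 < t -> 8 * t <= 1 -> 0 < x ->
  normc (y - x%:C) * 512 <= x * t -> thin t y.
Proof.
move=> t0 t8 x0.
have h2 := normc_Re (y - x%:C); have h3 := normc_Im (y - x%:C).
have e1 : complex.Re (y - x%:C) = complex.Re y - x by case: (y).
have e2 : complex.Im (y - x%:C) = complex.Im y by case: (y) => c d /=; rewrite oppr0 addr0.
rewrite e1 e2 in h2 h3; have d0 := normc_ge0 (y - x%:C).
move: (normc _) h2 h3 d0 => d h2 h3 d0 h4; rewrite /thin.
have h5 : d * (8 * t) <= d by rewrite ler_piMr.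
have h6 : x * (8 * t) <= x by rewrite ler_piMr // ltW.
move: h2; rewrite ler_norml => /andP[h2 _].
have h7 : 0 < complex.Re y by lra.
have h8 : t * (x - d) <= t * complex.Re y by rewrite ler_pM2l //; lra.
by apply/andP; split=> //; lra.
Qed.

Variables (m K : nat) (H : rat) (xi : 'I_m -> R) (a b : 'I_m -> rat).
Variables (J : 'I_m -> rat * rat) (n r : 'I_m -> nat).

Let beta := (3 * K + 20)%N.
Let it j i := iter i (round p (xi j) (n j) beta) (J j).

(** For each interval, all rounds but the last yield a root by [ascent_descent], and these roots
    form a shrinking chain. The premise bounding [width (J j) * 2 ^+ beta] by [(J j).1] puts them
    into the cone, the one with [b j - a j] makes the chain start well below the length of the
    interval, and the one with [H * tower (n j)] says that a round of successful steps would reach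
    the target. *)
Lemma sum_rounds :
  p != 0 -> (size p <= 2 ^ K)%N -> injective xi -> 0 < H ->
  (forall j, root P (xi j)) ->
  (forall j, 0 < xi j) ->
  (forall j, ratr (a j) < xi j /\ xi j < ratr (b j)) ->
  (forall i j, i != j -> b i <= a j \/ b j <= a i) ->
  (forall j, encloses (xi j) (J j)) ->
  (forall j, (0 < r j)%N -> 0 < (J j).1) ->
  (forall j, (0 < r j)%N -> width (J j) * 2 ^+ beta <= (J j).1) ->
  (forall j, (0 < r j)%N -> width (J j) * 2 ^+ beta <= b j - a j) ->
  (forall j, (0 < r j)%N -> 2 * width (J j) < H * tower (n j)) ->
  (forall j i, (i < r j)%N -> H <= width (it j i)) ->
  (\sum_j r j <= m + 2 * nterms)%N /\ (m <= nterms)%N.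
Proof.
move=> p0 sK xi_inj H0 rxi xi_gt0 xiI disj encJ J0 wJa wJab wH hr.
have [zs [zsE szs]] := root_list_exists R p0.
have rootzs z : (z \in zs) = root C z by rewrite (mem_root_list z zsE).
have xizs j : (xi j)%:C \in zs by rewrite rootzs root_cpoly_real.
pose u : R := 2 ^+ K.
have u1 : 1 <= u by rewrite exprn_ege1 // ler1n.
have uE : ((2 ^ K)%N%:R : R) = u by rewrite natrX.
pose G : R := 256 * u.
(* Consecutive roots of a chain are compared through two widths, at the expense of
   [G ^+ 2 = 2 ^+ 16 * u ^+ 2]. The bisections outweigh this and leave a factor [16 u], enough for
   the factor 2 of [flatten_root] and for the ratio [2 u] of the chain. *)
have BE : ratr (2 ^+ beta) = 2 ^+ 20 * u ^+ 3 :> R.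
  by rewrite rmorphXn rmorph_nat /beta exprD mulrC mulnC exprM.
have GE : 256 * (size zs)%:R <= G.
  by apply: ler_wpM2l; rewrite ?ler0n // -uE ler_nat; apply: leq_trans sK; rewrite -szs.
have e20 : 2 ^+ 20 = 16 * (256 * 256) :> R.
  by rewrite -[20%N]/(4 + (8 + 8))%N !exprD; congr (_ * (_ * _)); ring.
(* Both [nterms] and the number of roots are at most [u], so the product required to be below
   [1 / 2] is at most [1 / 4]. *)
pose t : R := (8 * u ^+ 2)^-1.
have t0 : 0 < t by rewrite invr_gt0 mulr_gt0 // exprn_gt0 //; lra.
have tE : t * (8 * u ^+ 2) = 1 by rewrite mulVf // gt_eqF // mulr_gt0 // exprn_gt0 //; lra.
have ht : (nterms * (size zs + size zs))%:R * t < 1 / 2.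
  have h1 : (nterms%:R : R) <= u by rewrite -uE ler_nat (leq_trans nterms_le).
  have h2 : ((size zs)%:R : R) <= u by rewrite -uE ler_nat; apply: leq_trans sK; rewrite -szs.
  have : (nterms * (size zs + size zs))%:R <= 2 * u ^+ 2 :> R.
    rewrite natrM natrD; have := ler_pM (ler0n R nterms) (ler0n R (size zs)) h1 h2.
    by rewrite expr2; lra.
  move/(ler_wpM2r (ltW t0)) => h; apply: le_lt_trans h _; lra.
have ncount Z : uniq Z -> all (fun z => root C z && thin t z) Z -> (size Z < nterms)%N.
  by apply: thin_root_count (ltW t0) _ ht; rewrite // szs.
pose dist j (z : R[i]) : R := normc (z - (xi j)%:C).
pose wR I : R := ratr (width I).
have encI j i : encloses (xi j) (it j i) /\ subint (it j i) (J j).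
  elim: i => [|i [h1 h2]]; first by split; [exact: encJ | exact: subint_refl].
  have [h3 h4 _] := round_spec p (n j) beta h1.
  by split; [exact: h3 | exact: subint_trans h2 h4].
have B0 : 0 < 2 ^+ 20 * u ^+ 3 by rewrite mulr_gt0 // exprn_gt0 //; lra.
have B2 : 2 <= 2 ^+ beta :> rat.
  by rewrite /beta addnS exprS; have : 1 <= 2 ^+ (3 * K + 19) :> rat by [rewrite exprn_ege1]; lra.
have xi_ge j : ratr (J j).1 <= xi j by have /andP[] := encloses_le (encJ j).
have wR_J j : (0 < r j)%N -> wR (J j) * (2 ^+ 20 * u ^+ 3) <= xi j.
  by move=> rj; apply: le_trans (xi_ge j); rewrite -BE -rmorphM ler_rat wJa.
have wR_ab j : (0 < r j)%N -> wR (J j) * (2 ^+ 20 * u ^+ 3) <= ratr (b j) - ratr (a j).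
  by move=> rj; rewrite -BE -rmorphM -rmorphB ler_rat wJab.
have wR_it j i : wR (it j i) <= wR (J j).
  by rewrite /wR ler_rat; apply: subint_width; case: (encI j i).
pose D j i := descent p (xi j) (n j) (ascent p (xi j) (n j) (it j i)).
pose good j i z := [&& z != (xi j)%:C, wR (D j i) <= G * dist j z & dist j z <= G * wR (it j i)].
(* A round that is followed by another one cannot have succeeded throughout: its width would have
   dropped below [H]. *)
have exz j i : (i.+1 < r j)%N -> has (good j i) zs.
  move=> lt_ir; have [h1 h2] := encI j i.
  have Hw : H <= width (it j i) by apply: hr; apply: ltnW.
  have w0 : 0 < width (it j i) by apply: lt_le_trans Hw.
  have wlt : width (it j i) < (it j i).1.
    have /andP[h3 _] := h2; apply: lt_le_trans h3.
    have r0 : (0 < r j)%N by apply: leq_ltn_trans lt_ir.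
    have h4 := J0 j r0; have h5 := subint_width h2.
    have h6 := wJa j r0; have h7 := encloses_width (encJ j).
    have [h8|h8] := eqVneq (width (J j)) 0; first by lra.
    have h9 : 0 < width (J j) by rewrite lt_def h8.
    have h11 : width (J j) * 2 <= width (J j) * 2 ^+ beta by rewrite ler_pM2l.
    by clear -h11 h9 h6 h5 h4; lra.
  have [h|[z [h3 h4 h5 h6]]] := ascent_descent (n j) zsE (xizs j) GE h1 wlt w0.
    have [h3 h4 h5] := round_spec p (n j) beta h1.
    have h6 := hr j i.+1 lt_ir; rewrite /it iterS -/(it j i) in h6.
    rewrite -/(D j i) in h h5.
    have hD : 0 <= width (D j i) by apply: encloses_width (descent_encloses _ _ (ascent_encloses _ _ h1)).
    have h7 : width (D j i) / 2 ^+ beta <= width (D j i) by rewrite ler_pdivrMr ?ler_peMr //; lra.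
    have T0 : 0 < tower (n j) by have := tower_ge2 (n j); lra.
    have h8 : H * tower (n j) <= width (D j i) * tower (n j) by rewrite ler_pM2r //; lra.
    have h9 := subint_width h2.
    by have := wH j (leq_ltn_trans (leq0n _) lt_ir); lra.
  by apply/hasP; exists z => //; apply/and3P.
pose z j i := nth 0 zs (find (good j i) zs).
have zP j i : (i < (r j).-1)%N -> good j i (z j i) /\ z j i \in zs.
  move=> lt_ir; have h : has (good j i) zs by apply: exz; rewrite -ltn_predRL.
  by split; [exact: nth_find | rewrite mem_nth // -has_find].
have GwJ j : (0 < r j)%N -> G * wR (J j) * (4096 * u ^+ 2) <= xi j.
  by move=> rj; have := wR_J j rj; congr (_ <= _); rewrite /G; ring.
have G0 : 0 <= G := mulr_ge0 (ler0n R 256) (le_trans ler01 u1).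
have t8 : 8 * t <= 1.
  rewrite -[leRHS]tE [8 * t]mulrC; apply: (ler_wpM2l (ltW t0)).
  exact: ler_peMr (ler0n R 8) (exprn_ege1 2 u1).
have zthin j y : (0 < r j)%N -> dist j y <= G * wR (J j) -> thin t y.
  move=> rj h; have h1 : dist j y * (4096 * u ^+ 2) <= xi j.
    apply: le_trans (GwJ j rj); apply: ler_wpM2r h.
    by apply: mulr_ge0 (sqr_ge0 u); apply: ler0n.
  have h4 : dist j y * 512 <= xi j * t.
    have := ler_wpM2r (ltW t0) h1.
    have -> : dist j y * (4096 * u ^+ 2) * t = dist j y * 512 * (t * (8 * u ^+ 2)) by ring.
    by rewrite tE mulr1.
  exact: thin_close t0 t8 (xi_gt0 j) h4.
pose Z := undup [seq y <- zs | thin t y].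
have memZ y : (y \in Z) = thin t y && root C y by rewrite mem_undup mem_filter rootzs.
have uZ : uniq Z by apply: undup_uniq.
have ltZ : (size Z < nterms)%N.
  by apply: ncount => //; apply/allP => y; rewrite memZ andbC.
have xiZ j : (xi j)%:C \in Z.
  rewrite memZ root_cpoly_real rxi andbT; apply: (thin_close t0 t8 (xi_gt0 j)).
  by rewrite subrr normc0 mul0r mulr_ge0 // ltW.
(* One point per root suffices: the other choice of [flatten_root] is the point of the conjugate,
   which is in [Z] too. *)
pose X := [seq complex.Re y + complex.Im y | y <- Z].
have sX : size X = size Z by rewrite size_map.
have flatX j y : y \in Z -> flatten_root (xi j) y \in X.
  move=> yZ; rewrite /flatten_root; case: ifP => _; first exact: map_f.
  have : conjc y \in Z by move: yZ; rewrite !memZ thin_conj => /andP[-> /root_cpoly_conj].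
  by move/(map_f (fun y => complex.Re y + complex.Im y)); case: (y).
have zZ j i : (i < (r j).-1)%N -> z j i \in Z.
  move=> lt_ir; have [/and3P[_ _ h] zzs] := zP _ _ lt_ir; rewrite memZ -rootzs zzs andbT.
  apply: (zthin j); first by case: (r j) lt_ir.
  by apply: le_trans h _; apply: ler_wpM2l.
have mZ : (m <= size Z)%N.
  have : {subset [seq (xi j)%:C | j <- enum 'I_m] <= Z} by move=> y /mapP[j _ ->].
  move/uniq_leq_size; rewrite size_map size_enum_ord; apply.
  by rewrite map_inj_uniq ?enum_uniq // => i j [] /xi_inj.
have distD j i : (i < (r j).-1)%N -> 0 < dist j (z j i).
  by move=> /zP[/and3P[h _ _] _]; rewrite normc_gt0 subr_eq0.
have szX : ((size X)%:R : R) <= u.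
  by rewrite -uE ler_nat sX (leq_trans (ltnW ltZ)) // (leq_trans nterms_le).
(* The last rounds of the intervals are paid for by the summand [m]. *)
suff : (\sum_j (r j).-1 <= 2 * size X)%N.
  rewrite sX => h; split; last by apply: leq_trans mZ (ltnW ltZ).
  apply: (@leq_trans (\sum_(j < m) (1 + (r j).-1))%N).
    by apply: leq_sum => j _; rewrite add1n leqSpred.
  by rewrite big_split /= sum1_card card_ord leq_add2l (leq_trans h) // leq_mul2l ltnW.
apply: (@sum_shrinking_chains R X m xi (fun j => ratr (a j)) (fun j => ratr (b j))
  (fun j => (r j).-1) (fun j i => flatten_root (xi j) (z j i)) (2 * u)).
- exact: ler_wpM2l (ler0n R 2) _ _ szX.
- by apply: le_trans u1 (ler_peMl (le_trans ler01 u1) _); rewrite ler1n.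
- exact: xiI.
- by move=> i j /disj; rewrite !ler_rat.
- move=> j; have := map_f (fun y => complex.Re y + complex.Im y) (xiZ j).
  by rewrite /= addr0.
- move=> j i lt_ir; split; first exact: flatX (zZ _ _ lt_ir).
  have /andP[h _] := flatten_root_dist (xi j) (z j i).
  exact: lt_le_trans (distD _ _ lt_ir) h.
- move=> j r0; have [/and3P[_ _ h1] _] := zP _ _ r0.
  have u0 : 0 < u by apply: lt_le_trans u1.
  have /andP[_ h2] := flatten_root_dist (xi j) (z j 0%N).
  rewrite -/(dist j (z j 0%N)) in h2.
  have r0' : (0 < r j)%N by case: (r j) r0.
  have h3 := wR_ab j r0'; have h4 := wR_it j 0%N.
  apply: (@le_lt_trans _ _ (4 * u * dist j (z j 0%N))).
    by have := ler_wpM2r (ltW u0) h2; clear; lra.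
  apply: (@le_lt_trans _ _ (1024 * u ^+ 2 * wR (J j))).
    have := ler_wpM2l (ltW u0) h1; have := ler_wpM2l (mulr_ge0 (ltW u0) G0) h4.
    by rewrite /G expr2; clear; lra.
  have ab : 0 < ratr (b j) - ratr (a j) :> R by have [h5 h6] := xiI j; rewrite subr_gt0 (lt_trans h5 h6).
  have w0 : 0 <= wR (J j) by rewrite /wR ler0q (encloses_width (encJ j)).
  have e : 0 <= u ^+ 2 * wR (J j) by rewrite mulr_ge0 ?sqr_ge0.
  have e' : u ^+ 2 * wR (J j) <= u * (u ^+ 2 * wR (J j)) by rewrite ler_peMl.
  have [e0|e0] := eqVneq (u ^+ 2 * wR (J j)) 0; first by rewrite -mulrA e0 mulr0.
  have : 0 < u ^+ 2 * wR (J j) by rewrite lt_def e0.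
  have {}h3 : 16 * (256 * 256) * (u * (u ^+ 2 * wR (J j))) <= ratr (b j) - ratr (a j).
    by move: h3; rewrite e20; congr (_ <= _); ring.
  by rewrite -mulrA; move: (u ^+ 2 * wR (J j)) h3 e e' ab => Y; move: (u * Y) => Y'; lra.
- move=> j i lt_ir; have lt_ir' := ltnW lt_ir.
  have [/and3P[_ _ h1] _] := zP _ _ lt_ir.
  have [/and3P[_ h2 _] _] := zP _ _ lt_ir'.
  have /andP[_ h3] := flatten_root_dist (xi j) (z j i.+1).
  have /andP[h4 _] := flatten_root_dist (xi j) (z j i).
  rewrite -/(dist j (z j i.+1)) in h3; rewrite -/(dist j (z j i)) in h4.
  have [_ _ h5] := round_spec p (n j) beta (encI j i).1.
  have {h5} h5 : wR (it j i.+1) * (2 ^+ 20 * u ^+ 3) <= wR (D j i).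
    rewrite -BE -rmorphM ler_rat -ler_pdivlMr ?exprn_gt0 //; exact: h5.
  have u0 : 0 < u by apply: lt_le_trans u1.
  have d0 := distD _ _ lt_ir'.
  apply: lt_le_trans h4; apply: (@le_lt_trans _ _ (4 * u * dist j (z j i.+1))).
    by have := ler_wpM2r (ltW u0) h3; clear; lra.
  have h6 : dist j (z j i.+1) * (2 ^+ 20 * u ^+ 3) <= G * (G * dist j (z j i)).
    apply: le_trans (ler_wpM2r (ltW B0) h1) _; rewrite -mulrA ler_wpM2l //.
    exact: le_trans h5 h2.
  have u2 : 0 < 256 * 256 * u ^+ 2 by rewrite !mulr_gt0 ?exprn_gt0 ?ltr0n.
  have : (256 * 256 * u ^+ 2) * (16 * u * dist j (z j i.+1)) <= (256 * 256 * u ^+ 2) * dist j (z j i).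
    by move: h6; rewrite e20; congr (_ <= _); rewrite /G; ring.
  by rewrite (ler_pM2l u2); move: d0; clear; lra.
Qed.

End SumRounds.

End RoundCount.

(** * Running programs *)

(** Total correctness: a run with the required result exists, and by determinism of the machine it
    is the only one. The cost is an argument of the postcondition. *)
Definition wp (c : cmd) (st : state) (Q : nat -> state -> Prop) : Prop :=
  exists t st', exec c st t st' /\ Q t st'.

Lemma wp_mono c st (Q Q' : nat -> state -> Prop) :
  wp c st Q -> (forall t st', Q t st' -> Q' t st') -> wp c st Q'.
Proof. by move=> [t [st' [h1 h2]]] h; exists t, st'; split=> //; apply: h. Qed.

Lemma wp_skip st (Q : nat -> state -> Prop) : Q 0%N st -> wp Skip st Q.
Proof. by move=> h; exists 0%N, st; split=> //; apply: ESkip. Qed.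

Lemma wp_nset r e st (Q : nat -> state -> Prop) :
  Q 0%N (set_nreg st r (neval st e)) -> wp (NSet r e) st Q.
Proof. by move=> h; do 2!eexists; split; first exact: ENSet. Qed.

Lemma wp_lit d q st (Q : nat -> state -> Prop) :
  Q 0%N (set_qmem st d q) -> wp (QLit d q) st Q.
Proof. by move=> h; do 2!eexists; split; first exact: EQLit. Qed.

Lemma wp_copy d x st (Q : nat -> state -> Prop) :
  Q 0%N (set_qmem st d (qeval st x)) -> wp (QCopy d x) st Q.
Proof. by move=> h; do 2!eexists; split; first exact: EQCopy. Qed.

Lemma wp_op o d x y st (Q : nat -> state -> Prop) : qdefined o (qeval st y) ->
  Q 1%N (set_qmem st d (apply_qop o (qeval st x) (qeval st y))) ->
  wp (QOp o d x y) st Q.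
Proof. by move=> h1 h; do 2!eexists; split; first exact: EQOp. Qed.

Lemma wp_cmp r x y st (Q : nat -> state -> Prop) :
  Q 1%N (set_nreg st r (cmp_code (qeval st x) (qeval st y))) ->
  wp (QCmp r x y) st Q.
Proof. by move=> h; do 2!eexists; split; first exact: EQCmp. Qed.

Lemma wp_seq c1 c2 st (Q : nat -> state -> Prop) :
  wp c1 st (fun t1 st1 => wp c2 st1 (fun t2 => Q (t1 + t2)%N)) ->
  wp (Seq c1 c2) st Q.
Proof.
move=> [t1 [st1 [h1 [t2 [st2 [h2 h]]]]]]; exists (t1 + t2)%N, st2; split=> //.
exact: ESeq h1 h2.
Qed.

Lemma wp_if e c1 c2 st (Q : nat -> state -> Prop) :
  (if neval st e != 0%N then wp c1 st Q else wp c2 st Q) -> wp (If e c1 c2) st Q.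
Proof.
by case: ifPn => [h|/negPn h] [t [st' [h1 h2]]]; exists t, st'; split=> //;
  [apply: EIfTrue | apply: EIfFalse].
Qed.

(** The number [n] of passes is fixed in advance and the invariant indexed by the passes made and
    the cost so far, so termination needs no separate measure. *)
Lemma wp_while_iter e c st (I : nat -> nat -> state -> Prop) (n : nat)
    (Q : nat -> state -> Prop) :
  I 0%N 0%N st ->
  (forall i t st1, (i < n)%N -> I i t st1 -> neval st1 e != 0%N /\
     wp c st1 (fun t' => I i.+1 (t + t')%N)) ->
  (forall t st1, I n t st1 -> neval st1 e = 0%N /\ Q t st1) ->
  wp (While e c) st Q.
Proof.
move=> h0 hs hn.
suff loop d i t st1 : (i + d = n)%N -> I i t st1 ->
    wp (While e c) st1 (fun t' st2 => Q (t + t')%N st2).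
  exact: (loop n 0%N 0%N st).
elim: d i t st1 => [|d IH] i t st1 hi hI.
  rewrite addn0 in hi; rewrite hi in hI; have [h1 h2] := hn _ _ hI.
  by exists 0%N, st1; rewrite addn0; split=> //; apply: EWhileStop; rewrite h1.
have [|h1 [t1 [st2 [h2 h3]]]] := hs i t st1 _ hI; first by lia.
have [|t2 [st3 [h4 h5]]] := IH i.+1 (t + t1)%N st2 _ h3; first by lia.
exists (t1 + t2)%N, st3; rewrite addnA; split=> //.
exact: EWhileStep h1 h2 h4.
Qed.

Definition block (cs : seq cmd) : cmd := foldr Seq Skip cs.

(* Register 2 holds the address of the first cell after the input; [var i] is
   the [i]-th cell from there on.  Cells 0 to 5 hold 0, 1/2, 1, a power of two
   above the degree, the target width and a bound for the coefficients; cells 6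
   and 7 the current interval, 8 a value of [p] to the left of its root, 9 to 12
   the argument and the results of an evaluation, [40 + i] the number
   2^(2^i), and the remaining ones intermediate results. *)
Definition var (i : nat) : nexp := NAdd (NReg 2) (NLit i).

Definition val (st : state) (i : nat) : rat := qmem st (nreg st 2 + i)%N.

(** A frame condition. Cells are counted from register 2 of the first state, which is why
    transitivity requires this register to be unchanged. *)
Definition keeps (rs vs : seq nat) (st st' : state) : Prop :=
  (forall r, r \notin rs -> nreg st' r = nreg st r) /\
  (forall a, (forall v, v \in vs -> a <> nreg st 2 + v)%N -> qmem st' a = qmem st a).

Lemma keeps_refl rs vs st : keeps rs vs st st.
Proof. by []. Qed.

Lemma keeps_sub rs vs rs' vs' st st' : {subset rs <= rs'} -> {subset vs <= vs'} ->
  keeps rs vs st st' -> keeps rs' vs' st st'.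
Proof.
move=> hr hv [h1 h2]; split=> [r h|a h]; first by apply: h1; apply: contra h => /hr.
by apply: h2 => v /hv; apply: h.
Qed.

Lemma keeps_trans rs vs st1 st2 st3 :
  keeps rs vs st1 st2 -> keeps rs vs st2 st3 -> 2 \notin rs -> keeps rs vs st1 st3.
Proof.
move=> [h1 h2] [h3 h4] r2; split=> [r h|a h]; first by rewrite h3 // h1.
by rewrite h4 ?h2 // => v vv; rewrite h1 //; apply: h.
Qed.

Lemma keeps_reg rs vs st st' r : keeps rs vs st st' -> r \notin rs ->
  nreg st' r = nreg st r.
Proof. by move=> [h _]; apply: h. Qed.

Lemma keeps_val rs vs st st' v : keeps rs vs st st' -> 2 \notin rs -> v \notin vs ->
  val st' v = val st v.
Proof.
move=> [h1 h2] r2 hv; rewrite /val h1 // h2 // => w hw /addnI vw.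
by rewrite vw hw in hv.
Qed.

Lemma keeps_low rs vs st st' a : keeps rs vs st st' -> (a < nreg st 2)%N ->
  qmem st' a = qmem st a.
Proof. by move=> [_ h] ha; apply: h => v _; lia. Qed.

Lemma keeps_nset rs vs st0 st r n : r \in rs -> keeps rs vs st0 st ->
  keeps rs vs st0 (set_nreg st r n).
Proof.
move=> hr [h1 h2]; split=> // r' hr' /=; case: eqP => [e|_]; last exact: h1.
by rewrite e hr in hr'.
Qed.

Lemma keeps_qset rs vs st0 st v q : 2 \notin rs -> v \in vs -> keeps rs vs st0 st ->
  keeps rs vs st0 (set_qmem st (var v) q).
Proof.
move=> r2 hv [h1 h2]; split=> // a ha /=; case: eqP => [e|_]; last exact: h2.
by case: (ha v hv); rewrite e h1.
Qed.

Lemma val_nset st r n v :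
  val (set_nreg st r n) v = if r == 2 then qmem st (n + v) else val st v.
Proof. by rewrite /val /= eq_sym; case: (r == 2). Qed.

Lemma val_qset st w q v : val (set_qmem st (var w) q) v = if v == w then q else val st v.
Proof. by rewrite /val /= eqn_add2l. Qed.

#[local] Arguments val : simpl never.
#[local] Arguments qeval : simpl never.
#[local] Arguments var : simpl never.

Lemma qevalE st i : qeval st (var i) = val st i. Proof. by []. Qed.

Lemma cmp_code_neq0 x y : (cmp_code x y != 0%N) = (y <= x).
Proof. by rewrite /cmp_code; case: ltgtP. Qed.

Lemma cmp_code_lt x y : (1 - cmp_code x y != 0)%N = (x < y).
Proof. by rewrite /cmp_code; case: ltgtP. Qed.

Lemma cmp_code_le x y : (2 - cmp_code x y != 0)%N = (x <= y).
Proof. by rewrite /cmp_code; case: ltgtP. Qed.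

Lemma cmp_code_gt x y : (cmp_code x y - 1 != 0)%N = (y < x).
Proof. by rewrite /cmp_code; case: ltgtP. Qed.

Lemma wp_op_var o d x y st (Q : nat -> state -> Prop) vx vy :
  val st x = vx -> val st y = vy -> qdefined o vy ->
  Q 1%N (set_qmem st (var d) (apply_qop o vx vy)) ->
  wp (QOp o (var d) (var x) (var y)) st Q.
Proof. by move=> <- <- h1 h2; apply: wp_op. Qed.

Lemma wp_cmp_var r x y st (Q : nat -> state -> Prop) vx vy :
  val st x = vx -> val st y = vy ->
  Q 1%N (set_nreg st r (cmp_code vx vy)) -> wp (QCmp r (var x) (var y)) st Q.
Proof. by move=> <- <- h; apply: wp_cmp. Qed.

Lemma wp_copy_var d x st (Q : nat -> state -> Prop) vx : val st x = vx ->
  Q 0%N (set_qmem st (var d) vx) -> wp (QCopy (var d) (var x)) st Q.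
Proof. by move=> <- h; apply: wp_copy. Qed.

Lemma wp_nset_val r e v st (Q : nat -> state -> Prop) : neval st e = v ->
  Q 0%N (set_nreg st r v) -> wp (NSet r e) st Q.
Proof. by move=> <- h; apply: wp_nset. Qed.

Ltac vals := rewrite ?(qevalE, val_qset, val_nset) /=.
Ltac read := vals; reflexivity.
Ltac run := cbn [block foldr]; repeat lazymatch goal with
  | |- wp (Seq _ _) _ _ => apply: wp_seq
  | |- wp (QOp QDiv _ _ _) _ _ => fail
  | |- wp (QOp _ (var _) (var _) (var _)) _ _ =>
      eapply wp_op_var; [read | read | exact isT | cbn [apply_qop]]
  | |- wp (QOp _ _ _ _) _ _ => apply: wp_op; [exact isT | ]
  | |- wp (QCmp _ (var _) (var _)) _ _ => eapply wp_cmp_var; [read | read | ]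
  | |- wp (QCmp _ _ _) _ _ => apply: wp_cmp
  | |- wp (NSet _ _) _ _ => eapply wp_nset_val; [simpl; reflexivity | ]
  | |- wp (QLit _ _) _ _ => apply: wp_lit
  | |- wp (QCopy (var _) (var _)) _ _ => eapply wp_copy_var; [read | ]
  | |- wp (QCopy _ _) _ _ => apply: wp_copy
  | |- wp Skip _ _ => apply: wp_skip
  end.
Ltac kept := repeat first
  [ apply: keeps_nset; [exact isT | ] | apply: keeps_qset; [exact isT | exact isT | ]
  | apply: keeps_refl | assumption ].

(** * Evaluation of a sparse polynomial *)

Definition pow_prog : cmd := block
  [:: QLit (var 14) 1; QCopy (var 15) (var 3); NSet 6 (NReg 3);
      While (NReg 6) (block
        [:: QOp QMul (var 15) (var 15) (var 1); QOp QMul (var 14) (var 14) (var 14);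
            QCmp 7 (var 13) (var 15);
            If (NReg 7) (block [:: QOp QSub (var 13) (var 13) (var 15);
                                   QOp QMul (var 14) (var 14) (var 9)]) Skip;
            NSet 6 (NSub (NReg 6) (NLit 1))])].

(** The exponent sits in a rational cell and can influence registers through comparisons only. Its
    binary digits are therefore read from the top, by comparing the remainder with a power of two
    that is halved in each pass; [q] is the number formed by the digits read so far. *)
Lemma pow_spec st (e K : nat) : val st 1 = 2^-1 -> val st 3 = 2 ^+ K ->
  nreg st 3 = K -> val st 13 = e%:R -> (e < 2 ^ K)%N ->
  wp pow_prog st (fun t st' => [/\ (t <= 5 * K)%N,
    keeps [:: 6; 7] [:: 13; 14; 15] st st' & val st' 14 = val st 9 ^+ e]).
Proof.
move=> hhalf hpk hK he eK; rewrite /pow_prog; run.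
pose I (i t : nat) st' := [/\ (t <= 5 * i)%N,
  keeps [:: 6; 7] [:: 13; 14; 15] st st', nreg st' 6 = (K - i)%N,
  val st' 15 = 2 ^+ (K - i) &
  exists q r, [/\ (e = q * 2 ^ (K - i) + r)%N, (r < 2 ^ (K - i))%N,
     val st' 13 = r%:R & val st' 14 = val st 9 ^+ q]].
apply: (@wp_while_iter _ _ _ I K).
- split=> //; first by kept.
  + by rewrite /= hK subn0.
  + by vals; rewrite hpk subn0.
  + by exists 0%N, e; vals; rewrite subn0 mul0n add0n expr0.
- move=> i t st1 iK [ht kp h6 h15 [q [r [heq hr h13 h14]]]].
  split; first by rewrite /= h6 subn_eq0 -ltnNge.
  have v1 : val st1 1 = 2^-1 by rewrite (keeps_val kp).
  have v9 : val st1 9 = val st 9 by rewrite (keeps_val kp).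
  have Kd : (K - i = (K - i.+1).+1)%N by lia.
  have p15 : val st1 15 * 2^-1 = 2 ^+ (K - i.+1).
    by rewrite h15 Kd exprSr mulfK.
  run; apply: wp_if; vals.
  rewrite cmp_code_neq0 v1 p15 h13 -[X in X <= _]natrX ler_nat.
  case: leqP => hcmp; run.
  + split; [lia | kept | by rewrite /= h6; lia | by vals |].
    exists (2 * q + 1)%N, (r - 2 ^ (K - i.+1))%N; split.
    * by rewrite heq Kd expnS; lia.
    * by move: hr; rewrite Kd expnS; lia.
    * by vals; rewrite h13 natrB // natrX.
    * by vals; rewrite h14 v9 -exprD -exprSr; congr (_ ^+ _); lia.
  + split; [lia | kept | by rewrite /= h6; lia | by vals |].
    exists (2 * q)%N, r; split.
    * by rewrite heq Kd expnS; lia.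
    * by [].
    * by vals; rewrite h13.
    * by vals; rewrite h14 -exprD; congr (_ ^+ _); lia.
- move=> t st1 [ht kp h6 _ [q [r [heq hr _ h14]]]]; split; first by rewrite /= h6 subnn.
  rewrite subnn expn0 in heq hr; run; split=> //; first by lia.
  by rewrite h14; congr (_ ^+ _); lia.
Qed.

Definition lsum (s : seq (nat * int)) (e : nat) (x : rat) : rat :=
  \sum_(t <- s) t.2%:~R * t.1%:R ^+ e * x ^+ t.1.

Lemma lsum_wsum p s e x : sparse_repr p s -> lsum s e x = wsum p e x.
Proof.
move=> hs; rewrite /lsum (perm_big _ hs) /= big_map big_filter /wsum.
rewrite -(big_mkord xpredT (fun i => (p`_i)%:~R * i%:R ^+ e * x ^+ i)).
rewrite /index_iota subn0 big_mkcond; apply: eq_bigr => i _ /=.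
by case: eqVneq => //= ->; rewrite !mul0r.
Qed.

Record env (s : seq (nat * int)) (K : nat) (H M : rat) (st : state) : Prop := Env {
  env_size : nreg st 0 = size s;
  env_base : (2 * size s < nreg st 2)%N;
  env_K : nreg st 3 = K;
  env_exp : forall i, (i < size s)%N -> qmem st (1 + 2 * i)%N = (nth (0%N, 0) s i).1%:R;
  env_coef : forall i, (i < size s)%N -> qmem st (2 + 2 * i)%N = (nth (0%N, 0) s i).2%:~R;
  env_zero : val st 0 = 0;
  env_half : val st 1 = 2^-1;
  env_one : val st 2 = 1;
  env_pk : val st 3 = 2 ^+ K;
  env_H : val st 4 = H;
  env_M : val st 5 = M;
  env_lt : forall t, t \in s -> (t.1 < 2 ^ K)%N }.

Lemma env_keeps s K H M rs vs st st' : env s K H M st -> keeps rs vs st st' ->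
  [&& 0 \notin rs, 2 \notin rs & 3 \notin rs]%N ->
  [&& 0 \notin vs, 1 \notin vs, 2 \notin vs, 3 \notin vs, 4 \notin vs & 5 \notin vs]%N ->
  env s K H M st'.
Proof.
case=> h0 hb hK he hc z0 z1 z2 z3 z4 z5 hlt kp /and3P[r0 r2 r3].
case/and5P=> v0 v1 v2 v3 /andP[v4 v5].
split; rewrite ?(keeps_reg kp) ?(keeps_val kp) //.
- by move=> i hi; rewrite (keeps_low kp) ?he //; lia.
- by move=> i hi; rewrite (keeps_low kp) ?hc //; lia.
Qed.

Lemma qeval_low st st' a e rs vs : keeps rs vs st st' -> (a < nreg st 2)%N ->
  neval st' e = a -> qeval st' e = qmem st a.
Proof. by move=> kp ha ha'; rewrite /qeval ha' (keeps_low kp). Qed.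

(** One pass over the list yields all three sums, since multiplication by the exponent turns a term
    of one sum into the corresponding term of the next. *)
Definition eval_prog : cmd := block
  [:: QLit (var 10) 0; QLit (var 11) 0; QLit (var 12) 0;
      NSet 4 (NLit 1); NSet 5 (NReg 0);
      While (NReg 5) (block
        [:: QCopy (var 22) (NReg 4); QCopy (var 23) (NAdd (NReg 4) (NLit 1));
            QCopy (var 13) (var 22); pow_prog;
            QOp QMul (var 16) (var 14) (var 23); QOp QAdd (var 10) (var 10) (var 16);
            QOp QMul (var 16) (var 16) (var 22); QOp QAdd (var 11) (var 11) (var 16);
            QOp QMul (var 16) (var 16) (var 22); QOp QAdd (var 12) (var 12) (var 16);
            NSet 4 (NAdd (NReg 4) (NLit 2)); NSet 5 (NSub (NReg 5) (NLit 1))])].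

Definition eval_regs : seq nat := [:: 4; 5; 6; 7].
Definition eval_vars : seq nat := [:: 10; 11; 12; 13; 14; 15; 16; 22; 23].
Definition eval_cost (s : seq (nat * int)) (K : nat) : nat := size s * (5 * K + 6).

Lemma lsum_take s i e x : (i < size s)%N ->
  lsum (take i.+1 s) e x = lsum (take i s) e x +
    (nth (0%N, 0) s i).2%:~R * (nth (0%N, 0) s i).1%:R ^+ e * x ^+ (nth (0%N, 0) s i).1.
Proof. by move=> hi; rewrite (take_nth (0%N, 0)) // /lsum big_rcons /= addrC. Qed.

Lemma eval_spec s K H M st : env s K H M st ->
  wp eval_prog st (fun t st' => [/\ (t <= eval_cost s K)%N,
    keeps eval_regs eval_vars st st', val st' 10 = lsum s 0 (val st 9),
    val st' 11 = lsum s 1 (val st 9) & val st' 12 = lsum s 2 (val st 9)]).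
Proof.
move=> hst; have [h0 hb hK he hc z0 z1 z2 z3 z4 z5 hlt] := hst.
rewrite /eval_prog; run.
set x := val st 9.
pose I (i t : nat) st' := [/\ (t <= i * (5 * K + 6))%N,
  keeps eval_regs eval_vars st st', nreg st' 4 = (1 + 2 * i)%N, nreg st' 5 = (size s - i)%N &
  [/\ val st' 10 = lsum (take i s) 0 x, val st' 11 = lsum (take i s) 1 x
     & val st' 12 = lsum (take i s) 2 x]].
apply: (@wp_while_iter _ _ _ I (size s)).
- split=> //; [by kept | by rewrite /= h0 subn0 |].
  by vals; rewrite /lsum take0 !big_nil.
- move=> i t st1 hi [ht kp h4 h5 [s0 s1 s2]].
  split; first by rewrite /= h5 subn_eq0 -ltnNge.
  have e1 := env_keeps hst kp isT isT.
  run.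
  set st2 := set_qmem st1 _ _; set st3 := set_qmem st2 _ _; set st4 := set_qmem st3 _ _.
  have k2 : keeps eval_regs eval_vars st st2 by kept.
  have k4 : keeps eval_regs eval_vars st st4 by kept.
  have e4 := env_keeps hst k4 isT isT.
  set tm := nth (0%N, 0) s i; have hts : tm \in s by apply: mem_nth.
  have v22 : val st4 22 = tm.1%:R.
    rewrite /st4 /st3 /st2; vals.
    by rewrite (qeval_low kp (a := 1 + 2 * i)) ?he //; lia.
  have v23 : val st4 23 = tm.2%:~R.
    rewrite /st4 /st3; vals.
    by rewrite (qeval_low k2 (a := 2 + 2 * i)) ?hc //; [lia | rewrite /st2 /= h4; lia].
  have v13 : val st4 13 = tm.1%:R by rewrite -v22 /st4 /st3 /st2; vals.
  have v9 : val st4 9 = x by rewrite (keeps_val k4).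
  have [v10 v11 v12] : [/\ val st4 10 = lsum (take i s) 0 x,
      val st4 11 = lsum (take i s) 1 x & val st4 12 = lsum (take i s) 2 x].
    by rewrite /st4 /st3 /st2; vals.
  have r45 : nreg st4 4 = (1 + 2 * i)%N /\ nreg st4 5 = (size s - i)%N by [].
  apply: wp_mono (pow_spec (env_half e4) (env_pk e4) (env_K e4) v13 (hlt _ hts)) _.
  move: st4 k4 e4 v22 v23 v13 v9 v10 v11 v12 r45 => st4 k4 e4 v22 v23 v13 v9 v10 v11 v12 [r4 r5].
  move=> t' st5 [ht' kp5 v14]; run.
  have k5 : keeps eval_regs eval_vars st st5.
    by apply: keeps_trans k4 _ _ => //; apply: keeps_sub kp5; apply/allP.
  rewrite v9 in v14.
  split.
  + by lia.
  + by kept.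
  + by rewrite /= (keeps_reg kp5) // r4; lia.
  + by rewrite /= (keeps_reg kp5) // r5; lia.
  + vals; rewrite v14 !(keeps_val kp5) // v22 v23 v10 v11 v12 !lsum_take // -/tm.
    split; ring.
- move=> t st1 [ht kp h4 h5 [s0 s1 s2]]; split; first by rewrite /= h5 subnn.
  by run; rewrite take_size in s0 s1 s2; split=> //; rewrite /eval_cost; lia.
Qed.

(** * The refinement program *)

Lemma cmp_code_ne x y :
  ((cmp_code x y - 1) + (1 - cmp_code x y) != 0)%N = (x != y).
Proof. by rewrite /cmp_code; case: ltgtP. Qed.

Definition table (r : nat) : nexp := NAdd (var 40) (NReg r).

Lemma qeval_table st r : qeval st (table r) = val st (40 + nreg st r).
Proof. by rewrite /qeval /val /= addnA. Qed.

Lemma keeps_table rs vs st st' i : keeps rs vs st st' -> 2 \notin rs ->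
  all (fun v => v < 40)%N vs -> val st' (40 + i) = val st (40 + i).
Proof.
move=> kp r2 /allP hv; rewrite (keeps_val kp) //.
by apply/negP => /hv; rewrite ltnNge leq_addr.
Qed.

(* After a comparison has set register 7 to [c], the truncated difference
   [1 - c] is nonzero iff the outcome is [<], and the sum of [c - 1] and [1 - c]
   is nonzero iff the compared numbers differ. *)
Definition cut_prog : cmd := block
  [:: QCmp 7 (var 6) (var 17);
      If (NSub (NLit 1) (NReg 7)) (block
        [:: QCmp 7 (var 17) (var 7);
            If (NSub (NLit 1) (NReg 7)) (block
              [:: QCopy (var 9) (var 17); eval_prog; QOp QMul (var 16) (var 10) (var 8);
                  QCmp 7 (var 16) (var 0);
                  If (NReg 7)
                    (If (NSub (NReg 7) (NLit 1)) (QCopy (var 6) (var 17))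
                      (block [:: QCopy (var 6) (var 17); QCopy (var 7) (var 17)]))
                    (QCopy (var 7) (var 17))])
              Skip])
        Skip].

Definition cut_vars : seq nat := [:: 6; 7; 9] ++ eval_vars.

Definition newton_prog : cmd := block
  [:: QCopy (var 24) (table 11); QOp QSub (var 18) (var 7) (var 6);
      QOp QSub (var 9) (var 6) (var 18); eval_prog;
      QOp QMul (var 19) (var 11) (var 11); QOp QMul (var 20) (var 10) (var 12);
      QOp QSub (var 19) (var 19) (var 20); QOp QMul (var 20) (var 10) (var 11);
      QOp QAdd (var 19) (var 19) (var 20); QCmp 7 (var 19) (var 0);
      NSet 7 (NAdd (NSub (NReg 7) (NLit 1)) (NSub (NLit 1) (NReg 7)));
      If (NReg 7) (block
        [:: QOp QMul (var 20) (var 20) (var 9); QOp QDiv (var 20) (var 20) (var 19);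
            QOp QSub (var 21) (var 9) (var 20);
            QOp QMul (var 18) (var 18) (var 1); QOp QDiv (var 18) (var 18) (var 24);
            QOp QSub (var 17) (var 21) (var 18); QOp QAdd (var 25) (var 21) (var 18);
            cut_prog; QCopy (var 17) (var 25); cut_prog])
        Skip].

Definition step_vars : seq nat := [:: 17; 18; 19; 20; 21; 24; 25] ++ cut_vars.

Definition bisect_prog : cmd := block
  [:: QOp QAdd (var 17) (var 6) (var 7); QOp QMul (var 17) (var 17) (var 1); cut_prog].

Section Steps.
Variables (R : realType) (p : {poly int}) (s : seq (nat * int)) (xi : R).
Variables (K : nat) (H M : rat) (I0 : rat * rat) (sg : rat).
Hypothesis sp : sparse_repr p s.

(* [sg] has the sign of [p] on the part of [I0] to the left of [xi]. *)
Definition oriented : Prop := forall y, I0.1 < y < I0.2 ->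
  (lsum s 0 y * sg < 0) = (xi < ratr y) /\ (lsum s 0 y * sg == 0) = (ratr y == xi).

Hypothesis hsg : oriented.

Record at_pair (J : rat * rat) (st : state) : Prop := AtPair {
  at_env : env s K H M st;
  at_left : val st 6 = J.1;
  at_right : val st 7 = J.2;
  at_sign : val st 8 = sg;
  at_sub : subint J I0 }.

(** [oriented] speaks only of points strictly inside [I0]; hence the comparisons with both ends
    before the sign is consulted. *)
Lemma cut_spec J st : at_pair J st ->
  wp cut_prog st (fun t st' => [/\ (t <= eval_cost s K + 4)%N,
    keeps eval_regs cut_vars st st' & at_pair (cut xi (val st 17) J) st']).
Proof.
move=> [hst h6 h7 h8 /andP[s1 s2]]; set y := val st 17.
have post st' : keeps eval_regs cut_vars st st' ->
    val st' 6 = (cut xi y J).1 -> val st' 7 = (cut xi y J).2 ->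
    at_pair (cut xi y J) st'.
  move=> kp e6 e7; split=> //; first exact: env_keeps kp isT isT.
    by rewrite (keeps_val kp).
  by apply: subint_trans (cut_subint _ _ _); apply/andP.
rewrite /cut_prog; run; apply: wp_if; vals; rewrite cmp_code_lt -/y h6.
case: ifPn => [ay|nay]; last first.
  run; split; [lia | kept | apply: post; first kept; rewrite /cut (negPf nay); by vals].
run; apply: wp_if; vals; rewrite cmp_code_lt -/y h7.
case: ifPn => [yb|nyb]; last first.
  run; split; [lia | kept | apply: post; first kept; rewrite /cut (negPf nyb) andbF; by vals].
have cutE : cut xi y J = if ratr y < xi then (y, J.2) else if ratr y == xi then (y, y) else (J.1, y).
  by rewrite /cut ay yb.
have [lt0 eq0] := hsg (y := y) (introT andP (conj (le_lt_trans s1 ay) (lt_le_trans yb s2))).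
run; rewrite -/y.
set st1 := set_qmem _ _ _.
have k1 : keeps eval_regs cut_vars st st1 by kept.
have v1 i : val st1 i = if i == 9 then y else val st i by rewrite /st1; vals.
have e1 := env_keeps hst k1 isT isT.
apply: wp_mono (eval_spec e1) _ => t st2 [ht kp2 v10 _ _].
have k2 : keeps eval_regs cut_vars st st2.
  by apply: keeps_trans k1 _ _ => //; apply: keeps_sub kp2; apply/allP.
rewrite v1 /= in v10.
run; apply: wp_if; vals; rewrite cmp_code_neq0.
have z0 : val st2 0 = 0 by rewrite (keeps_val kp2) // v1 /= (env_zero hst).
have z8 : val st2 8 = sg by rewrite (keeps_val kp2) // v1.
have z17 : val st2 17 = y by rewrite (keeps_val kp2) // v1.
have z6 : val st2 6 = J.1 by rewrite (keeps_val kp2) // v1.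
have z7 : val st2 7 = J.2 by rewrite (keeps_val kp2) // v1.
rewrite z0 z8 v10 leNgt lt0.
case: ltgtP cutE eq0 => hy cutE eq0 /=.
- apply: wp_if; vals; rewrite cmp_code_gt.
  rewrite lt_def eq0 leNgt lt0 -leNgt (ltW hy) /=.
  run; split; [lia | kept | apply: post; first kept; by rewrite cutE; vals].
- run; split; [lia | kept | apply: post; first kept; by rewrite cutE; vals].
- apply: wp_if; vals; rewrite cmp_code_gt lt_def eq0 /=.
  run; split; [lia | kept | apply: post; first kept; by rewrite cutE; vals].
Qed.

Lemma newton_spec J st (T : rat) : at_pair J st -> T != 0 ->
  val st (40 + nreg st 11) = T ->
  wp newton_prog st (fun t st' => [/\ (t <= 3 * eval_cost s K + 23)%N,
    keeps eval_regs step_vars st st' & at_pair (newton p xi T J) st']).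
Proof.
move=> hJ T0 hT; have [hst h6 h7 h8 hsub] := hJ.
rewrite /newton_prog; run.
set st1 := set_qmem _ (var 9) _.
have k1 : keeps eval_regs step_vars st st1 by kept.
have e1 := env_keeps hst k1 isT isT.
have w1 : val st1 18 = width J by rewrite /st1; vals; rewrite h6 h7.
have x1 : val st1 9 = J.1 - width J by rewrite /st1; vals; rewrite h6 h7.
have t1 : val st1 24 = T by rewrite /st1; vals; rewrite qeval_table.
have a1 : [/\ val st1 6 = J.1, val st1 7 = J.2 & val st1 8 = sg] by rewrite /st1; vals.
move: st1 k1 e1 w1 x1 t1 a1 => st1 k1 e1 w1 x1 t1 [a6 a7 a8].
apply: wp_mono (eval_spec e1) _ => t st2 [ht kp2].
rewrite x1 !(lsum_wsum _ _ sp) => v10 v11 v12.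
have k2 : keeps eval_regs step_vars st st2.
  by apply: keeps_trans k1 _ _ => //; apply: keeps_sub kp2; apply/allP.
have e2 := env_keeps hst k2 isT isT.
set x := J.1 - width J in x1 v10 v11 v12.
have b (i : nat) : i \notin eval_vars -> val st2 i = val st1 i by move=> hi; rewrite (keeps_val kp2).
run; set st3 := set_nreg _ 7 _.
have k23 : keeps eval_regs step_vars st2 st3 by kept.
have v20 : val st3 20 = wsum p 0 x * wsum p 1 x by rewrite /st3; vals; rewrite v10 v11.
have v19 : val st3 19 = schroder_den p x by rewrite /st3; vals; rewrite v10 v11 v12.
have d7 : (nreg st3 7 != 0)%N = (schroder_den p x != 0).
  by rewrite /st3 /= cmp_code_ne (env_zero e2) v10 v11 v12.
have b3 (i : nat) : i \notin [:: 19; 20] ++ eval_vars -> val st3 i = val st1 i.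
  rewrite mem_cat negb_or => /andP[h hi]; move: h; rewrite !inE negb_or => /andP[/negPf n1 /negPf n2].
  by rewrite /st3; vals; rewrite n1 n2 b.
have k3 := keeps_trans k2 k23 isT; have e3 := env_keeps hst k3 isT isT.
move: st3 k23 k3 e3 v20 v19 d7 b3 => st3 _ k3 e3 v20 v19 d7 b3.
have [c6 c7 c8] : [/\ val st3 6 = J.1, val st3 7 = J.2 & val st3 8 = sg] by rewrite !b3.
have [c9 c18 c24] : [/\ val st3 9 = x, val st3 18 = width J & val st3 24 = T] by rewrite !b3.
have half3 := env_half e3.
apply: wp_if; rewrite [neval _ _]/= d7 /newton -/x.
case: eqVneq => den0 /=.
  by run; split; [lia | exact: k3 | split].
clear st1 k1 e1 w1 x1 t1 a6 a7 a8 st2 kp2 v10 v11 v12 k2 e2 b d7 b3 hst h6 h7 h8.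
run; eapply wp_op_var; [read | read | by rewrite /= v19; exact: den0 | cbn [apply_qop]].
run; eapply wp_op_var; [read | read | by rewrite /= c24 | cbn [apply_qop]].
run; set st4 := set_qmem _ (var 25) _.
have k34 : keeps eval_regs step_vars st3 st4 by kept.
have k4 := keeps_trans k3 k34 isT.
have hc : val st4 17 = schroder p x - width J * 2^-1 / T /\
          val st4 25 = schroder p x + width J * 2^-1 / T.
  by rewrite /st4; vals; rewrite half3 c9 c18 c24 v20 v19.
have hJ4 : at_pair J st4.
  split=> //; first exact: env_keeps e3 k34 isT isT.
  - by rewrite /st4; vals.
  - by rewrite /st4; vals.
  - by rewrite /st4; vals.
move: st4 k34 k4 hc hJ4 => st4 _ k4 [c17 c25] hJ4.
apply: wp_mono (cut_spec hJ4) _ => t' st5 [ht' kp5 hJ5].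
have k5 : keeps eval_regs step_vars st st5.
  by apply: keeps_trans k4 _ _ => //; apply: keeps_sub kp5; apply/allP.
run; rewrite (keeps_val kp5) // c25; rewrite c17 in hJ5.
set st6 := set_qmem _ _ _; set J5 := cut _ _ _ in hJ5 *.
have k56 : keeps eval_regs step_vars st5 st6 by kept.
have v6 i : val st6 i = if i == 17 then schroder p x + width J * 2^-1 / T else val st5 i.
  by rewrite /st6; vals.
have hJ6 : at_pair J5 st6.
  by case: hJ5 => *; split; rewrite ?v6 //; apply: env_keeps k56 isT isT.
apply: wp_mono (cut_spec hJ6) _ => t'' st7 [ht'' kp7 hJ7].
run; split; first by lia.
  apply: keeps_trans k5 _ _ => //; apply: keeps_trans k56 _ _ => //.
  by apply: keeps_sub kp7; apply/allP.
by move: hJ7; rewrite v6.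
Qed.

Lemma bisect_spec J st : at_pair J st ->
  wp bisect_prog st (fun t st' => [/\ (t <= eval_cost s K + 6)%N,
    keeps eval_regs step_vars st st' & at_pair (bisect xi J) st']).
Proof.
move=> [hst h6 h7 h8 hsub]; rewrite /bisect_prog; run.
set st1 := set_qmem _ _ _.
have k1 : keeps eval_regs step_vars st st1 by kept.
have v1 : val st1 17 = (J.1 + J.2) * 2^-1 by rewrite /st1; vals; rewrite h6 h7 (env_half hst).
have hJ1 : at_pair J st1.
  by split=> //; rewrite /st1; [exact: env_keeps k1 isT isT | vals | vals | vals].
apply: wp_mono (cut_spec hJ1) _ => t st2 [ht kp2 hJ2].
run; split; first by lia.
  by apply: keeps_trans k1 _ _ => //; apply: keeps_sub kp2; apply/allP.
by rewrite v1 in hJ2.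
Qed.

End Steps.

Definition ascent_prog : cmd := block
  [:: NSet 11 (NLit 0); NSet 14 (NAdd (NReg 10) (NLit 1));
      While (NReg 14) (block
        [:: newton_prog; NSet 11 (NAdd (NReg 11) (NLit 1));
            NSet 14 (NSub (NReg 14) (NLit 1))])].

Definition descent_prog : cmd := block
  [:: NSet 11 (NAdd (NReg 10) (NLit 1));
      While (NReg 11) (block [:: NSet 11 (NSub (NReg 11) (NLit 1)); newton_prog])].

Definition bisects_prog : cmd := block
  [:: NSet 12 (NAdd (NAdd (NReg 3) (NReg 3)) (NAdd (NReg 3) (NLit 20)));
      While (NReg 12) (block [:: bisect_prog; NSet 12 (NSub (NReg 12) (NLit 1))])].

Definition geo_prog : cmd := block
  [:: NSet 11 (NAdd (NReg 10) (NLit 1));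
      While (NReg 11) (block
        [:: NSet 11 (NSub (NReg 11) (NLit 1)); QCopy (var 24) (table 11);
            QOp QMul (var 17) (var 6) (var 24); cut_prog])].

Definition rounds_prog : cmd := block
  [:: QOp QSub (var 18) (var 7) (var 6); QCmp 7 (var 4) (var 18);
      NSet 13 (NSub (NLit 1) (NReg 7));
      While (NReg 13) (block
        [:: ascent_prog; descent_prog; bisects_prog;
            QOp QSub (var 18) (var 7) (var 6); QCmp 7 (var 4) (var 18);
            NSet 13 (NSub (NLit 1) (NReg 7))])].

Definition loop_regs : seq nat := [:: 11; 12; 13; 14] ++ eval_regs.

Definition round_cost (s : seq (nat * int)) (K n : nat) : nat :=
  2 * (n * (3 * eval_cost s K + 23)) + (3 * K + 20) * (eval_cost s K + 6).

Section Geo.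
Variables (R : realType) (xi : R).
(** Binary search on a logarithmic scale: if [J.2 <= J.1 * tower m.+1], a cut at [J.1 * tower m]
    leaves a ratio of at most [tower m], because [tower m.+1] is the square of [tower m]. *)
Fixpoint geo n J := if n is m.+1 then geo m (cut xi (J.1 * tower m) J) else J.
End Geo.

Section Loops.
Variables (R : realType) (p : {poly int}) (s : seq (nat * int)) (xi : R).
Variables (K : nat) (H M : rat) (I0 : rat * rat) (sg : rat) (n : nat).
Hypothesis sp : sparse_repr p s.
Hypothesis hsg : oriented s xi I0 sg.

(** Register 10 holds the last index of the table, one less than its length [n]. *)
Record ready (J : rat * rat) (st : state) : Prop := Ready {
  ready_at :> at_pair s K H M I0 sg J st;
  ready_size : (nreg st 10).+1 = n;
  ready_table : forall i, (i < n)%N -> val st (40 + i) = tower i }.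

Lemma ready_keeps J J' st st' rs vs : ready J st -> keeps rs vs st st' ->
  2 \notin rs -> 10 \notin rs -> all (fun v => v < 40)%N vs ->
  at_pair s K H M I0 sg J' st' -> ready J' st'.
Proof.
move=> [_ h1 h2] kp r2 r10 hv hJ; split=> //; first by rewrite (keeps_reg kp).
by move=> i /h2 <-; apply: keeps_table kp r2 hv.
Qed.

Lemma at_nset J st r v : r \notin [:: 0; 2; 3] -> at_pair s K H M I0 sg J st ->
  at_pair s K H M I0 sg J (set_nreg st r v).
Proof.
rewrite !inE !negb_or => /and3P[r0 r2 r3] [he h6 h7 h8 hs].
split; rewrite ?val_nset ?(negPf r2) //.
apply: env_keeps he (_ : keeps [:: r] [::] st _) _ isT.
  by apply: keeps_nset (keeps_refl _ _ _); rewrite mem_head.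
by rewrite !inE !(eq_sym _ r) r0 r2 r3.
Qed.

Lemma ready_nset J st r v : r \notin [:: 0; 2; 3; 10] -> ready J st ->
  ready J (set_nreg st r v).
Proof.
rewrite !inE !negb_or => /and4P[r0 r2 r3 r10] [hJ h1 h2]; split.
- by apply: at_nset hJ; rewrite !inE !negb_or r0 r2.
- by rewrite /= eq_sym (negPf r10).
- by move=> i hi; rewrite val_nset (negPf r2) h2.
Qed.

Lemma sub_loop_regs st st' vs : keeps eval_regs vs st st' -> keeps loop_regs vs st st'.
Proof. by apply: keeps_sub; apply/allP. Qed.

Lemma sub_step_vars st st' rs : keeps rs cut_vars st st' -> keeps rs step_vars st st'.
Proof. by apply: keeps_sub; apply/allP. Qed.

Lemma tower_neq0 i : tower i != 0.
Proof. by rewrite gt_eqF //; apply: lt_le_trans (tower_ge2 i). Qed.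

Lemma newton_ready J st : ready J st -> (nreg st 11 < n)%N ->
  wp newton_prog st (fun t st' => [/\ (t <= 3 * eval_cost s K + 23)%N,
    keeps loop_regs step_vars st st', nreg st' 11 = nreg st 11, nreg st' 14 = nreg st 14
    & ready (newton p xi (tower (nreg st 11)) J) st']).
Proof.
move=> hJ lt_n; have hT := ready_table hJ lt_n.
apply: wp_mono (newton_spec sp hsg hJ (tower_neq0 _) hT) _ => t st' [h1 h2 h3].
split=> //; first exact: sub_loop_regs.
- by rewrite (keeps_reg h2).
- by rewrite (keeps_reg h2).
- exact: ready_keeps hJ h2 isT isT isT h3.
Qed.

Lemma ascent_spec J st : ready J st ->
  wp ascent_prog st (fun t st' => [/\ (t <= n * (3 * eval_cost s K + 23))%N,
    keeps loop_regs step_vars st st' & ready (ascent p xi n J) st']).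
Proof.
move=> hJ; rewrite /ascent_prog; run.
pose I (i t : nat) st' := [/\ (t <= i * (3 * eval_cost s K + 23))%N,
  keeps loop_regs step_vars st st', nreg st' 11 = i, nreg st' 14 = (n - i)%N
  & ready (ascent p xi i J) st'].
apply: (@wp_while_iter _ _ _ I n).
- split=> //; first by kept.
    by rewrite /= -(ready_size hJ) addn1 subn0.
  by do 2!apply: ready_nset => //.
- move=> i t st1 hi [ht kp h11 h14 hr].
  split; first by rewrite /= h14 subn_eq0 -ltnNge.
  run; apply: wp_mono (newton_ready hr _) _; first by rewrite h11.
  move=> t' st2 [ht' kp2]; rewrite h11 h14 => e11 e14 hr2; run.
  have k2 := keeps_trans kp kp2 isT.
  split; [lia | by kept | by rewrite /= e11; lia | by rewrite /= e14; lia |].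
  by do 2!apply: ready_nset => //.
- move=> t st1 [ht kp h11 h14 hr]; split; first by rewrite /= h14 subnn.
  by run; split=> //; lia.
Qed.

Lemma descent_spec J st : ready J st ->
  wp descent_prog st (fun t st' => [/\ (t <= n * (3 * eval_cost s K + 23))%N,
    keeps loop_regs step_vars st st' & ready (descent p xi n J) st']).
Proof.
move=> hJ; rewrite /descent_prog; run.
pose I (i t : nat) st' := [/\ (t <= i * (3 * eval_cost s K + 23))%N,
  keeps loop_regs step_vars st st', nreg st' 11 = (n - i)%N
  & exists2 J', ready J' st' & descent p xi (n - i) J' = descent p xi n J].
apply: (@wp_while_iter _ _ _ I n).
- split=> //; first by kept.
    by rewrite /= -(ready_size hJ) addn1 subn0.
  by exists J; rewrite ?subn0 //; apply: ready_nset.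
- move=> i t st1 hi [ht kp h11 [J' hr e]].
  split; first by rewrite /= h11 subn_eq0 -ltnNge.
  have Sni : (n - i = (n - i.+1).+1)%N by lia.
  rewrite Sni /= in e; run.
  set st2 := set_nreg _ _ _.
  have r11 : nreg st2 11 = (n - i.+1)%N by rewrite /= h11; lia.
  have hr2 : ready J' st2 by apply: ready_nset.
  have k2' : keeps loop_regs step_vars st1 st2 by kept.
  apply: wp_mono (newton_ready hr2 _) _; first by rewrite r11; lia.
  move=> t' st3 [ht' kp3]; rewrite r11 => e11 _ hr3; run.
  split; [lia | exact: keeps_trans (keeps_trans kp k2' isT) kp3 isT | by [] |].
  by eexists; first exact: hr3.
- move=> t st1 [ht kp h11 [J' hr]]; rewrite subnn /= => e.
  split; first by rewrite /= h11 subnn.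
  by run; split=> //; [lia | rewrite -e].
Qed.

Lemma bisects_spec J st : ready J st ->
  wp bisects_prog st (fun t st' => [/\ (t <= (3 * K + 20) * (eval_cost s K + 6))%N,
    keeps loop_regs step_vars st st' & ready (iter (3 * K + 20) (bisect xi) J) st']).
Proof.
move=> hJ; rewrite /bisects_prog; run.
set N := (3 * K + 20)%N.
pose I (i t : nat) st' := [/\ (t <= i * (eval_cost s K + 6))%N,
  keeps loop_regs step_vars st st', nreg st' 12 = (N - i)%N
  & ready (iter i (bisect xi) J) st'].
apply: (@wp_while_iter _ _ _ I N).
- split=> //; first by kept.
    by rewrite /= (env_K (at_env hJ)) /N; lia.
  exact: ready_nset.
- move=> i t st1 hi [ht kp h12 hr].
  split; first by rewrite /= h12 subn_eq0 -ltnNge.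
  run; apply: wp_mono (bisect_spec hsg hr) _ => t' st2 [ht' kp2 hr2]; run.
  have k2 := keeps_trans kp (sub_loop_regs kp2) isT.
  split; [lia | by kept | by rewrite /= (keeps_reg kp2) // h12; lia |].
  by apply: ready_nset => //; apply: ready_keeps hr kp2 isT isT isT hr2.
- move=> t st1 [ht kp h12 hr]; split; first by rewrite /= h12 subnn.
  by run; split=> //; lia.
Qed.

Lemma geo_spec J st : ready J st ->
  wp geo_prog st (fun t st' => [/\ (t <= n * (eval_cost s K + 5))%N,
    keeps loop_regs step_vars st st' & ready (geo xi n J) st']).
Proof.
move=> hJ; rewrite /geo_prog; run.
pose I (i t : nat) st' := [/\ (t <= i * (eval_cost s K + 5))%N,
  keeps loop_regs step_vars st st', nreg st' 11 = (n - i)%N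
  & exists2 J', ready J' st' & geo xi (n - i) J' = geo xi n J].
apply: (@wp_while_iter _ _ _ I n).
- split=> //; first by kept.
    by rewrite /= -(ready_size hJ) addn1 subn0.
  by exists J; rewrite ?subn0 //; apply: ready_nset.
- move=> i t st1 hi [ht kp h11 [J' hr e]].
  split; first by rewrite /= h11 subn_eq0 -ltnNge.
  have Sni : (n - i = (n - i.+1).+1)%N by lia.
  rewrite Sni /= in e; run.
  set st2 := set_qmem _ (var 17) _.
  have k12 : keeps loop_regs step_vars st1 st2 by kept.
  have r11 : nreg st2 11 = (n - i.+1)%N by rewrite /= h11; lia.
  have v17 : val st2 17 = J'.1 * tower (n - i.+1).
    rewrite /st2; vals; rewrite qeval_table val_nset /= (at_left hr) -(ready_table hr); last by lia.
    by rewrite h11; congr (_ * val _ (_ + _)); lia.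
  have hJ2 : at_pair s K H M I0 sg J' st2.
    case: (ready_at hr) => e1 h6 h7 h8 hs; split=> //; last 3 first.
    - by rewrite /st2; vals.
    - by rewrite /st2; vals.
    - by rewrite /st2; vals.
    exact: env_keeps e1 k12 isT isT.
  have hr2 : ready J' st2 by apply: ready_keeps hr k12 isT isT isT hJ2.
  apply: wp_mono (cut_spec hsg hr2) _ => t' st3 [ht' kp3 hJ3]; run.
  have kp3' : keeps loop_regs step_vars st2 st3 by apply/sub_loop_regs/sub_step_vars.
  split; [lia | | by rewrite (keeps_reg kp3) // r11 |].
    exact: keeps_trans kp (keeps_trans k12 kp3' isT) isT.
  exists (cut xi (val st2 17) J'); first exact: ready_keeps hr2 kp3' isT isT isT hJ3.
  by rewrite v17.
- move=> t st1 [ht kp h11 [J' hr]]; rewrite subnn /= => e.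
  split; first by rewrite /= h11 subnn.
  by run; split=> //; [lia | rewrite -e].
Qed.

Lemma rounds_spec J st (r : nat) : ready J st ->
  let it i := iter i (round p xi n (3 * K + 20)) J in
  (forall i, (i < r)%N -> H < width (it i)) -> width (it r) <= H ->
  wp rounds_prog st (fun t st' => [/\ (t <= r * (round_cost s K n + 2) + 2)%N,
    keeps loop_regs step_vars st st' & ready (it r) st']).
Proof.
move=> hJ it hlt hle; rewrite /rounds_prog; run.
pose I (i t : nat) st' := [/\ (t <= i * (round_cost s K n + 2))%N,
  keeps loop_regs step_vars st st', nreg st' 13 = (1 - cmp_code H (width (it i)))%N
  & ready (it i) st'].
have hv (J' : rat * rat) st1 q : ready J' st1 -> ready J' (set_qmem st1 (var 18) q).
  move=> hr; have k : keeps loop_regs step_vars st1 (set_qmem st1 (var 18) q) by kept.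
  apply: (ready_keeps hr k isT isT isT _).
  case: (ready_at hr) => e1 h6 h7 h8 hs; split=> //; rewrite ?val_qset //=.
  exact: env_keeps e1 k isT isT.
apply: (@wp_while_iter _ _ _ (fun i t st' => I i t st') r).
- split=> //; first by kept.
    by rewrite /= (env_H (at_env hJ)) (at_left hJ) (at_right hJ).
  by do 2!apply: ready_nset => //; apply: hv.
- move=> i t st1 hi [ht kp h13 hr].
  split; first by rewrite /= h13 cmp_code_lt hlt.
  run; apply: wp_mono (ascent_spec hr) _ => t2 st2 [ht2 kp2 hr2].
  run; apply: wp_mono (descent_spec hr2) _ => t3 st3 [ht3 kp3 hr3].
  run; apply: wp_mono (bisects_spec hr3) _ => t4 st4 [ht4 kp4 hr4].
  have k4 := keeps_trans (keeps_trans (keeps_trans kp kp2 isT) kp3 isT) kp4 isT.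
  run; split; first by rewrite mulSn {1}/round_cost; lia.
  + by kept.
  + by rewrite /= (env_H (at_env hr4)) (at_left hr4) (at_right hr4).
  + by do 2!apply: ready_nset => //; apply: hv.
- move=> t st1 [ht kp h13 hr]; split.
    by apply/eqP; rewrite /= h13 -[_ == _]negbK cmp_code_lt -leNgt.
  by run; split=> //; lia.
Qed.

End Loops.

#[local] Arguments table : simpl never.

(** [keeps] lists finitely many cells in advance, whereas the length of the table depends on the
    input. Here only the cells below the base and the constants in cells 0 to 5 are protected. *)
Definition frame (rs : seq nat) (st st' : state) : Prop :=
  [/\ forall r, r \notin rs -> nreg st' r = nreg st r,
      forall a, (a < nreg st 2)%N -> qmem st' a = qmem st a
    & forall v, (v < 6)%N -> val st' v = val st v].

Lemma frame_keeps rs vs st st' : keeps rs vs st st' -> 2 \notin rs ->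
  all (fun v => 6 <= v)%N vs -> frame rs st st'.
Proof.
move=> kp r2 /allP hv; split=> [r|a|v v6]; first exact: (keeps_reg kp).
  exact: (keeps_low kp).
by rewrite (keeps_val kp) //; apply/negP => /hv h; move: v6; rewrite ltnNge h.
Qed.

Lemma frame_sub rs rs' st st' : {subset rs <= rs'} -> frame rs st st' -> frame rs' st st'.
Proof.
by move=> hr [h1 h2 h3]; split=> // r hr'; apply: h1; apply: contra hr' => /hr.
Qed.

Lemma frame_trans rs st1 st2 st3 : frame rs st1 st2 -> frame rs st2 st3 ->
  2 \notin rs -> frame rs st1 st3.
Proof.
move=> [h1 h2 h3] [h4 h5 h6] r2; split=> [r hr|a ha|v hv].
- by rewrite h4 // h1.
- by rewrite h5 ?h2 // h1.
- by rewrite h6 // h3.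
Qed.

Lemma env_frame s K H M rs st st' : env s K H M st -> frame rs st st' ->
  [&& 0 \notin rs, 2 \notin rs & 3 \notin rs]%N -> env s K H M st'.
Proof.
case=> h0 hb hK he hc z0 z1 z2 z3 z4 z5 hlt [f1 f2 f3] /and3P[r0 r2 r3].
split; rewrite ?f1 ?f3 //.
- by move=> i hi; rewrite f2 ?he //; lia.
- by move=> i hi; rewrite f2 ?hc //; lia.
Qed.

(** * Preparation of an interval: the table of powers and the reference sign *)

Definition table_step : cmd := block
  [:: QCopy (table 10) (var 24); QOp QMul (var 16) (var 24) (var 4);
      QCmp 7 (var 16) (var 7); NSet 13 (NSub (NLit 1) (NReg 7))].

Definition table_prog : cmd := block
  [:: NSet 10 (NLit 0); QLit (var 24) 2; table_step;
      While (NReg 13) (block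
        [:: QOp QMul (var 24) (var 24) (var 24); NSet 10 (NAdd (NReg 10) (NLit 1));
            table_step])].

Definition orient_prog : cmd := block
  [:: QCopy (var 9) (var 6); eval_prog; QCopy (var 8) (var 10); QCmp 7 (var 8) (var 0);
      NSet 7 (NAdd (NSub (NReg 7) (NLit 1)) (NSub (NLit 1) (NReg 7)));
      If (NReg 7) Skip (block
        [:: QOp QAdd (var 17) (var 6) (var 2); QOp QAdd (var 17) (var 17) (var 2);
            QOp QMul (var 17) (var 17) (var 5); NSet 12 (NReg 3);
            While (NReg 12) (block
              [:: QOp QMul (var 17) (var 17) (var 17); NSet 12 (NSub (NReg 12) (NLit 1))]);
            QOp QDiv (var 17) (var 2) (var 17); QOp QAdd (var 9) (var 6) (var 17);
            eval_prog; QCopy (var 8) (var 10)])].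

Definition orient_vars : seq nat := [:: 8; 9; 17] ++ eval_vars.

Lemma val_tset st r q v :
  val (set_qmem st (table r) q) v = if v == (40 + nreg st r)%N then q else val st v.
Proof. by rewrite /val /= -addnA eqn_add2l. Qed.

Section Interval.
Variables (R : realType) (p : {poly int}) (s : seq (nat * int)) (xi : R).
Variables (K : nat) (H M : rat).
Hypothesis sp : sparse_repr p s.

Lemma at_frame rs J I0 sg st st' : at_pair s K H M I0 sg J st -> frame rs st st' ->
  [&& 0 \notin rs, 2 \notin rs & 3 \notin rs]%N ->
  [/\ val st' 6 = val st 6, val st' 7 = val st 7 & val st' 8 = val st 8] ->
  at_pair s K H M I0 sg J st'.
Proof.
move=> [he h6 h7 h8 hs] fr hr [e6 e7 e8]; split; rewrite ?e6 ?e7 ?e8 //.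
exact: env_frame fr hr.
Qed.

(** The length is found from the data: the table is complete once [tower n * H] reaches the right
    end. This bounds the ratio of the ends as soon as the left one is at least [H]. *)
Lemma table_spec J I0 sg st n : at_pair s K H M I0 sg J st ->
  (forall i, (i < n)%N -> tower i * H < J.2) -> J.2 <= tower n * H ->
  wp table_prog st (fun t st' => [/\ (t <= 3 * n + 2)%N,
    frame [:: 7; 10; 13] st st' & ready s K H M I0 sg n.+1 J st']).
Proof.
move=> hJ hlt hle; rewrite /table_prog; run.
pose I (i t : nat) st' := [/\ (t <= 3 * i)%N, frame [:: 7; 10; 13] st st',
  [/\ nreg st' 10 = i, nreg st' 13 = (1 - cmp_code (tower i * H) J.2)%N & val st' 24 = tower i],
  [/\ val st' 6 = val st 6, val st' 7 = val st 7 & val st' 8 = val st 8]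
  & forall i', (i' <= i)%N -> val st' (40 + i') = tower i'].
have T0 : tower 0 = 2 by [].
have step st1 (q : rat) i : frame [:: 7; 10; 13] st st1 -> val st1 24 = q -> q = tower i ->
    [/\ val st1 6 = val st 6, val st1 7 = val st 7 & val st1 8 = val st 8] ->
    (forall i', (i' < i)%N -> val st1 (40 + i') = tower i') -> nreg st1 10 = i ->
    wp table_step st1
      (fun t st' => t = 2 /\ forall t', (t' <= 3 * i)%N -> I i t' st').
  move=> fr hq qE [e6 e7 e8] htab h10.
  have [f1 f2 f3] := fr; have r2 : nreg st1 2 = nreg st 2 by apply: f1.
  rewrite /table_step; cbn [block foldr]; apply: wp_seq; apply: wp_copy; rewrite qevalE hq.
  set st2 := set_qmem _ _ _.
  have v2 v : val st2 v = if v == (40 + i)%N then q else val st1 v by rewrite val_tset h10.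
  have v2' v : (v < 40)%N -> val st2 v = val st1 v.
    by move=> hv; rewrite v2 ltn_eqF // (leq_trans hv) // leq_addr.
  have n2 r : nreg st2 r = nreg st1 r by [].
  have q2 a : (a < nreg st 2)%N -> qmem st2 a = qmem st a.
    move=> ha; rewrite /st2 /=; case: eqP => [e|_]; last exact: f2.
    by rewrite e r2 /= in ha; lia.
  move: st2 v2 v2' n2 q2 => st2 v2 v2' n2 q2; run; split=> //.
  rewrite !v2' // e7 hq (at_right hJ) f3 // (env_H (at_env hJ)).
  set st3 := set_nreg _ 13 _.
  have kp : keeps [:: 7; 13] [:: 16] st2 st3 by kept.
  have v3 v : v != 16 -> val st3 v = val st2 v by move=> hv; rewrite (keeps_val kp) // inE.
  move=> t' ht'; split=> //.
  - split=> [r|a ha|v hv].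
    + rewrite !inE !negb_or => /and3P[n7 n10 n13].
      rewrite (keeps_reg kp) ?inE ?negb_or ?n7 // n2 f1 //.
      by rewrite !inE !negb_or n7 n10.
    + by rewrite (keeps_low kp) ?n2 ?r2 // q2.
    + by rewrite v3 ?v2' ?f3 //; lia.
  - by rewrite /= n2 h10 -qE v3 // v2'.
  - by rewrite !v3 // !v2'.
  - move=> i' hi; rewrite v3; last by rewrite neq_ltn ltn_addr ?orbT.
    rewrite v2 eqn_add2l; case: eqVneq => [->|ne]; first by rewrite qE.
    by apply: htab; rewrite ltn_neqAle ne.
run; set st1 := set_qmem _ _ _.
have k1 : keeps [:: 7; 10; 13] [:: 24] st st1 by kept.
apply: wp_mono (step st1 2 0%N _ _ _ _ _ _) _ => //.
- exact: frame_keeps k1 isT isT.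
- by rewrite /st1; vals.
- by rewrite !(keeps_val k1).
move=> t1 st2 [-> hI]; run.
apply: (@wp_while_iter _ _ _ I n).
- exact: hI.
- move=> i t st3 hi [ht fr [h10 h13 h24] e678 htab].
  split; first by rewrite /= h13 cmp_code_lt hlt.
  run; rewrite h10 h24; set st4 := set_nreg _ _ _.
  have k4 : keeps [:: 7; 10; 13] [:: 24] st3 st4 by kept.
  have [e6 e7 e8] := e678.
  apply: wp_mono (step st4 (tower i * tower i) i.+1 _ _ _ _ _ _) _.
  + by apply: frame_trans fr _ _ => //; apply: frame_keeps k4 isT isT.
  + by rewrite /st4; vals.
  + by rewrite towerS.
  + by rewrite !(keeps_val k4).
  + by move=> i' hi'; rewrite (keeps_table _ k4) // htab.
  + by rewrite /= addn1.
  by move=> t' st5 [-> hI']; run; apply: hI'; lia.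
- move=> t st3 [ht fr [h10 h13 h24] e678 htab]; split.
    by apply/eqP; rewrite /= h13 -[_ == _]negbK cmp_code_lt -leNgt.
  run; split; [by rewrite addn0; lia | exact: fr |].
  split; [exact: at_frame hJ fr isT e678 | by rewrite h10 | exact: htab].
Qed.

(* For [M] the sum of 1 and the absolute values of the coefficients, and [2 ^ K]
   at least the size of [p], a root [a >= 0] is followed by no other root up to
   [a + (M * (a + 2)) ^- (2 ^ K)]. *)
Definition orient_value (a : rat) : rat :=
  if lsum s 0 a == 0 then lsum s 0 (a + (M * (a + 2)) ^- (2 ^ K)) else lsum s 0 a.

(** The shift takes [K] squarings and one division, although the separation bound has an exponent as
    large as the degree. *)
Lemma orient_spec a st : env s K H M st -> val st 6 = a -> M * (a + 2) != 0 ->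
  wp orient_prog st (fun t st' => [/\ (t <= 2 * eval_cost s K + K + 6)%N,
    keeps (12 :: eval_regs) orient_vars st st' & val st' 8 = orient_value a]).
Proof.
move=> hst h6 Y0; rewrite /orient_prog; run; rewrite h6.
set st1 := set_qmem _ _ _.
have k1 : keeps (12 :: eval_regs) orient_vars st st1 by kept.
have e1 := env_keeps hst k1 isT isT.
apply: wp_mono (eval_spec e1) _ => t st2 [ht kp2 v10 _ _].
have k2 : keeps (12 :: eval_regs) orient_vars st st2.
  by apply: keeps_trans k1 _ _ => //; apply: keeps_sub kp2; apply/allP.
have e2 := env_keeps hst k2 isT isT.
have v9 : val st1 9 = a by rewrite /st1; vals.
rewrite v9 in v10.
have b6 : val st2 6 = a by rewrite (keeps_val k2).
move: st1 k1 e1 kp2 v9 => _ _ _ _ _.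
run; apply: wp_if; rewrite [neval _ _]/= cmp_code_ne v10 (env_zero e2) /orient_value.
case: eqVneq => l0 /=.
  run; rewrite b6 (env_one e2) (env_M e2).
  set st3 := set_nreg _ _ _.
  have k3 : keeps (12 :: eval_regs) orient_vars st st3 by kept.
  have e3 := env_keeps hst k3 isT isT.
  have r12 : nreg st3 12 = K by rewrite /= (env_K e2).
  have v17 : val st3 17 = M * (a + 2) by rewrite /st3; vals; ring.
  have v6 : val st3 6 = a by rewrite (keeps_val k3).
  move: st3 k3 e3 r12 v17 v6 => st3 k3 e3 r12 v17 v6.
  pose I (i t : nat) st' := [/\ (t <= i)%N, keeps (12 :: eval_regs) orient_vars st3 st',
    nreg st' 12 = (K - i)%N & val st' 17 = (M * (a + 2)) ^+ (2 ^ i)].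
  apply: (@wp_while_iter _ _ _ I K).
  - by split=> //; rewrite r12 subn0.
  - move=> i t' st4 hi [ht' kp h12 h17].
    split; first by rewrite /= h12 subn_eq0 -ltnNge.
    run; split; [lia | by kept | by rewrite /= h12; lia |].
    by vals; rewrite h17 -exprD addnn -mul2n -expnS.
  move=> t' st4 [ht' kp h12 h17]; split; first by rewrite /= h12 subnn.
  have e4 := env_keeps e3 kp isT isT.
  have w6 : val st4 6 = a by rewrite (keeps_val kp).
  run; eapply wp_op_var; [read | read | by rewrite /= h17 expf_neq0 | cbn [apply_qop]].
  run; rewrite (env_one e4) h17 w6 div1r.
  set st5 := set_qmem _ (var 9) _.
  have k45 : keeps (12 :: eval_regs) orient_vars st4 st5 by kept.
  have k5 := keeps_trans (keeps_trans k3 kp isT) k45 isT.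
  have e5 := env_keeps hst k5 isT isT.
  have w9 : val st5 9 = a + (M * (a + 2)) ^- (2 ^ K) by rewrite /st5 val_qset.
  apply: wp_mono (eval_spec e5) _ => t5 st6 [ht6 kp6 z10 _ _].
  have k6 : keeps (12 :: eval_regs) orient_vars st st6.
    by apply: keeps_trans k5 _ _ => //; apply: keeps_sub kp6; apply/allP.
  by run; rewrite z10 w9; split; [lia | kept | rewrite val_qset].
by run; split; [lia | kept | vals].
Qed.

End Interval.

(** * The treatment of one interval *)

Definition interval_prog : cmd := block
  [:: QCopy (var 6) (NReg 8); QCopy (var 7) (NAdd (NReg 8) (NLit 1)); orient_prog;
      QCopy (var 17) (var 4); cut_prog; table_prog; geo_prog; bisects_prog; rounds_prog;
      QCopy (NReg 8) (var 6); QCopy (NAdd (NReg 8) (NLit 1)) (var 7);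
      NSet 8 (NAdd (NReg 8) (NLit 2))].

Definition int_regs : seq nat := [:: 4; 5; 6; 7; 10; 11; 12; 13; 14].

Definition interval_cost (s : seq (nat * int)) (K n r : nat) : nat :=
  (2 * eval_cost s K + K + 6) + (eval_cost s K + 4) + (3 * n + 2) +
  n.+1 * (eval_cost s K + 5) + (3 * K + 20) * (eval_cost s K + 6) +
  (r * (round_cost s K n.+1 + 2) + 2).

Section IntervalSpec.
Variables (R : realType) (p : {poly int}) (s : seq (nat * int)) (xi : R).
Variables (K : nat) (H M : rat) (a b : rat) (n r : nat).
Hypothesis sp : sparse_repr p s.

(** The geometric search needs a positive left end, but [a] may be 0. The cut at [H] helps: a pair
    that is still wider than [H] after it begins at or above [H]. *)
Definition start_pair : rat * rat :=
  iter (3 * K + 20) (bisect xi) (geo xi n.+1 (cut xi H (a, b))).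

Definition final_pair : rat * rat :=
  iter r (round p xi n.+1 (3 * K + 20)) start_pair.

Hypothesis hor : oriented s xi (a, b) (orient_value s K M a).
Hypothesis Y0 : M * (a + 2) != 0.
Hypothesis n_lt : forall i, (i < n)%N -> tower i * H < (cut xi H (a, b)).2.
Hypothesis n_le : (cut xi H (a, b)).2 <= tower n * H.
Hypothesis r_lt : forall i, (i < r)%N ->
  H < width (iter i (round p xi n.+1 (3 * K + 20)) start_pair).
Hypothesis r_le : width final_pair <= H.

Lemma interval_spec A st : env s K H M st -> nreg st 8 = A ->
  (2 * size s < A)%N -> (A.+1 < nreg st 2)%N -> qmem st A = a -> qmem st A.+1 = b ->
  wp interval_prog st (fun t st' => [/\ (t <= interval_cost s K n r)%N,
    env s K H M st', nreg st' 8 = A.+2, nreg st' 2 = nreg st 2 /\ nreg st' 9 = nreg st 9 &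
    [/\ qmem st' A = final_pair.1, qmem st' A.+1 = final_pair.2
      & forall c, (c < nreg st 2)%N -> c != A -> c != A.+1 -> qmem st' c = qmem st c]]).
Proof.
move=> hst h8 sA hA qa qb; rewrite /interval_prog; run.
have -> : qeval st (NReg 8) = a by rewrite /qeval /= h8.
set st0 := set_qmem st _ _.
have k0 : keeps int_regs [:: 6; 7] st st0 by kept.
have -> : qeval st0 (NAdd (NReg 8) (NLit 1)) = b.
  by rewrite -qb; apply: (qeval_low k0) => //=; rewrite h8 addn1.
set st1 := set_qmem st0 _ _.
have k1 : keeps int_regs [:: 6; 7] st st1 by kept.
have e1 := env_keeps hst k1 isT isT.
have [v6 v7] : val st1 6 = a /\ val st1 7 = b by rewrite /st1 /st0; vals.
have f1 : frame int_regs st st1 by apply: frame_keeps k1 isT isT.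
move: st0 st1 k0 k1 e1 v6 v7 f1 => _ st1 _ _ e1 v6 v7 f1.
apply: wp_mono (orient_spec e1 v6 Y0) _ => t2 st2 [ht2 k2 h2].
have fk rs vs st' st'' : keeps rs vs st' st'' -> {subset rs <= int_regs} ->
    all (fun v => 6 <= v)%N vs -> frame int_regs st' st''.
  move=> kp hr hv; apply: (frame_keeps (vs := vs)) => //.
  exact: keeps_sub kp.
have f2 : frame int_regs st st2.
  by apply: frame_trans f1 _ _ => //; apply: fk k2 _ isT; apply/allP.
run; set st3 := set_qmem _ _ _.
have k3 : keeps (12 :: eval_regs) (17 :: orient_vars) st2 st3 by kept.
have f3 : frame int_regs st st3.
  by apply: frame_trans f2 _ _ => //; apply: fk k3 _ isT; apply/allP.
have v17 : val st3 17 = H.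
  rewrite /st3; vals; have [_ _ h] := f2; rewrite h //; exact: env_H hst.
have hJ3 : at_pair s K H M (a, b) (orient_value s K M a) (a, b) st3.
  split; rewrite /st3 ?val_qset /=.
  - exact: env_frame hst f3 isT.
  - by rewrite (keeps_val k2).
  - by rewrite (keeps_val k2).
  - exact: h2.
  - exact: subint_refl.
move: st3 k3 f3 v17 hJ3 => st3 _ f3 v17 hJ3.
apply: wp_mono (cut_spec hor hJ3) _ => t4 st4 [ht4 k4]; rewrite v17 => hJ4.
have f4 : frame int_regs st st4.
  by apply: frame_trans f3 _ _ => //; apply: fk k4 _ isT; apply/allP.
run; apply: wp_mono (table_spec hJ4 n_lt n_le) _ => t5 st5 [ht5 f45 hr5].
have f5 : frame int_regs st st5.
  by apply: frame_trans f4 _ _ => //; apply: frame_sub f45; apply/allP.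
run; apply: wp_mono (geo_spec hor hr5) _ => t6 st6 [ht6 k6 hr6].
have f6 : frame int_regs st st6.
  by apply: frame_trans f5 _ _ => //; apply: fk k6 _ isT; apply/allP.
run; apply: wp_mono (bisects_spec hor hr6) _ => t7 st7 [ht7 k7 hr7].
have f7 : frame int_regs st st7.
  by apply: frame_trans f6 _ _ => //; apply: fk k7 _ isT; apply/allP.
run; apply: wp_mono (rounds_spec sp hor hr7 r_lt r_le) _ => t8 st8 [ht8 k8 hr8].
have f8 : frame int_regs st st8.
  by apply: frame_trans f7 _ _ => //; apply: fk k8 _ isT; apply/allP.
have [g1 g2 g3] := f8.
have e8 := env_frame hst f8 isT.
have r8 : nreg st8 8 = A by rewrite g1.
have r2 : nreg st8 2 = nreg st 2 by rewrite g1.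
have w6 : val st8 6 = final_pair.1 by case: hr8 => -[].
have w7 : val st8 7 = final_pair.2 by case: hr8 => -[].
run; rewrite qevalE w6.
set st9 := set_qmem st8 _ _.
have -> : qeval st9 (var 7) = final_pair.2.
  rewrite -w7 /st9 /qeval /val /=; case: eqP => // e.
  by rewrite r8 r2 in e; lia.
set st10 := set_nreg _ _ _.
have q10 c : qmem st10 c =
    if c == A.+1 then final_pair.2 else if c == A then final_pair.1 else qmem st8 c.
  by rewrite /st10 /= r8 addn1.
have n10 i : nreg st10 i = if i == 8 then A.+2 else nreg st8 i.
  by rewrite /st10 /= r8 addn2.
have low c : (2 * size s < nreg st 2)%N -> (c <= 2 * size s)%N -> qmem st10 c = qmem st8 c.
  by move=> _ hc; rewrite q10 !ltn_eqF //; lia.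
have high v : val st10 v = val st8 v.
  by rewrite /val q10 n10 /= r2 !gtn_eqF //; lia.
clearbody st10; have [h0 hb hK he hc z0 z1 z2 z3 z4 z5 hlt] := e8.
split.
- by rewrite /interval_cost; lia.
- split; rewrite ?high ?n10 //=.
  + by move=> i hi; rewrite low ?he //; lia.
  + by move=> i hi; rewrite low ?hc //; lia.
- by rewrite n10.
- by rewrite !n10 /= !g1.
split; rewrite ?q10 ?eqxx //.
  by rewrite ltn_eqF.
by move=> c hc1 /negPf n1 /negPf n2; rewrite q10 n1 n2 g2.
Qed.

End IntervalSpec.

(** * Constants derived from the input, and the loop over the intervals *)

Fixpoint up (e : nat) : nat := if e is 0 then 0%N else (trunc_log 2 e).+1.

Lemma ltn_up e : (e < 2 ^ up e)%N.
Proof. by case: e => // e; apply: trunc_log_ltn. Qed.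

Lemma leq_up j e : (j < up e)%N -> (2 ^ j <= e)%N.
Proof.
by case: e => // e hj; apply: leq_trans (trunc_logP (isT : 1 < 2)%N (isT : 0 < e.+1)%N); rewrite leq_exp2l.
Qed.

Definition setup_prog : cmd := block
  [:: NSet 2 (NAdd (NLit 1) (NAdd (NAdd (NReg 0) (NReg 0)) (NAdd (NReg 1) (NReg 1))));
      QLit (var 0) 0; QLit (var 1) (2^-1); QLit (var 2) 1; QLit (var 3) 1; QLit (var 5) 1;
      NSet 3 (NLit 0); NSet 4 (NLit 1); NSet 5 (NReg 0);
      While (NReg 5) (block
        [:: QCopy (var 22) (NReg 4); QCopy (var 23) (NAdd (NReg 4) (NLit 1));
            QCmp 7 (var 22) (var 3);
            While (NReg 7) (block
              [:: QOp QAdd (var 3) (var 3) (var 3); NSet 3 (NAdd (NReg 3) (NLit 1));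
                  QCmp 7 (var 22) (var 3)]);
            QCmp 7 (var 0) (var 23);
            If (NReg 7) (QOp QSub (var 5) (var 5) (var 23)) (QOp QAdd (var 5) (var 5) (var 23));
            NSet 4 (NAdd (NReg 4) (NLit 2)); NSet 5 (NSub (NReg 5) (NLit 1))]);
      QLit (var 13) 1; QCopy (var 4) (var 1); QCopy (var 22) (NLit 0);
      QCmp 7 (var 13) (var 22); NSet 7 (NSub (NLit 2) (NReg 7));
      While (NReg 7) (block
        [:: QOp QAdd (var 13) (var 13) (var 13); QOp QMul (var 4) (var 4) (var 4);
            QCmp 7 (var 13) (var 22); NSet 7 (NSub (NLit 2) (NReg 7))])].

Section Setup.
Variables (s : seq (nat * int)) (m L : nat).

Definition bits : nat := \max_(t <- s) up t.1.
Definition coef_bound : rat := 1 + \sum_(t <- s) `|t.2%:~R|.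
(** Reached by [up L] squarings of [1 / 2]. For positive [L] one has [L < 2 ^ up L <= 2 L], so this
    is below [2 ^- L] without affecting the order of the cost. *)
Definition target_width : rat := 2 ^- (2 ^ up L).

Lemma setup_spec st : nreg st 0 = size s -> nreg st 1 = m -> qmem st 0 = L%:R ->
  (forall i, (i < size s)%N -> qmem st (1 + 2 * i)%N = (nth (0%N, 0) s i).1%:R) ->
  (forall i, (i < size s)%N -> qmem st (2 + 2 * i)%N = (nth (0%N, 0) s i).2%:~R) ->
  wp setup_prog st (fun t st' => [/\ (t <= 3 * size s + 2 * bits + 3 * up L + 1)%N,
    env s bits target_width coef_bound st', nreg st' 1 = m,
    nreg st' 2 = (1 + 2 * size s + 2 * m)%N
    & forall a, (a < 1 + 2 * size s + 2 * m)%N -> qmem st' a = qmem st a]).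
Proof.
move=> h0 h1 hL he hc; rewrite /setup_prog; run; rewrite h0 h1.
set base := (1 + _)%N; have baseE : base = (1 + 2 * size s + 2 * m)%N by rewrite /base; lia.
set stb := set_nreg st 2 base.
set st1 := set_nreg _ 5 _.
pose vs : seq nat := [:: 0; 1; 2; 3; 4; 5; 13; 22; 23].
pose rs : seq nat := [:: 3; 4; 5; 7].
have k1 : keeps rs vs stb st1 by kept.
have [c0 c1 c2 c3 c5] : [/\ val st1 0 = 0, val st1 1 = 2^-1, val st1 2 = 1, val st1 3 = 1 & val st1 5 = 1].
  by rewrite /st1; vals.
have [n3 n4 n5] : [/\ nreg st1 3 = 0, nreg st1 4 = 1 & nreg st1 5 = size s]%N by [].
have b2 : nreg stb 2 = base by [].
have lowb a : qmem stb a = qmem st a by [].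
have regb r : r != 2 -> nreg stb r = nreg st r by rewrite /stb /= => /negPf ->.
clearbody stb st1.
(* The power of two in cell 3 is never reset, so the doublings made for all terms together number
   only [bits]. *)
pose bt i := \max_(t <- take i s) up t.1.
pose I (i t : nat) st' := [/\ (t <= 3 * i + 2 * bt i)%N, keeps rs [:: 3; 5; 13; 22; 23] st1 st',
  [/\ nreg st' 4 = (1 + 2 * i)%N, nreg st' 5 = (size s - i)%N & nreg st' 3 = bt i],
  val st' 3 = 2 ^+ bt i & val st' 5 = 1 + \sum_(t <- take i s) `|t.2%:~R|].
have r12 : nreg st1 2 = base by rewrite (keeps_reg k1).
have low1 a : (a < base)%N -> qmem st1 a = qmem st a by move=> ha; rewrite (keeps_low k1) ?b2.
apply: (@wp_while_iter _ _ _ I (size s)).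
- split=> //.
  + by split; rewrite ?n4 ?n5 ?n3 ?subn0 // /bt take0 big_nil.
  + by rewrite c3 /bt take0 big_nil.
  + by rewrite c5 take0 big_nil addr0.
- move=> i t st2 hi [ht kp [h4 h5 h3] v3 v5].
  split; first by rewrite /= h5 subn_eq0 -ltnNge.
  set tm := nth (0%N, 0) s i.
  have takeS : take i.+1 s = rcons (take i s) tm by rewrite -take_nth.
  run; have -> : qeval st2 (NReg 4) = tm.1%:R.
    by rewrite (qeval_low kp (a := 1 + 2 * i)) ?low1 ?he ?r12 ?baseE //=; lia.
  set st3 := set_qmem st2 _ _.
  have k3 : keeps rs [:: 3; 5; 13; 22; 23] st1 st3 by kept.
  have -> : qeval st3 (NAdd (NReg 4) (NLit 1)) = tm.2%:~R.
    by rewrite (qeval_low k3 (a := 2 + 2 * i)) ?low1 ?hc ?r12 ?baseE //=; rewrite ?h4; lia.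
  rewrite v3; set st4 := set_nreg _ 7 _.
  have k4 : keeps rs [:: 3; 5; 13; 22; 23] st1 st4 by kept.
  have [x3 x5 x22 x23] : [/\ val st4 3 = 2 ^+ bt i, val st4 5 = val st2 5, val st4 22 = tm.1%:R & val st4 23 = tm.2%:~R].
    by rewrite /st4 /st3; vals.
  have [y3 y4 y5 y7] : [/\ nreg st4 3 = bt i, nreg st4 4 = (1 + 2 * i)%N, nreg st4 5 = (size s - i)%N
     & nreg st4 7 = cmp_code tm.1%:R (2 ^+ bt i)] by rewrite /st4 /=.
  clearbody st4; clear st3 k3.
  pose d := (maxn (bt i) (up tm.1) - bt i)%N.
  pose J (j t : nat) st' := [/\ (t <= 2 * j)%N, keeps [:: 3; 7] [:: 3] st4 st',
    nreg st' 3 = (bt i + j)%N, val st' 3 = 2 ^+ (bt i + j)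
    & nreg st' 7 = cmp_code tm.1%:R (2 ^+ (bt i + j))].
  apply: (@wp_while_iter _ _ _ J d).
  + by split; rewrite ?addn0.
  + move=> j t' st5 hj [ht' kp5 z3 w3 z7]; split.
      rewrite /= z7 cmp_code_neq0 -natrX ler_nat; apply: leq_up.
      by move: hj; rewrite /d; lia.
    run; split; [lia | by kept | by rewrite /= z3; lia | |].
    * by vals; rewrite w3 addnS exprS; ring.
    * rewrite /= (keeps_val kp5) // x22 w3; congr cmp_code.
      by rewrite addnS exprS; ring.
  move=> t' st5 [ht' kp5 z3 w3 z7]; split.
    rewrite /= z7; apply/eqP; rewrite -[_ == _]negbK cmp_code_neq0 -ltNge -natrX ltr_nat.
    apply: leq_trans (ltn_up _) _; rewrite leq_exp2l // /d; lia.
  have dE : (bt i + d = bt i.+1)%N.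
    by rewrite /bt takeS big_rcons /= -/(bt i) /d maxnC; lia.
  rewrite dE in z3 w3.
  have k5 : keeps rs [:: 3; 5; 13; 22; 23] st1 st5.
    by apply: keeps_trans k4 _ _ => //; apply: keeps_sub kp5; apply/allP.
  run; apply: wp_if; rewrite [neval _ _]/= cmp_code_neq0 (keeps_val (v := 0%N) k5 isT isT) c0
    (keeps_val (v := 23%N) kp5 isT isT) x23.
  have sumS : 1 + \sum_(t0 <- take i.+1 s) `|t0.2%:~R| =
      val st4 5 + `|tm.2%:~R| :> rat.
    by rewrite takeS big_rcons /= x5 v5; ring.
  have cost : (3 * i + 2 * bt i + (2 * d + 3) <= 3 * i.+1 + 2 * bt i.+1)%N by lia.
  case: ifPn => sgn; run.
  + split; [lia | by kept | split; rewrite /= ?z3 ?(keeps_reg kp5) ?y4 ?y5 //; lia | by vals |].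
    by rewrite sumS; vals; rewrite !(keeps_val kp5) // x23 ler0_norm.
  + split; [lia | by kept | split; rewrite /= ?z3 ?(keeps_reg kp5) ?y4 ?y5 //; lia | by vals |].
    by rewrite sumS; vals; rewrite !(keeps_val kp5) // x23 gtr0_norm // ltNge.
move=> t st2 [ht kp [h4 h5 h3] v3 v5]; split; first by rewrite /= h5 subnn.
have btE : bt (size s) = bits by rewrite /bt take_size.
rewrite btE in ht h3 v3; rewrite take_size in v5.
run; set st3 := set_nreg _ 7 _.
have k3 : keeps rs vs st1 st3.
  have : keeps rs vs st1 st2 by apply: keeps_sub kp; apply/allP.
  by move=> h; kept.
have q22 : val st3 22 = L%:R.
  rewrite /st3; vals.
  set st' := set_qmem _ _ _; have k' : keeps rs vs st2 st' by kept.
  rewrite (qeval_low k' (a := 0)) //; last by rewrite (keeps_reg kp) // r12.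
  by rewrite (keeps_low kp) ?low1 // ?r12 baseE.
have [d13 d4] : val st3 13 = 1 /\ val st3 4 = 2^-1.
  by rewrite /st3; vals; rewrite (keeps_val kp).
have n7 : nreg st3 7 = (2 - cmp_code 1 L%:R)%N.
  by move: q22; rewrite /st3; vals => ->.
have kz3 (v : nat) : v \in [:: 0; 1; 2] -> val st3 v = val st1 v.
  by rewrite !inE => /or3P[] /eqP ->; rewrite /st3; vals; rewrite (keeps_val kp).
have [g3 g5] : val st3 3 = 2 ^+ bits /\ val st3 5 = coef_bound.
  by rewrite /st3; vals; rewrite v3 v5.
have m3 : nreg st3 3 = bits by rewrite /st3 /=.
clearbody st3.
pose J (j t : nat) st' := [/\ (t <= 3 * j)%N, keeps [:: 7] [:: 4; 13] st3 st',
  val st' 13 = 2 ^+ j, val st' 4 = 2 ^- (2 ^ j)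
  & nreg st' 7 = (2 - cmp_code (2 ^+ j) L%:R)%N].
apply: (@wp_while_iter _ _ _ J (up L)).
- by split; rewrite ?d13 ?d4 ?n7 ?expn0 ?expr1.
- move=> j t' st4 hj [ht' kp4 w13 w4 w7]; split.
    by rewrite /= w7 cmp_code_le -natrX ler_nat leq_up.
  have two : (2 ^+ j + 2 ^+ j : rat) = 2 ^+ j.+1 by rewrite exprS; ring.
  run; rewrite w13 w4 two (keeps_val kp4) // q22; split; [lia | by kept | by vals | | by []].
  by vals; rewrite -invfM -exprD addnn -mul2n -expnS.
move=> t' st4 [ht' kp4 w13 w4 w7]; split.
  apply/eqP; rewrite /= w7 -[_ == _]negbK cmp_code_le -natrX ler_nat -ltnNge.
  exact: ltn_up.
run.
have k4 : keeps rs vs st1 st4.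
  by apply: keeps_trans k3 _ _ => //; apply: keeps_sub kp4; apply/allP.
have kb := keeps_trans k1 k4 isT.
have n42 : nreg st4 2 = base by rewrite (keeps_reg kb).
have lowf a : (a < base)%N -> qmem st4 a = qmem st a.
  by move=> ha; rewrite (keeps_low kb) ?b2.
split.
- by lia.
- split.
  + by rewrite (keeps_reg kb) // regb.
  + by rewrite n42 baseE; lia.
  + by rewrite (keeps_reg kp4).
  + by move=> i hi; rewrite lowf ?he // baseE; lia.
  + by move=> i hi; rewrite lowf ?hc // baseE; lia.
  + by rewrite (keeps_val kp4) // kz3.
  + by rewrite (keeps_val kp4) // kz3.
  + by rewrite (keeps_val kp4) // kz3.
  + by rewrite (keeps_val kp4).
  + by rewrite w4.
  + by rewrite (keeps_val kp4).
  + move=> t0 t0s; apply: leq_trans (ltn_up _) _; rewrite leq_exp2l //.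
    by rewrite /bits (big_rem t0) //= leq_maxl.
- by rewrite (keeps_reg kb) // regb.
- by rewrite n42 baseE.
- by move=> a ha; rewrite lowf // baseE.
Qed.

End Setup.

Definition main_prog : cmd := block
  [:: setup_prog; NSet 8 (NAdd (NLit 1) (NAdd (NReg 0) (NReg 0))); NSet 9 (NReg 1);
      While (NReg 9) (block [:: interval_prog; NSet 9 (NSub (NReg 9) (NLit 1))])].

Lemma nth_flatten_pairs (T : Type) (f g : T -> rat) (l : seq T) (x0 : T) i rest :
  (i < size l)%N ->
  nth 0 (flatten [seq [:: f t; g t] | t <- l] ++ rest) (2 * i) = f (nth x0 l i) /\
  nth 0 (flatten [seq [:: f t; g t] | t <- l] ++ rest) (2 * i).+1 = g (nth x0 l i).
Proof. by elim: l i => [|x l IH] [|i] // lt_il; rewrite mulnS add2n /=; apply: IH. Qed.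

Section Main.
Variables (R : realType) (p : {poly int}) (s : seq (nat * int)) (m L : nat).
Variables (xi : 'I_m -> R) (a b : 'I_m -> rat) (n r : 'I_m -> nat).
Hypothesis sp : sparse_repr p s.
Let K := bits s.
Let H := target_width L.
Let M := coef_bound s.

Definition final (j : 'I_m) : rat * rat := final_pair p (xi j) K H (a j) (b j) (n j) (r j).

Hypothesis hor : forall j, oriented s (xi j) (a j, b j) (orient_value s K M (a j)).
Hypothesis Y0 : forall j, M * (a j + 2) != 0.
Hypothesis n_lt : forall j i, (i < n j)%N -> tower i * H < (cut (xi j) H (a j, b j)).2.
Hypothesis n_le : forall j, (cut (xi j) H (a j, b j)).2 <= tower (n j) * H.
Hypothesis r_lt : forall j i, (i < r j)%N -> H < width (iter i
  (round p (xi j) (n j).+1 (3 * K + 20)) (start_pair (xi j) K H (a j) (b j) (n j))).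
Hypothesis r_le : forall j, width (final j) <= H.

Definition main_cost : nat := (3 * size s + 2 * K + 3 * up L + 1 +
  \sum_(j < m) interval_cost s K (n j) (r j))%N.

Lemma main_spec : wp main_prog (init_state s a b L) (fun t st => (t <= main_cost)%N /\
  forall j : 'I_m, left_end s st j = (final j).1 /\ right_end s st j = (final j).2).
Proof.
set st0 := init_state s a b L.
have he i : (i < size s)%N -> qmem st0 (1 + 2 * i)%N = (nth (0%N, 0) s i).1%:R.
  move=> hi; rewrite add1n /=.
  by case: (nth_flatten_pairs (fun t : nat * int => t.1%:R) (fun t => t.2%:~R) (0%N, 0)
       (flatten [seq [:: a j; b j] | j <- enum 'I_m]) hi).
have hc i : (i < size s)%N -> qmem st0 (2 + 2 * i)%N = (nth (0%N, 0) s i).2%:~R.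
  move=> hi; rewrite add2n /=.
  by case: (nth_flatten_pairs (fun t : nat * int => t.1%:R) (fun t => t.2%:~R) (0%N, 0)
       (flatten [seq [:: a j; b j] | j <- enum 'I_m]) hi).
have := @setup_spec s m L st0 erefl erefl erefl he hc.
have la (j : 'I_m) : qmem st0 (1 + 2 * size s + 2 * j)%N = a j := left_end_init s a b L j.
have lb (j : 'I_m) : qmem st0 (2 + 2 * size s + 2 * j)%N = b j := right_end_init s a b L j.
clearbody st0; move=> hsetup.
rewrite /main_prog; run; apply: wp_mono hsetup _ => t1 st1 [ht1 e1 m1 b1 low1].
run; rewrite (env_size e1) m1; set st2 := set_nreg _ 9 _.
have k2 : keeps [:: 8; 9] [::] st1 st2 by kept.
have e2 := env_keeps e1 k2 isT isT.
have [n8 n9] : nreg st2 8 = (1 + 2 * size s)%N /\ nreg st2 9 = m by rewrite /st2 /=; lia.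
have b2 : nreg st2 2 = (1 + 2 * size s + 2 * m)%N by rewrite -b1.
have low2 c : (c < 1 + 2 * size s + 2 * m)%N -> qmem st2 c = qmem st0 c by exact: low1.
clearbody st2; clear k2.
pose c j := interval_cost s K (n j) (r j).
pose I (i t : nat) st := [/\ (t <= \sum_(j < m | (j < i)%N) c j)%N, env s K H M st,
  [/\ nreg st 8 = (1 + 2 * size s + 2 * i)%N, nreg st 9 = (m - i)%N
    & nreg st 2 = (1 + 2 * size s + 2 * m)%N],
  forall j : 'I_m, (i <= j)%N -> left_end s st j = a j /\ right_end s st j = b j
  & forall j : 'I_m, (j < i)%N -> left_end s st j = (final j).1 /\ right_end s st j = (final j).2].
apply: (@wp_while_iter _ _ _ I m).
- split=> //; first by rewrite n8 n9 b2; split; lia.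
  by move=> j _; rewrite /left_end /right_end !low2 ?la ?lb //; have := ltn_ord j; lia.
- move=> i t st3 hi [ht e3 [h8 h9 h2] horig hfin].
  split; first by rewrite /= h9 subn_eq0 -ltnNge.
  pose j := Ordinal hi; have [oa ob] := horig j (leqnn _).
  set A := (1 + 2 * size s + 2 * i)%N in h8.
  have A1 : A.+1 = (2 + 2 * size s + 2 * i)%N by [].
  have h1 : (2 * size s < A)%N by rewrite /A; lia.
  have h3 : (A.+1 < nreg st3 2)%N by rewrite h2 /A; lia.
  have hint := interval_spec sp (@hor j) (Y0 j) (@n_lt j) (n_le j) (@r_lt j) (r_le j)
    e3 h8 h1 h3 oa ob.
  run; apply: wp_mono hint _.
  move=> t' st4 [ht' e4 g8 [g2 g9] [qA qA1 qo]]; run.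
  set st5 := set_nreg _ 9 _.
  have k5 : keeps [:: 9] [::] st4 st5 by kept.
  have l5 (j' : 'I_m) : left_end s st5 j' = left_end s st4 j' by [].
  have r5 (j' : 'I_m) : right_end s st5 j' = right_end s st4 j' by [].
  have other (j' : 'I_m) : j' != i :> nat ->
      left_end s st4 j' = left_end s st3 j' /\ right_end s st4 j' = right_end s st3 j'.
    move=> /eqP ne; have hj := ltn_ord j'.
    by rewrite /left_end /right_end !qo // ?h2 /A ?A1; first [lia | apply/eqP; lia].
  split.
  + rewrite (bigD1 j) //=; apply: leq_trans (_ : t + c j <= _)%N; first by rewrite /c; lia.
    rewrite addnC leq_add2l; apply: leq_trans ht _; rewrite [leqRHS](eq_bigl (fun j' : 'I_m => (j' < i)%N)) //.
    move=> j'; rewrite -(inj_eq val_inj) /= ltnS leq_eqVlt.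
    by case: eqVneq => [->|]; rewrite ?ltnn ?andbF ?andbT.
  + exact: env_keeps e4 k5 isT isT.
  + by rewrite /= g8 g9 g2 h9 h2 /A; split; lia.
  + move=> j' hj'; rewrite l5 r5; have [|-> ->] := other j'; first by rewrite neq_ltn hj' orbT.
    by apply: horig; apply: ltnW.
  + move=> j'; rewrite ltnS leq_eqVlt l5 r5 => /orP[/eqP ej|hj'].
      have -> : j' = j by apply: val_inj.
      by split; [rewrite /left_end qA | rewrite /right_end -[LHS]/(qmem st4 A.+1) qA1].
    have [|-> ->] := other j'; first by rewrite neq_ltn hj'.
    exact: hfin.
- move=> t st3 [ht e3 [h8 h9 h2] _ hfin]; split; first by rewrite /= h9 subnn.
  run; split; last by move=> j; apply: hfin.
  rewrite /main_cost -/K; apply: leq_trans (_ : (3 * size s + 2 * K + 3 * up L + 1) +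
    \sum_(j < m | (j < m)%N) c j <= _)%N; first by lia.
  by rewrite leq_add2l (eq_bigl xpredT) ?leqnn // => j; rewrite ltn_ord.
Qed.

End Main.

(** * Cost of the refinement *)

Section StartPair.
Variables (R : realType) (xi : R).
Implicit Types (J : rat * rat).

Lemma geo_encloses n J : encloses xi J -> encloses xi (geo xi n J).
Proof. by elim: n J => //= n IH J h; apply/IH/cut_encloses. Qed.

Lemma geo_subint n J : subint (geo xi n J) J.
Proof.
elim: n J => [|n IH] J /=; first exact: subint_refl.
exact: subint_trans (cut_subint _ _ _) (IH _).
Qed.

Lemma geo_ratio n J : 0 < J.1 -> J.2 <= J.1 * tower n ->
  (geo xi n J).2 <= (geo xi n J).1 * 2.
Proof.
elim: n J => [|n IH] J J0 hJ /=; first exact: hJ.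
have T2 := tower_ge2 n; set y := J.1 * tower n.
have yJ : J.1 < y by rewrite /y; nra.
have hJ' : J.2 <= y * tower n by rewrite /y -mulrA -towerS.
apply: IH; rewrite /cut; case: ifPn => [/andP[_ h2]|].
- by case: ifP => _ /=; [|case: ifP => _ /=]; lra.
- by [].
- case: ifP => _ /=; first exact: hJ'.
  by case: ifP => _ /=; rewrite // ?ler_peMr //; lra.
- by rewrite yJ /= -leNgt.
Qed.

(** Since [0 <= J.1], the part of the pair below [H] has width at most [H]. *)
Lemma cut_low_width (H : rat) J : 0 <= J.1 -> encloses xi J ->
  H < width (cut xi H J) -> H <= (cut xi H J).1.
Proof.
move=> J0 hJ; rewrite /cut /width; case: ifPn => [/andP[h1 h2]|].
  by case: ifP => _ /=; [|case: ifP => _ /=]; lra.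
by rewrite negb_and -!leNgt => /orP[//|]; lra.
Qed.

(** The last bound is why the rounds use [n.+1] powers: the pair lies below [tower n * H], and twice
    this is still at most [tower n.+1 * H]; so a round of successful steps ends the refinement. *)
Lemma start_pair_spec K H a b n : 0 <= a -> encloses xi (a, b) ->
  let J1 := cut xi H (a, b) in let S := start_pair xi K H a b n in
  [/\ encloses xi S, subint S (a, b) & H < width S -> 0 < H ->
    J1.2 <= tower n * H ->
    [/\ 0 < S.1, width S * 2 ^+ (3 * K + 20) <= S.1,
        width S * 2 ^+ (3 * K + 20) <= b - a & 2 * width S < H * tower n.+1]].
Proof.
move=> a0 hab J1 S.
have hJ1 : encloses xi J1 by apply: cut_encloses.
have sJ1 : subint J1 (a, b) by apply: cut_subint.
pose J2 := geo xi n.+1 J1.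
have hJ2 : encloses xi J2 by apply: geo_encloses.
have sJ2 : subint J2 J1 by apply: geo_subint.
have [hS sS wS] := bisects (3 * K + 20) hJ2.
rewrite -/(start_pair xi K H a b n) -/S in hS sS wS.
split=> //; first exact: subint_trans (subint_trans sJ1 sJ2) sS.
move=> HS H0 hn.
have sSJ1 := subint_trans sJ2 sS.
have wJ1 : H < width J1 by apply: lt_le_trans HS (subint_width sSJ1).
have lbJ1 : H <= J1.1 by apply: cut_low_width.
have J10 : 0 < J1.1 by lra.
have T2 := tower_ge2 n; have T2' := tower_ge2 n.+1.
have r1 : J1.2 <= J1.1 * tower n by apply: le_trans hn _; rewrite mulrC ler_wpM2r //; lra.
have r2 : J2.2 <= J2.1 * 2.
  apply: geo_ratio => //; apply: le_trans r1 _; rewrite ler_wpM2l ?tower_leS //; lra.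
have /andP[l1 u1] := sJ2; have /andP[l2 u2] := sS.
have B0 : 0 < 2 ^+ (3 * K + 20) :> rat by rewrite exprn_gt0.
rewrite ler_pdivlMr // in wS.
have w2 : width J2 <= b - a by apply: subint_width (subint_trans sJ1 sJ2).
have w2' : width J2 <= J2.1 by rewrite /width; lra.
split; [lra | lra | lra |].
have wS' : width S < J1.2 by rewrite /width; lra.
have : 0 < tower n * H by rewrite mulr_gt0 //; lra.
rewrite towerS => TH.
have : 2 * (tower n * H) <= tower n * (tower n * H) by rewrite ler_wpM2r // ltW.
by lra.
Qed.

End StartPair.

(** The bisections alone at least halve the width in each round. This crude rate ensures that the
    rounds come to an end, whatever the steps do. *)
Lemma round_iter_spec (R : realType) p (xi : R) n K J i : encloses xi J ->
  let it := iter i (round p xi n (3 * K + 20)) J in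
  [/\ encloses xi it, subint it J & width it * 2 ^+ i <= width J].
Proof.
move=> hJ; elim: i => [|i [h1 h2 h3]] /=.
  by split; [exact: hJ | exact: subint_refl | rewrite expr0 mulr1].
set it := iter i _ J in h1 h2 h3 *.
have [h4 h5 h6] := round_spec p n (3 * K + 20) h1.
split; [exact: h4 | exact: subint_trans h2 h5 |].
have hD := descent_subint p xi n (ascent p xi n it).
have wD := le_trans (subint_width hD) (subint_width (ascent_subint p xi n it)).
have w0 := encloses_width h1; have w0' := encloses_width h4.
have B2 : 2 <= 2 ^+ (3 * K + 20) :> rat.
  by rewrite addnS exprS; have : 1 <= 2 ^+ (3 * K + 19) :> rat by [rewrite exprn_ege1]; lra.
have h7 : width (round p xi n (3 * K + 20) it) * 2 <= width it.
  apply: le_trans wD; rewrite ler_pdivlMr in h6; last by lra.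
  by apply: le_trans h6; rewrite ler_wpM2l.
apply: le_trans h3; rewrite exprS mulrA ler_wpM2r // exprn_ge0 //.
Qed.

Lemma exists_round_count (R : realType) p (xi : R) n K (H : rat) J : 0 < H -> encloses xi J ->
  exists r, width (iter r (round p xi n (3 * K + 20)) J) <= H /\
    forall i, (i < r)%N -> H < width (iter i (round p xi n (3 * K + 20)) J).
Proof.
move=> H0 hJ.
have ex : exists r, width (iter r (round p xi n (3 * K + 20)) J) <= H.
  exists (Num.bound (width J / H)); set i := Num.bound _.
  have [_ _ h] := round_iter_spec p n K i hJ.
  have : width J / H < 2 ^+ i by apply: upper_nthrootP.
  have B0 : 0 < 2 ^+ i :> rat by rewrite exprn_gt0.
  rewrite ltr_pdivrMr // mulrC => h2; rewrite -(ler_pM2r B0).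
  exact: le_trans h (ltW h2).
case: (ex_minnP ex) => r hr hmin; exists r; split=> // i ir.
by rewrite ltNge; apply: contraTN ir => /hmin; rewrite -leqNgt.
Qed.

(** * Open intervals with rational ends, and binary logarithms *)

Section OpenIntervals.
Variable R : realType.
Implicit Types (a b : rat) (x y : R).

Lemma ointE a b x : oint a b x <-> ratr a < x < ratr b.
Proof. by rewrite /oint /= in_itv. Qed.

(** An end outside []0, u[] would leave points of the interval outside as well: a midpoint, moved
    back into the interval if necessary by a minimum or maximum with [x]. *)
Lemma oint_bounds a b x (u : R) : oint a b x -> oint (R := R) a b `<=` `]0, u[ ->
  0 <= a /\ ratr b <= u.
Proof.
move=> /ointE/andP[ax xb] sub; split.
  rewrite -(ler_rat R) rmorph0 leNgt; apply/negP => a0.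
  have /sub : oint (R := R) a b (Num.min ((ratr a + 0) / 2) x).
    apply/ointE; case: (leP ((ratr a + 0) / 2) x) => h; first by apply/andP; split; lra.
    by rewrite ax.
  rewrite /= in_itv /= => /andP[h _].
  have : Num.min ((ratr a + 0) / 2) x <= (ratr a + 0) / 2 by rewrite ge_min lexx.
  by lra.
rewrite leNgt; apply/negP => ub.
have /sub : oint (R := R) a b (Num.max ((u + ratr b) / 2) x).
  apply/ointE; case: (leP ((u + ratr b) / 2) x) => h; first by rewrite ax.
  by apply/andP; split; lra.
rewrite /= in_itv /= => /andP[_ h].
have : (u + ratr b) / 2 <= Num.max ((u + ratr b) / 2) x by rewrite le_max lexx.
by lra.
Qed.

Lemma oint_disjoint a b a' b' x x' : oint a b x -> oint a' b' x' ->
  (forall y, ~ (oint a b y /\ oint a' b' y)) -> b <= a' \/ b' <= a.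
Proof.
move=> /ointE/andP[h1 h2] /ointE/andP[h3 h4] dis.
have [|ba] := leP b a'; first by left.
have [|ba'] := leP b' a; first by right.
rewrite -(ltr_rat R) in ba; rewrite -(ltr_rat R) in ba'.
set u := Num.max (ratr a : R) (ratr a'); set v := Num.min (ratr b : R) (ratr b').
have uv : u < v by rewrite lt_min !gt_max ba ba' (lt_trans h1 h2) (lt_trans h3 h4).
have [u1 u2] : ratr a <= u /\ ratr a' <= u by rewrite !le_max !lexx orbT.
have [v1 v2] : v <= ratr b /\ v <= ratr b' by rewrite !ge_min !lexx orbT.
by case: (dis ((u + v) / 2)); split; apply/ointE; apply/andP; split; lra.
Qed.

Lemma encloses_refines L a b (J : rat * rat) x : oint a b x -> encloses x J ->
  subint J (a, b) -> width J < 2 ^- L -> refines L a b J.1 J.2 x.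
Proof.
move=> /ointE/andP[ax xb] hJ /andP[/= s1 s2] wJ; split=> //.
  rewrite /rint; case: eqVneq => e y.
    move=> ->; apply/ointE; have /andP[h1 h2] := encloses_le hJ.
    case: hJ => [[h3 h4]|[_ <-]]; last by rewrite ax.
    by have := lt_trans h3 h4; rewrite e ltxx.
  move=> /ointE/andP[h1 h2]; apply/ointE.
  by rewrite (le_lt_trans _ h1) ?(lt_le_trans h2) ?ler_rat.
rewrite /rint; case: eqVneq => e.
  by case: hJ => [[h3 h4]|[_ ->] //]; have := lt_trans h3 h4; rewrite e ltxx.
apply/ointE; case: hJ => [[-> ->] //|[h _]]; by rewrite h eqxx in e.
Qed.

Lemma lg_ge1 m : 1 <= lg R m.
Proof. by rewrite /lg le_max lexx. Qed.

Lemma lg_trunc_log m : (0 < m)%N -> (trunc_log 2 m).+1%:R <= 2 * lg R m.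
Proof.
move=> m0; have h1 := lg_ge1 m.
have h2 : ln m%:R / ln 2 <= lg R m by rewrite /lg le_max lexx orbT.
have ln2 : 0 < ln 2 :> R by rewrite ln_gt0 // ltr1n.
suff : (trunc_log 2 m)%:R <= ln m%:R / ln 2 :> R by rewrite -natr1; lra.
rewrite ler_pdivlMr // mulr_natl -lnXn // ler_ln ?posrE ?exprn_gt0 ?ltr0n //.
by rewrite -natrX ler_nat trunc_logP.
Qed.

End OpenIntervals.

(** * What the list of terms tells about the polynomial *)

Section Input.
Variables (p : {poly int}) (s : seq (nat * int)).
Hypothesis sp : sparse_repr p s.

Lemma mem_sparse t : (t \in s) = [&& (t.1 < size p)%N, p`_t.1 != 0 & t.2 == p`_t.1].
Proof.
rewrite (perm_mem sp); apply/mapP/idP => [[e]|/and3P[h1 h2 /eqP h3]].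
  by rewrite mem_filter mem_iota /= add0n => /andP[h1 h2] -> /=; rewrite h1 h2 eqxx.
exists t.1; first by rewrite mem_filter mem_iota /= add0n h2.
by rewrite -h3; case: (t).
Qed.

Lemma size_sparse : size s = size [seq i <- iota 0 (size p) | p`_i != 0].
Proof. by rewrite (perm_size sp) size_map. Qed.

Lemma size_sparse_count : size s = count (predC1 0%R) p.
Proof.
rewrite size_sparse size_filter -[in RHS](mkseq_nth 0 p) /mkseq count_map.
by apply: eq_count.
Qed.

Lemma coef_bound_abs_sum : coef_bound s = 1 + abs_sum p.
Proof.
rewrite /coef_bound /abs_sum (perm_big _ sp) /= big_map big_filter.
rewrite -(big_mkord xpredT (fun i => `|(p`_i)%:~R : rat|)) /index_iota subn0.
rewrite big_mkcond; congr (_ + _); apply: eq_bigr => i _ /=.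
by case: eqVneq => //= ->; rewrite normr0.
Qed.

Lemma size_le_bits : (size p <= 2 ^ bits s)%N.
Proof.
have [->|p0] := eqVneq p 0; first by rewrite size_poly0.
have h : ((size p).-1, lead_coef p) \in s.
  by rewrite mem_sparse /= prednK ?size_poly_gt0 // leqnn -lead_coefE lead_coef_eq0 p0 eqxx.
have : ((size p).-1 < 2 ^ bits s)%N.
  apply: leq_trans (ltn_up _) _; rewrite leq_exp2l // /bits (big_rem _ h) //= leq_maxl //.
by rewrite prednK ?size_poly_gt0.
Qed.

Lemma leq_up_mono e f : (e <= f)%N -> (up e <= up f)%N.
Proof.
move=> ef; rewrite leqNgt; apply/negP => /leq_up h.
by have := leq_ltn_trans (leq_trans h ef) (ltn_up f); rewrite ltnn.
Qed.

Lemma bits_le n : (size p <= n.+1)%N -> (bits s <= up n)%N.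
Proof.
move=> pn; apply/bigmax_leqP_seq => t; rewrite mem_sparse => /andP[h _] _.
by apply: leq_up_mono; rewrite -ltnS (leq_trans h).
Qed.

Lemma lsum_horner (R : realType) (y : rat) :
  ratr (lsum s 0 y) = (map_poly intr p : {poly R}).[ratr y].
Proof.
rewrite (lsum_wsum _ _ sp) wsum0.
have -> : (map_poly intr p : {poly R}) = map_poly ratr (map_poly intr p : {poly rat}).
  by rewrite -map_poly_comp; apply: eq_map_poly => z /=; rewrite ratr_int.
by rewrite horner_map.
Qed.

(** If [a] is a root, the separation bound is used twice: the shifted point is not a root, and it
    has not passed [xi], which is itself a root to the right of [a]. *)
Lemma orient_valueP (R : realType) (xi : R) (a b : rat) : p != 0 -> 0 <= a ->
  ratr a < xi -> xi < ratr b -> mup xi (map_poly intr p) = 1%N ->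
  (forall x, ratr a < x < ratr b -> root (map_poly intr p) x -> x = xi) ->
  oriented s xi (a, b) (orient_value s (bits s) (coef_bound s) a).
Proof.
move=> p0 a0 axi xib m1 only; set M := coef_bound s.
have hM : 1 + abs_sum p <= M by rewrite /M coef_bound_abs_sum.
have abs0 : 0 <= abs_sum p by apply: sumr_ge0.
set e := (M * (a + 2)) ^- (2 ^ bits s).
have e0 : 0 < e by rewrite invr_gt0 exprn_gt0 // mulr_gt0; lra.
set P : {poly R} := map_poly intr p in m1 only *.
suff H : exists c : rat, [/\ orient_value s (bits s) M a = lsum s 0 c,
    ratr a <= (ratr c : R) < xi & P.[ratr c] != 0].
  case: H => c [cE cxi Pc] y /andP[/= ay yb].
  have := simple_root_sgr m1 only cxi xib Pc (y := ratr y).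
  rewrite !ltr_rat ay yb => /(_ isT).
  rewrite -!lsum_horner // -rmorphM /= => sg.
  rewrite cE -(ltrq0 R) -sgr_lt0 sg sgr_lt0 subr_lt0; split=> //.
  by rewrite -(fmorph_eq0 (@ratr R)) -sgr_eq0 sg sgr_eq0 subr_eq0 eq_sym.
rewrite /orient_value; case: eqVneq => pa; last first.
  exists a; rewrite lexx axi; split=> //.
  by rewrite -lsum_horner fmorph_eq0.
have ra : root (map_poly intr p : {poly rat}) a.
  by rewrite rootE -wsum0 -(lsum_wsum _ _ sp) pa.
have nr := @no_root_right_of_root R p a M _ p0 ra a0 hM size_le_bits.
exists (a + e); rewrite rmorphD.
have re0 : 0 < ratr e :> R by rewrite ltr0q.
split=> //.
  rewrite lerDl (ltW re0) /= -ltrBrDl ltNge; apply/negP => h.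
  have := nr (xi - ratr a); rewrite subr_gt0 axi [ratr a + _]addrC subrK => /(_ isT h).
  by apply/negP/negPn; apply: contraTT isT => /mupNroot; rewrite m1.
by have := nr (ratr e) re0 (lexx _); rewrite rootE.
Qed.

End Input.

(** * Summing up the cost *)

Lemma interval_cost_le s K n r k X Z : (0 < k)%N -> (0 < X)%N -> (X < Z)%N ->
  (size s <= k)%N -> (K <= X)%N -> (n <= Z + 2)%N ->
  (interval_cost s K n r <= 600 * (Z * (k * X)) + r * (900 * (Z * (k * X))))%N.
Proof.
move=> k0 X0 XZ sk KX nZ; set A := (k * X)%N; set W := (Z * A)%N.
have XA : (X <= A)%N by rewrite leq_pmull.
have ZW : (Z <= W)%N by rewrite leq_pmulr // muln_gt0 k0.
have AW : (A <= W)%N by rewrite leq_pmull // (leq_ltn_trans _ XZ).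
have kA : (k <= A)%N by rewrite leq_pmulr.
have hE : (eval_cost s K <= 11 * A)%N.
  rewrite /eval_cost; apply: leq_trans (leq_mul sk (_ : 5 * K + 6 <= 11 * X)%N) _; first by lia.
  by rewrite /A; lia.
have h1 : (n.+1 * (3 * eval_cost s K + 23) <= (4 * Z) * (56 * A))%N by apply: leq_mul; lia.
have h2 : ((3 * K + 20) * (eval_cost s K + 6) <= (23 * Z) * (17 * A))%N by apply: leq_mul; lia.
have h3 : (n.+1 * (eval_cost s K + 5) <= (4 * Z) * (16 * A))%N by apply: leq_mul; lia.
have e1 : ((4 * Z) * (56 * A) = 224 * W)%N by rewrite /W; ring.
have e2 : ((23 * Z) * (17 * A) = 391 * W)%N by rewrite /W; ring.
have e3 : ((4 * Z) * (16 * A) = 64 * W)%N by rewrite /W; ring.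
rewrite e1 in h1; rewrite e2 in h2; rewrite e3 in h3.
rewrite /interval_cost /round_cost.
have h4 : (r * (2 * (n.+1 * (3 * eval_cost s K + 23)) +
    (3 * K + 20) * (eval_cost s K + 6) + 2) <= r * (900 * W))%N.
  by rewrite leq_mul2l; apply/orP; right; lia.
clearbody A W; lia.
Qed.

(** [X] and [Z] stand for [log n] and [log n + log (tau + L)]. The preparation of an interval and
    each of its rounds cost O([Z k X]), with at most [k] preparations and [3 k] rounds in all. *)
Lemma main_cost_le s m L (n r : 'I_m -> nat) k X Z : (0 < k)%N -> (0 < X)%N -> (X < Z)%N ->
  (size s <= k)%N -> (m <= k)%N -> (bits s <= X)%N -> (up L <= Z)%N ->
  (forall j, n j <= Z + 2)%N -> (\sum_j r j <= 3 * k)%N ->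
  (main_cost s L n r <= 4000 * (k * (Z * (k * X))))%N.
Proof.
move=> k0 X0 XZ sk mk KX LZ nZ hr; rewrite /main_cost.
set W := (Z * (k * X))%N.
have sum_le : (\sum_(j < m) interval_cost s (bits s) (n j) (r j) <=
    m * (600 * W) + (\sum_j r j) * (900 * W))%N.
  rewrite big_distrl /= -[X in (X * (600 * W))%N]card_ord -sum_nat_const -big_split /=.
  by apply: leq_sum => j _; apply: interval_cost_le.
have ZW : (Z <= W)%N by rewrite leq_pmulr // muln_gt0 k0.
have W0 : (0 < W)%N by apply: leq_trans ZW; apply: leq_ltn_trans XZ.
have kW : (k <= k * W)%N by rewrite leq_pmulr.
have WkW : (W <= k * W)%N by rewrite leq_pmull.
have h1 : (m * (600 * W) <= k * (600 * W))%N by rewrite leq_mul2r mk orbT.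
have h2 : ((\sum_j r j) * (900 * W) <= (3 * k) * (900 * W))%N by rewrite leq_mul2r hr orbT.
have e1 : (k * (600 * W) = 600 * (k * W))%N by ring.
have e2 : ((3 * k) * (900 * W) = 2700 * (k * W))%N by ring.
rewrite e1 in h1; rewrite e2 in h2.
clearbody W; lia.
Qed.

Lemma upE n : (0 < n)%N -> up n = (trunc_log 2 n).+1.
Proof. by case: n. Qed.

(** It suffices that [2 ^ N] is at least [tau + 1 + 2 ^ up L], where [2 ^ up L <= 2 L]; two more
    than the number of binary digits of [tau + L] will do. *)
Lemma table_size_exists (c : rat) tau L : (0 < tau)%N -> (0 < L)%N -> c <= 2 ^+ tau.+1 ->
  exists n, [/\ c <= tower n * target_width L,
    forall i, (i < n)%N -> tower i * target_width L < c & (n <= trunc_log 2 (tau + L) + 3)%N].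
Proof.
move=> tau0 L0 hc; set H := target_width L; set N := (trunc_log 2 (tau + L) + 3)%N.
have H0 : 0 < H by rewrite invr_gt0 exprn_gt0.
have hN : c <= tower N * H.
  apply: le_trans hc _; rewrite /H /target_width /tower ler_pdivlMr ?exprn_gt0 //.
  rewrite -exprD ler_eXn2l; last by lra.
  have h1 : (2 ^ up L <= 2 * L)%N.
    by rewrite upE // expnS leq_mul2l trunc_logP.
  have h2 : (tau + L < 2 ^ (trunc_log 2 (tau + L)).+1)%N by rewrite trunc_log_ltn.
  have -> : (2 ^ N = 4 * 2 ^ (trunc_log 2 (tau + L)).+1)%N.
    by rewrite /N addnS addn2 !expnS; lia.
  by move: h1 h2; lia.
case: (ex_minnP (ex_intro (fun n => c <= tower n * H) N hN)) => n hn hmin.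
exists n; split=> //; last exact: hmin.
by move=> i; rewrite ltNge => lt_in; apply/negP => /hmin; rewrite leqNgt lt_in.
Qed.

Lemma mup_poly0 (R : realType) (x : R) : mup x (0 : {poly R}) = 0%N.
Proof.
have : (mup x (0%R : {poly R}) < (size (0%R : {poly R})).+1)%N by apply: ltn_ord.
by rewrite size_poly0 ltnS leqn0 => /eqP.
Qed.

Lemma cost_real (R : realFieldType) (c k X Z : nat) (A B : R) :
  X%:R <= 2 * A -> Z%:R <= 2 * B ->
  (c * (k * (Z * (k * X))))%:R <= (c * 4)%:R * (k%:R ^+ 2 * A * B).
Proof.
move=> hX hZ; have h := ler_pM (ler0n R X) (ler0n R Z) hX hZ.
have h' := ler_wpM2l (mulr_ge0 (ler0n R c) (exprn_ge0 2 (ler0n R k))) h.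
have -> : (c * (k * (Z * (k * X))))%:R = c%:R * k%:R ^+ 2 * (X%:R * Z%:R) :> R.
  by rewrite !natrM; ring.
by apply: le_trans h' _; rewrite natrM le_eqVlt; apply/orP; left; apply/eqP; ring.
Qed.

Theorem corollary8 :
  exists (P : cmd) (C : nat),
  forall (R : realType) (k n tau L : nat) (p : {poly int})
    (s : seq (nat * int)) (k0 : nat) (a b : 'I_k0 -> rat) (xi : 'I_k0 -> R),
  (0 < k)%N -> (0 < n)%N -> (0 < tau)%N -> (0 < L)%N ->
  knomial k n tau p ->
  sparse_repr p s ->
  (forall j, oint (R := R) (a j) (b j) `<=` `]0, 2 ^+ tau.+1[) ->
  isolating p (simple_roots p `]0, 2 ^+ tau.+1[) a b xi ->
  exists (cost : nat) (st : state),
    [/\ exec P (init_state s a b L) cost st,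
        forall j : 'I_k0,
          refines L (a j) (b j) (left_end s st j) (right_end s st j) (xi j)
      & cost%:R <= C%:R * (k%:R ^+ 2 * lg R n * (lg R n + lg R (tau + L)))].
Proof.
exists main_prog, (4000 * 4)%N => R k n tau L p s m a b xi k0 n0 tau0 L0.
move=> [szp cnt _] sp sub [xi_inj xiS xiI only triv].
set K := bits s; set H := target_width L; set M := coef_bound s.
have H0 : 0 < H by rewrite invr_gt0 exprn_gt0.
have simple j : [/\ 0 < xi j & mup (xi j) (map_poly intr p : {poly R}) = 1%N].
  have : range xi (xi j) by exists j.
  by rewrite xiS => -[/=]; rewrite in_itv /= => /andP[h _].
(* Without any interval [p] may be 0, so an index is required: it provides a root of multiplicity 1,
   whereas [mup] vanishes for the zero polynomial. *)
have p_neq0 (j : 'I_m) : p != 0.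
  have [_ h] := simple j; apply: contra_eq_neq h => ->.
  by rewrite rmorph0 mup_poly0.
have a0 j : 0 <= a j /\ ratr (b j) <= 2 ^+ tau.+1 :> R := oint_bounds (xiI j) (sub j).
have ab j : ratr (a j) < xi j /\ xi j < ratr (b j) by have /ointE/andP := xiI j.
have hor j : oriented s (xi j) (a j, b j) (orient_value s K M (a j)).
  have [h1 h2] := ab j; have [_ m1] := simple j.
  apply: (orient_valueP sp (p_neq0 j) (a0 j).1 h1 h2 m1) => x hx rx.
  by apply: (only j) => //; apply/ointE.
have Y0 j : M * (a j + 2) != 0.
  have [h _] := a0 j; have M1 : 1 <= M by rewrite lerDl sumr_ge0.
  by rewrite mulf_neq0 // gt_eqF // ?(lt_le_trans ltr01 M1) // ltr_wpDl.
have enc j : encloses (xi j) (a j, b j) by left; exact: ab.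
pose J1 j := cut (xi j) H (a j, b j).
have bJ1 j : (J1 j).2 <= 2 ^+ tau.+1.
  have /andP[_ h] := cut_subint (xi j) H (a j, b j); apply: le_trans h _.
  by rewrite -(ler_rat R) rmorphXn rmorph_nat; have [] := a0 j.
have /fin_all_exists[nn hnn] : forall j, exists i, [/\ (J1 j).2 <= tower i * H,
    forall i', (i' < i)%N -> tower i' * H < (J1 j).2 & (i <= trunc_log 2 (tau + L) + 3)%N].
  by move=> j; apply: table_size_exists.
pose S j := start_pair (xi j) K H (a j) (b j) (nn j).
have hS j := start_pair_spec K H (nn j) (a0 j).1 (enc j).
have encS j : encloses (xi j) (S j) by have [] := hS j.
have /fin_all_exists[r hr] : forall j, exists i,
    width (iter i (round p (xi j) (nn j).+1 (3 * K + 20)) (S j)) <= H /\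
    forall i', (i' < i)%N -> H < width (iter i' (round p (xi j) (nn j).+1 (3 * K + 20)) (S j)).
  by move=> j; apply: exists_round_count.
have [n_le n_lt] : (forall j, (J1 j).2 <= tower (nn j) * H) /\
    (forall j i, (i < nn j)%N -> tower i * H < (J1 j).2).
  by split=> j; have [] := hnn j.
have [r_le r_lt] : (forall j, width (final p s L xi a b nn r j) <= H) /\
    (forall j i, (i < r j)%N -> H < width (iter i (round p (xi j) (nn j).+1 (3 * K + 20)) (S j))).
  by split=> j; have [] := hr j.
have [cost [st [ex [hcost hst]]]] := main_spec sp hor Y0 n_lt n_le r_lt r_le.
exists cost, st; split=> //.
  move=> j; have [-> ->] := hst j.
  have [_ sS _] := hS j.
  have [e1 e2 _] := round_iter_spec p (nn j).+1 K (r j) (encS j).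
  apply: encloses_refines (xiI j) e1 (subint_trans sS e2) _.
  apply: le_lt_trans (r_le j) _; rewrite /H /target_width.
  by rewrite ltf_pV2 ?posrE ?exprn_gt0 // ltr_eXn2l ?ltn_up //; lra.
have sE := size_sparse sp.
have [sum_r mk] : (\sum_j r j <= m + 2 * size s)%N /\ (m <= size s)%N.
  have [m0|mpos] := posnP m.
    split; last by rewrite m0.
    by rewrite big1 // => j; have := ltn_ord j; rewrite [X in (_ < X)%N]m0.
  pose j0 := Ordinal mpos.
  rewrite sE; apply: (@sum_rounds R p m K H xi a b S (fun j => (nn j).+1) r) => //.
  - exact: p_neq0 j0.
  - exact: size_le_bits.
  - move=> j; have [_ m1] := simple j.
    by apply: contraTT isT => /mupNroot; rewrite m1.
  - by move=> j; have [] := simple j.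
  - move=> i j ij; apply: (oint_disjoint (xiI i) (xiI j)) => y [yi yj].
    by move/eqP: ij; apply; apply: triv => //; exists y.
  - by move=> j rj; have [_ _ h] := hS j; have [] := h (r_lt j 0%N rj) H0 (n_le j).
  - by move=> j rj; have [_ _ h] := hS j; have [] := h (r_lt j 0%N rj) H0 (n_le j).
  - by move=> j rj; have [_ _ h] := hS j; have [] := h (r_lt j 0%N rj) H0 (n_le j).
  - by move=> j rj; have [_ _ h] := hS j; have [] := h (r_lt j 0%N rj) H0 (n_le j).
  - by move=> j i ir; apply: ltW; apply: r_lt.
have sk : (size s <= k)%N by rewrite (size_sparse_count sp).
set X := (trunc_log 2 n).+1; set l := trunc_log 2 (tau + L).
have KX : (K <= X)%N by rewrite /X -upE //; apply: bits_le sp _ szp.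
have LZ : (up L <= X + l.+1)%N.
  rewrite -(upE (_ : 0 < tau + L)%N) ?addn_gt0 ?tau0 //.
  by apply: leq_trans (leq_addl _ _); apply: leq_up_mono; apply: leq_addl.
have hmc : (main_cost s L nn r <= 4000 * (k * ((X + l.+1) * (k * X))))%N.
  apply: main_cost_le => //.
  - by rewrite addnS ltnS leq_addr.
  - exact: leq_trans mk sk.
  - by move=> j; have [_ _ h] := hnn j; apply: leq_trans h _; rewrite /X; lia.
  - by apply: leq_trans sum_r _; lia.
have hX : X%:R <= 2 * lg R n by apply: lg_trunc_log.
have hl : l.+1%:R <= 2 * lg R (tau + L) by apply: lg_trunc_log; rewrite addn_gt0 tau0.
have hZ : (X + l.+1)%:R <= 2 * (lg R n + lg R (tau + L)) by rewrite natrD mulrDr lerD.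
apply: le_trans (cost_real 4000 k hX hZ); rewrite ler_nat; exact: leq_trans hmc.
Qed.
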